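(* Let $\mathcal{K}$ be a tame prime knot class and let $p_{n}\in\mathcal{P}_{n}(\mathcal{K})$ be such that $$\Big|\inf_{\mathcal{P}_{n}(\mathcal{K})}\mathcal{E}_{n}-\mathcal{E}_{n}(p_{n})\Big|\to 0\qquad\text{and}\qquad p_{n}\to\gamma\in\mathcal{C}(\mathcal{K})\ \text{ in } L^{1}(\mathbb{S}_{1},\mathbb{R}^{d})$$ as $n\to\infty$. Then $\gamma$ is a minimizer of $\mathcal{E}$ in $\mathcal{C}(\mathcal{K})$ and $\lim_{n\to\infty}\mathcal{E}_{n}(p_{n})=\mathcal{E}(\gamma)$.
   Context: $\mathbb{S}_{L}$ is the circle of length $L$ and $d(\cdot,\cdot)$ its intrinsic (shortest arc) metric; $\mathbb{R}^{d}$ is the ambient Euclidean space (prime knots are understood in the usual sense, i.e. in $\mathbb{R}^3$, so $d=3$). $\mathcal{C}$ is the set of closed curves $\gamma:\mathbb{S}_{1}\to\mathbb{R}^{d}$ of length $1$ parametrised by arc length (Lipschitz, $|\gamma'|=1$ a.e.). Möbius energy of $\gamma\in\mathcal{C}$: $$\mathcal{E}(\gamma)=\int_{\mathbb{S}_{1}}\int_{\mathbb{S}_{1}}\Big(\frac{1}{|\gamma(t)-\gamma(s)|^{2}}-\frac{1}{d(t,s)^{2}}\Big)\,ds\,dt\in[0,\infty],$$ where $1/0=+\infty$. $\mathcal{P}_{n}\subset\mathcal{C}$ is the set of closed equilateral polygons with $n$ segments, i.e. those $p\in\mathcal{C}$ for which there are consecutive points $a_{1},\dots,a_{n}$ on $\mathbb{S}_{1}$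 (indices mod $n$) with $d(a_{i+1},a_{i})=1/n$ such that $p$ is affine on each arc $[a_{i},a_{i+1}]$. Discrete Möbius energy of $p\in\mathcal{P}_{n}$: $$\mathcal{E}_{n}(p)=\sum_{\substack{i,j=1\\ i\neq j}}^{n}\Big(\frac{1}{|p(a_{j})-p(a_{i})|^{2}}-\frac{1}{d(a_{j},a_{i})^{2}}\Big)d(a_{i+1},a_{i})\,d(a_{j+1},a_{j}).$$ A knot class is an ambient isotopy class of embedded closed curves; it is tame if it contains a polygonal curve. For a set $\mathcal{A}$ of curves, $\mathcal{A}(\mathcal{K})$ is the subset of those curves in $\mathcal{A}$ that belong to $\mathcal{K}$. The sequence $p_n$ is indexed by all $n$ large enough that $\mathcal{P}_n(\mathcal{K})$ is nonempty. *)

(* Defs.v *)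
From HB Require Import structures.
From mathcomp Require Import all_boot all_order all_algebra.
From mathcomp Require Import all_classical all_reals all_analysis.

Set Implicit Arguments.
Unset Strict Implicit.
Unset Printing Implicit Defensive.

Import Order.TTheory GRing.Theory Num.Theory.
Import numFieldNormedType.Exports.

Local Open Scope classical_set_scope.
Local Open Scope ring_scope.

(* The library norm on row vectors is the sup norm (it induces the same topology
   and the same Lipschitz maps), so the Euclidean one is introduced here. *)
Definition enorm {R : realType} {d : nat} (x : 'rV[R]_d) : R :=
  Num.sqrt (\sum_(i < d) x ord0 i ^+ 2).

(* The circle S_1 is R/Z: its points are represented by real numbers modulo
   integers, and maps on S_1 by 1-periodic maps on R. *)
Definition circle_dist {R : realType} (t s : R) : R :=
  let x := (t - s) - (Num.floor (t - s))%:~R in Num.min x (1 - x).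

Definition closed_curve {R : realType} {d : nat} (c : R -> 'rV[R]_d) : Prop :=
  continuous c /\ forall t, c (t + 1) = c t.

Definition embedded {R : realType} {d : nat} (c : R -> 'rV[R]_d) : Prop :=
  closed_curve c /\ forall s t, c s = c t -> exists k : int, t = s + k%:~R.

(* The length is 1 because the parameter circle has length 1. *)
Definition arclength_curves {R : realType} {d : nat} : set (R -> 'rV[R]_d) :=
  [set c | [/\ closed_curve c, lipschitz c &
    {ae lebesgue_measure, forall t : R, derivable c t 1 /\ enorm (derive1 c t) = 1}]].

(* The inverse is that of extended reals, for which 0^-1 = +oo. On the diagonal
   t = s (mod 1), a null set, the integrand is the irrelevant value +oo - +oo. *)
Definition moebius_energy {R : realType} {d : nat} (c : R -> 'rV[R]_d) : \bar R :=
  (\int[lebesgue_measure]_(t in `[0%R, 1%R])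
   \int[lebesgue_measure]_(s in `[0%R, 1%R])
     (((enorm (c t - c s)) ^+ 2)%:E^-1 - ((circle_dist t s) ^+ 2)%:E^-1))%E.

(* a 0 < ... < a n are lifts to R of consecutive points of the circle, a n being
   the point a 0 reached again after one turn. *)
Definition consecutive {R : realType} (n : nat) (a : nat -> R) : Prop :=
  (forall i : nat, (i < n)%N -> a i < a i.+1) /\ a n = a 0%N + 1.

Definition affine_on {R : realType} {d : nat} (c : R -> 'rV[R]_d) (s t : R) : Prop :=
  exists u v : 'rV[R]_d, forall r, s <= r <= t -> c r = u + r *: v.

Definition polygonal_at {R : realType} {d : nat} (n : nat) (a : nat -> R)
    (c : R -> 'rV[R]_d) : Prop :=
  consecutive n a /\ forall i : nat, (i < n)%N -> affine_on c (a i) (a i.+1).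

Definition polygonal {R : realType} {d : nat} (c : R -> 'rV[R]_d) : Prop :=
  closed_curve c /\ exists n a, polygonal_at n a c.

Definition equilateral_vertices {R : realType} {d : nat} (n : nat)
    (c : R -> 'rV[R]_d) : set (nat -> R) :=
  [set a | polygonal_at n a c /\
    forall i : nat, (i < n)%N -> circle_dist (a i.+1) (a i) = n%:R^-1].

Definition equilateral_polygons {R : realType} {d : nat} (n : nat) :
    set (R -> 'rV[R]_d) :=
  [set c | arclength_curves c /\ equilateral_vertices n c !=set0].

(* A closed non-constant curve has at most one equilateral vertex set, up to
   cyclic relabelling and integer translations; hence the value does not depend
   on the vertices selected by get. *)
Definition discrete_energy {R : realType} {d : nat} (n : nat)
    (c : R -> 'rV[R]_d) : \bar R :=
  let a := get (equilateral_vertices n c) in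
  (\sum_(i < n) \sum_(j < n | j != i)
     (((enorm (c (a j) - c (a i))) ^+ 2)%:E^-1
        - ((circle_dist (a j) (a i)) ^+ 2)%:E^-1)
     * (circle_dist (a i.+1) (a i))%:E * (circle_dist (a j.+1) (a j))%:E)%E.

Definition homeomorphism {T : topologicalType} (f : T -> T) : Prop :=
  continuous f /\ exists g : T -> T, [/\ continuous g, cancel f g & cancel g f].

Definition ambient_isotopic {R : realType} (A B : set 'rV[R]_3) : Prop :=
  exists H : R -> 'rV[R]_3 -> 'rV[R]_3,
    [/\ {within `[0, 1] `*` setT,
           continuous (fun z : R * 'rV[R]_3 => H z.1 z.2)},
        forall t, 0 <= t <= 1 -> homeomorphism (H t),
        forall x, H 0 x = x &
        H 1 @` A = B].

(* Knots are unoriented and considered up to reparametrization. *)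
Definition knot_class {R : realType} (K : set (R -> 'rV[R]_3)) : Prop :=
  exists c : R -> 'rV[R]_3, embedded c /\
    K = [set c' | embedded c' /\ ambient_isotopic (range c) (range c')].

Definition tame {R : realType} (K : set (R -> 'rV[R]_3)) : Prop :=
  exists2 c, K c & polygonal c.

Definition round_circle {R : realType} (t : R) : 'rV[R]_3 :=
  \row_(i < 3) [:: cos (2 * pi * t); sin (2 * pi * t); 0]`_i.

Definition trivial_knot {R : realType} (K : set (R -> 'rV[R]_3)) : Prop :=
  K round_circle.

Definition segment {R : realType} {d : nat} (x y : 'rV[R]_d) : set 'rV[R]_d :=
  [set x + r *: (y - x) | r in `[0, 1]].

Definition inner {R : realType} {d : nat} (x y : 'rV[R]_d) : R :=
  \sum_(i < d) x ord0 i * y ord0 i.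

(* K is a connected sum of K1 and K2: a polygonal representative c of K meets the
   plane inner nu x = h exactly in the two points c s and c t, the two arcs
   between them lie on opposite sides of the plane, and closing each arc by the
   segment from c s to c t yields knots in K1 and K2. *)
Definition connected_sum {R : realType} (K K1 K2 : set (R -> 'rV[R]_3)) : Prop :=
  exists c c1 c2 : R -> 'rV[R]_3, exists nu : 'rV[R]_3, exists h s t : R,
    [/\ K c, polygonal c & s < t < s + 1] /\
    [/\ inner nu (c s) = h, inner nu (c t) = h,
        forall r, s < r < t -> h < inner nu (c r) &
        forall r, t < r < s + 1 -> inner nu (c r) < h] /\
    [/\ K1 c1, K2 c2,
        range c1 = (c @` `[s, t]) `|` segment (c s) (c t) &
        range c2 = (c @` `[t, s + 1]) `|` segment (c s) (c t)].

(* For tame knot classes only: the summation above is one of polygonal knots. *)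
Definition prime_knot {R : realType} (K : set (R -> 'rV[R]_3)) : Prop :=
  ~ trivial_knot K /\
  forall K1 K2 : set (R -> 'rV[R]_3), knot_class K1 -> knot_class K2 ->
    connected_sum K K1 K2 -> trivial_knot K1 \/ trivial_knot K2.

Definition is_minimizer {R : realType} {T : Type} (A : set T) (f : T -> \bar R)
    (x : T) : Prop :=
  A x /\ forall y, A y -> (f x <= f y)%E.

(* Main.v *)
(** Lower bound: the L^1 convergence of unit speed curves is uniform, and the
    part of E_n coming from far pairs of vertices is close to the part of E
    coming from far pairs of points, so liminf E_n(p_n) >= E(gamma).

    Upper bound: every c of finite energy in the class is approximated by
    equilateral polygons of the same class and asymptotically the same energy.
    The arc-length excess |s - t| - |c s - c t| is monotone under inclusion of arcs,
    so finite energy makes c bi-Lipschitz and flat at small scales. The chord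
    directions u_i of an inscribed n-gon are turned into unit vectors of sum zero
    by normalizing u_i + x, where x minimizes the sum of |u_i + x|. The excess of
    the resulting equilateral polygon is controlled by that of c, hence so is the
    near-diagonal part of its energy. Its knot class is that of c: successive dyadic
    inscribed polygons, and finally the equilateral one, differ by maps of small
    Lipschitz constant relative to the curve; McShane's extension turns these into
    ambient homeomorphisms id + t G_k whose infinite composition converges to an
    isotopy. *)

Require Import Defs.
From HB Require Import structures.
From mathcomp Require Import all_boot all_order all_algebra.
From mathcomp Require Import all_classical all_reals all_analysis.
From mathcomp Require Import measurable_realfun ring lra zify.
Import Order.TTheory GRing.Theory Num.Theory.
Import numFieldNormedType.Exports.
Local Open Scope classical_set_scope.
Local Open Scope ring_scope.
Set Implicit Arguments.
Unset Strict Implicit.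

(** * Euclidean and circle distances *)

(** Finite energy does not make a curve C^1, so closeness of tangents cannot be used to control the
    knot class of a polygon near [c]. The displacements between successive polygons keep a Lipschitz
    constant of up to 1/4 relative to the curve, and only their sup norms decay, like 2^-k. This
    suffices: the inverse of the k-fold composition expands by at most (4/3)^k, and (4/3)/2 < 1.

    Uniform convergence says nothing about the near-diagonal part of a discrete energy. For that
    part only a comparison up to a constant factor is proved; it is enough because the factor
    multiplies the near-diagonal energy of [c], which tends to 0 with the cut-off.

    The same vector x is added to all chord directions because this leaves every difference u_i -
    u_j unchanged. For unit vectors v_i, the quantity m^2 - |v_1 + ... + v_m|^2 is half the sum of
    all |v_i - v_j|^2, so the excess is controlled on all blocks of consecutive edges at once. That
    x stays small needs slopes that are non-collinear uniformly in n; this comes from the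
    injectivity of [c]. *)

Section Euclid.
Context {R : realType} {d : nat}.
Implicit Types x y z : 'rV[R]_d.

Lemma innerC x y : inner x y = inner y x.
Proof. by apply: eq_bigr => i _; rewrite mulrC. Qed.

Lemma innerDl x y z : inner (x + y) z = inner x z + inner y z.
Proof. by rewrite -big_split/=; apply: eq_bigr => i _; rewrite mxE mulrDl. Qed.

Lemma innerZl (a : R) x y : inner (a *: x) y = a * inner x y.
Proof. by rewrite mulr_sumr; apply: eq_bigr => i _; rewrite mxE mulrA. Qed.

Lemma innerDr x y z : inner x (y + z) = inner x y + inner x z.
Proof. by rewrite innerC innerDl !(innerC x). Qed.

Lemma innerZr (a : R) x y : inner x (a *: y) = a * inner x y.
Proof. by rewrite innerC innerZl innerC. Qed.

Lemma innerNl x y : inner (- x) y = - inner x y.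
Proof. by rewrite -scaleN1r innerZl mulN1r. Qed.

Lemma innerNr x y : inner x (- y) = - inner x y.
Proof. by rewrite innerC innerNl innerC. Qed.

Lemma inner_sumr I (r : seq I) (P : pred I) (F : I -> 'rV[R]_d) x :
  inner x (\sum_(i <- r | P i) F i) = \sum_(i <- r | P i) inner x (F i).
Proof.
elim/big_rec2: _ => [|i y1 y2 _ <-]; last by rewrite innerDr.
by rewrite -(scale0r x) innerZr mul0r.
Qed.

Lemma inner_suml I (r : seq I) (P : pred I) (F : I -> 'rV[R]_d) x :
  inner (\sum_(i <- r | P i) F i) x = \sum_(i <- r | P i) inner (F i) x.
Proof. by rewrite innerC inner_sumr; apply: eq_bigr => i _; rewrite innerC. Qed.

Lemma inner_ge0 x : 0 <= inner x x.
Proof. by apply: sumr_ge0 => i _; rewrite -expr2 sqr_ge0. Qed.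

Lemma enormE x : enorm x = Num.sqrt (inner x x).
Proof. by congr Num.sqrt; apply: eq_bigr => i _; rewrite expr2. Qed.

Lemma enorm_sqr x : enorm x ^+ 2 = inner x x.
Proof. by rewrite enormE sqr_sqrtr// inner_ge0. Qed.

Lemma enorm_ge0 x : 0 <= enorm x.
Proof. by rewrite sqrtr_ge0. Qed.

Lemma enorm_le x (a : R) : 0 <= a -> inner x x <= a ^+ 2 -> enorm x <= a.
Proof. by move=> a0 h; rewrite -(@ler_pXn2r _ 2) ?nnegrE ?enorm_ge0// enorm_sqr. Qed.

Lemma enorm_ge x (a : R) : 0 <= a -> a ^+ 2 <= inner x x -> a <= enorm x.
Proof. by move=> a0 h; rewrite -(@ler_pXn2r _ 2) ?nnegrE ?enorm_ge0// enorm_sqr. Qed.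

Lemma enorm_sqrD x y : enorm (x + y) ^+ 2 = enorm x ^+ 2 + 2 * inner x y + enorm y ^+ 2.
Proof. by rewrite !enorm_sqr innerDl !innerDr (innerC y x); ring. Qed.

Lemma enormN x : enorm (- x) = enorm x.
Proof. by rewrite !enormE innerNl innerNr opprK. Qed.

Lemma enorm_sqrB x y : enorm (x - y) ^+ 2 = enorm x ^+ 2 - 2 * inner x y + enorm y ^+ 2.
Proof. by rewrite enorm_sqrD innerNr enormN mulrN. Qed.

Lemma enormZ (a : R) x : enorm (a *: x) = `|a| * enorm x.
Proof.
by rewrite !enormE innerZl innerZr mulrA -expr2 sqrtrM ?sqr_ge0// sqrtr_sqr.
Qed.

Lemma enorm_distC x y : enorm (x - y) = enorm (y - x).
Proof. by rewrite -opprB enormN. Qed.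

Lemma enorm0 : enorm (0 : 'rV[R]_d) = 0.
Proof. by rewrite -(scale0r 0) enormZ normr0 mul0r. Qed.

Lemma cauchy_schwarz x y : inner x y <= enorm x * enorm y.
Proof.
have [x0|x0] := eqVneq (enorm x) 0.
  have h : forall i, x ord0 i = 0.
    move=> i; apply/eqP; rewrite -sqrf_eq0; apply/eqP/le_anti; rewrite sqr_ge0 andbT.
    have <- : enorm x ^+ 2 = 0 by rewrite x0 expr0n.
    rewrite enorm_sqr /inner (bigD1 i)//= -expr2 lerDl.
    by apply: sumr_ge0 => j _; rewrite -expr2 sqr_ge0.
  by rewrite x0 mul0r /inner big1// => i _; rewrite h mul0r.
have xp : 0 < enorm x by rewrite lt0r x0 enorm_ge0.
have := inner_ge0 (enorm x *: y - inner x y / enorm x *: x).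
rewrite -enorm_sqr enorm_sqrB !enormZ !exprMn innerZl innerZr.
rewrite (innerC y x) !real_normK ?num_real//.
set n := enorm x; set m := enorm y; set i := inner x y => h.
have e : n ^+ 2 * m ^+ 2 - 2 * (n * (i / n * i)) + (i / n) ^+ 2 * n ^+ 2 =
   (n * m) ^+ 2 - i ^+ 2 by field.
move: h; rewrite e subr_ge0 => h.
have nm : 0 <= n * m by rewrite mulr_ge0 ?enorm_ge0.
apply: le_trans (ler_norm _) _.
by rewrite -(@ler_pXn2r _ 2) ?nnegrE// real_normK ?num_real.
Qed.

Lemma ler_enormD x y : enorm (x + y) <= enorm x + enorm y.
Proof.
apply: enorm_le; first by rewrite addr_ge0// enorm_ge0.
rewrite -enorm_sqr enorm_sqrD; have := cauchy_schwarz x y; lra.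
Qed.

Lemma ler_enormB x y : enorm (x - y) <= enorm x + enorm y.
Proof. by rewrite -(enormN y) ler_enormD. Qed.

Lemma ler_enorm_trans z x y : enorm (x - y) <= enorm (x - z) + enorm (z - y).
Proof. by apply: le_trans (ler_enormD _ _); rewrite addrA subrK. Qed.

Lemma lerB_enorm x y : enorm x - enorm y <= enorm (x - y).
Proof. by rewrite lerBlDr -{1}(subrK y x) ler_enormD. Qed.

Lemma ler_dist_enorm x y : `|enorm x - enorm y| <= enorm (x - y).
Proof.
by rewrite ler_norml lerB_enorm andbT lerNl opprB enorm_distC lerB_enorm.
Qed.

Lemma coord_le_norm x i : `|x ord0 i| <= `|x|.
Proof.
by rewrite [leRHS]mx_normrE; exact: (le_bigmax _ (fun ij => `|x ij.1 ij.2|) (ord0, i)).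
Qed.

Lemma norm_le_coord x (a : R) : 0 <= a -> (forall i, `|x ord0 i| <= a) -> `|x| <= a.
Proof.
move=> a0 h; rewrite [leLHS]mx_normrE; apply/bigmax_leP; split=> // -[i j] _ /=.
by rewrite (ord1 i).
Qed.

Lemma coord_le_enorm x i : `|x ord0 i| <= enorm x.
Proof.
apply: enorm_ge => //; rewrite real_normK ?num_real// /inner (bigD1 i)//= -expr2 lerDl.
by apply: sumr_ge0 => j _; rewrite -expr2 sqr_ge0.
Qed.

Lemma norm_le_enorm x : `|x| <= enorm x.
Proof. by apply: norm_le_coord (enorm_ge0 _) _ => i; exact: coord_le_enorm. Qed.

Lemma enorm_le_norm x : enorm x <= d%:R * `|x|.
Proof.
apply: enorm_le; first by rewrite mulr_ge0.
have h : inner x x <= \sum_(i < d) `|x| ^+ 2.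
  apply: ler_sum => i _; rewrite -expr2 -real_normK ?num_real//.
  by rewrite ler_pXn2r ?nnegrE// coord_le_norm.
apply: le_trans h _; rewrite sumr_const card_ord -[leLHS]mulr_natl exprMn.
rewrite ler_wpM2r ?sqr_ge0// -natrX ler_nat.
by case: (d) => [|n]//; rewrite -[leqLHS]expn1 leq_pexp2l.
Qed.

Lemma enorm_eq0 x : enorm x = 0 -> x = 0.
Proof.
move=> h; apply/normr0_eq0/le_anti.
by rewrite normr_ge0 andbT -h norm_le_enorm.
Qed.

Lemma parallelogram x y :
  enorm (x + y) ^+ 2 + enorm (x - y) ^+ 2 = 2 * (enorm x ^+ 2 + enorm y ^+ 2).
Proof. by rewrite enorm_sqrD enorm_sqrB; ring. Qed.

Lemma enorm_continuous : continuous (enorm : 'rV[R]_d -> R).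
Proof.
move=> x; apply/(@cvgrPdist_le _ _ _ _ (nbhs_filter x)) => e e0.
have e1 : 0 < e / d.+1%:R by rewrite divr_gt0.
have := @cvgr_dist_le _ _ _ (nbhs x) (nbhs_filter x) id x (@cvg_id _ (nbhs x)) _ e1.
apply: filterS => y h; apply: le_trans (ler_dist_enorm _ _) _.
apply: le_trans (enorm_le_norm _) _.
apply: (@le_trans _ _ (d.+1%:R * `|x - y|)); first by rewrite ler_wpM2r// ler_nat.
by rewrite mulrC -ler_pdivlMr.
Qed.

End Euclid.

Section CircleDist.
Context {R : realType}.
Implicit Types (t s r : R) (k : int).

Lemma circle_distP t s : exists k, circle_dist t s = `|t - s - k%:~R|.
Proof.
rewrite /circle_dist; set x := t - s.
have h1 := floor_le x; have h2 := floorD1_gt x.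
rewrite /Num.min; case: ifP => _.
  by exists (Num.floor x); rewrite ger0_norm// subr_ge0.
exists (Num.floor x + 1); rewrite intrD ltr0_norm; first by ring.
by rewrite subr_lt0 -intrD.
Qed.

Lemma circle_dist_le_int t s k : circle_dist t s <= `|t - s - k%:~R|.
Proof.
rewrite /circle_dist; set x := t - s.
have h1 := floor_le x; have h2 := floorD1_gt x.
rewrite ge_min; have [kf|fk] := leP k (Num.floor x).
  apply/orP; left; rewrite ger0_norm; last first.
    by rewrite subr_ge0 (le_trans _ h1)// ler_int.
  by rewrite lerD2l lerN2 ler_int.
apply/orP; right; have fk' : (Num.floor x + 1)%:~R <= k%:~R :> R by rewrite ler_int lezD1.
rewrite ler0_norm; first by move: fk'; rewrite intrD; lra.
by rewrite subr_le0 (le_trans (ltW h2)).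
Qed.

Lemma circle_dist_le t s : circle_dist t s <= `|t - s|.
Proof. by have := circle_dist_le_int t s 0; rewrite subr0. Qed.

Lemma circle_dist_ge0 t s : 0 <= circle_dist t s.
Proof. by have [k ->] := circle_distP t s. Qed.

Lemma circle_dist_le_half t s : circle_dist t s <= 2^-1.
Proof.
rewrite /circle_dist; set x := t - s; rewrite ge_min.
have [h|h] := leP (x - (Num.floor x)%:~R) 2^-1; rewrite ?h// orFb.
by move: h; lra.
Qed.

Lemma circle_distC t s : circle_dist t s = circle_dist s t.
Proof.
wlog suff : t s / circle_dist t s <= circle_dist s t.
  by move=> h; apply/le_anti; rewrite !h.
have [k ->] := circle_distP s t.
apply: le_trans (circle_dist_le_int _ _ (- k)) _.
by rewrite -normrN rmorphN/= (_ : - (t - s - - k%:~R) = s - t - k%:~R)//; ring.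
Qed.

Lemma circle_distDr t s k : circle_dist t (s + k%:~R) = circle_dist t s.
Proof.
wlog suff : t s k / circle_dist t (s + k%:~R) <= circle_dist t s.
  move=> h; apply/le_anti; rewrite h/=.
  by have := h t (s + k%:~R) (- k); rewrite rmorphN/= addrK.
have [m ->] := circle_distP t s.
apply: le_trans (circle_dist_le_int _ _ (m - k)) _.
by rewrite rmorphB/= (_ : t - (s + k%:~R) - (m%:~R - k%:~R) = t - s - m%:~R)//; ring.
Qed.

Lemma circle_distDl t s k : circle_dist (t + k%:~R) s = circle_dist t s.
Proof. by rewrite circle_distC circle_distDr// circle_distC. Qed.

Lemma circle_distE t s : `|t - s| <= 2^-1 -> circle_dist t s = `|t - s|.
Proof.
move=> h; apply/le_anti; rewrite circle_dist_le andTb.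
have [k ->] := circle_distP t s; have [->|k0] := eqVneq k 0; first by rewrite subr0.
have := lerB_dist (k%:~R : R) (t - s); rewrite (distrC k%:~R).
have : 1 <= `|k%:~R : R|.
  by rewrite -intr_norm ler1z -gtz0_ge1 normr_gt0.
by move: h; lra.
Qed.

Lemma circle_dist_triangle r t s :
  circle_dist t s <= circle_dist t r + circle_dist r s.
Proof.
have [k ->] := circle_distP t r; have [m ->] := circle_distP r s.
apply: le_trans (ler_normD _ _); apply: le_trans (circle_dist_le_int _ _ (k + m)) _.
by rewrite intrD (_ : t - s - (k%:~R + m%:~R) = t - r - k%:~R + (r - s - m%:~R))//; ring.
Qed.

Lemma circle_dist_eq0 t s : circle_dist t s = 0 -> exists k, t = s + k%:~R.
Proof.
have [k ->] := circle_distP t s; move=> /eqP; rewrite normr_eq0 subr_eq0 => /eqP h.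
by exists k; rewrite -h; ring.
Qed.

Lemma circle_distxx t : circle_dist t t = 0.
Proof. by rewrite circle_distE subrr normr0. Qed.

Lemma circle_dist_lift t s : exists k, circle_dist t s = `|t - (s + k%:~R)|.
Proof. by have [k ->] := circle_distP t s; exists k; rewrite opprD addrA. Qed.

Lemma circle_dist_dist t s t' s' :
  `|circle_dist t s - circle_dist t' s'| <= `|t - t'| + `|s - s'|.
Proof.
wlog suff : t s t' s' / circle_dist t s - circle_dist t' s' <= `|t - t'| + `|s - s'|.
  move=> h; rewrite ler_norml h andbT lerNl opprB; apply: le_trans (h _ _ _ _) _.
  by rewrite distrC (distrC s').
have := circle_dist_triangle t' t s; have := circle_dist_triangle s' t' s.
have := circle_dist_le t t'; have := circle_dist_le s' s; rewrite (distrC s').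
lra.
Qed.

End CircleDist.

(** * Unit speed almost everywhere implies 1-Lipschitz *)

Section AeLipschitz.
Context {R : realType}.

(** The supremum of the points where [P] holds satisfies [P] by the limit hypothesis, and the step
    hypothesis forbids it to lie below [b]. *)
Lemma real_induction (P : R -> Prop) (a b : R) : a <= b -> P a ->
  (forall t, a <= t < b -> P t -> exists h, [/\ 0 < h, t + h <= b & P (t + h)]) ->
  (forall t, a <= t <= b ->
     (forall e, 0 < e -> exists s, [/\ a <= s <= t, t - e < s & P s]) -> P t) ->
  P b.
Proof.
move=> ab Pa step lim; pose S := [set t | a <= t <= b /\ P t].
have Sa : S a by split=> //; rewrite lexx.
have Sb : has_ubound S by exists b => t [/andP[]].
have aT : a <= sup S by exact: ub_le_sup.
have Tb : sup S <= b by apply: ge_sup; [exists a | move=> t [/andP[]]].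
have PT : P (sup S).
  apply: lim; first by rewrite aT.
  move=> e e0; have hs : has_sup S by split=> //; exists a.
  have [s Ss hes] := sup_adherent e0 hs; exists s.
  by have [/andP[as_ _] Ps] := Ss; split=> //; rewrite as_ ub_le_sup.
move: Tb; rewrite le_eqVlt => /orP[/eqP <-//|Tb].
have [|h [h0 hb Ph]] := step (sup S) _ PT; first by rewrite aT.
have : sup S + h <= sup S by apply: ub_le_sup => //; split=> //; rewrite hb andbT; lra.
lra.
Qed.

Lemma null_cover (A : set R) (e : R) : 0 < e ->
  (@lebesgue_measure R).-negligible A ->
  exists U : set R, [/\ open U, A `<=` U & (lebesgue_measure U < e%:E)%E].
Proof.
move=> e0 [B [mB B0 AB]].
have Boo : (@lebesgue_measure R B < +oo)%E := eq_ind_r (fun x => (x < +oo)%E) (ltry 0) B0.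
have [U [oU BU Ue]] := lebesgue_regularity_outer mB Boo e0.
exists U; split=> //; first exact: subset_trans BU.
have mU : measurable U by exact: open_measurable.
apply: le_lt_trans Ue; rewrite (@measureDI _ _ _ lebesgue_measure U B mU mB).
rewrite [X in (_ + X)%E](_ : _ = 0%E) ?adde0//.
apply/eqP; rewrite eq_le measure_ge0 andbT.
have : (lebesgue_measure (U `&` B) <= lebesgue_measure B)%E.
  by rewrite le_measure ?inE//; exact: measurableI.
by move=> /le_trans; apply; rewrite -[leRHS]B0.
Qed.

Lemma measure_itv_oc (s t : R) : s <= t ->
  lebesgue_measure (`]s, t]%classic : set R) = (t - s)%:E.
Proof.
move=> st; rewrite lebesgue_measure_itv/= lte_fin.
case: ltP => // ts; move: st; rewrite le_eqVlt => /orP[/eqP ->|].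
  by rewrite subrr.
by rewrite ltNge ts.
Qed.

Section Swept.
Variables (U : set R) (oU : open U) (e : R) (Ue : (lebesgue_measure U < e%:E)%E) (a : R).
Let mU : measurable U := open_measurable oU.
(** The time spent in [U] since [a]: a clock that runs at unit speed inside [U] and never exceeds
    [e]. It pays for motion at unknown speed on the exceptional set. *)
Let psi t : R := fine (lebesgue_measure (U `&` `]a, t]%classic)).

Let fin t : lebesgue_measure (U `&` `]a, t]%classic) \is a fin_num.
Proof.
rewrite ge0_fin_numE//; apply: le_lt_trans (lt_trans Ue (ltry _)).
by rewrite le_measure ?inE//; exact: measurableI.
Qed.

Lemma swept_lt t : psi t < e.
Proof.
rewrite -lte_fin fineK ?fin//; apply: le_lt_trans Ue.
by rewrite le_measure ?inE//; exact: measurableI.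
Qed.

Lemma swept_ge0 t : 0 <= psi t.
Proof. exact/fine_ge0. Qed.

Lemma swept_homo s t : s <= t -> psi s <= psi t.
Proof.
move=> st; rewrite fine_le ?fin//.
rewrite le_measure ?inE//; [exact: measurableI..|].
apply: setIS => x /=; rewrite !in_itv/= => /andP[-> xs].
exact: le_trans st.
Qed.

Lemma sweptD s t : a <= s <= t -> `]s, t]%classic `<=` U ->
  psi t = psi s + (t - s).
Proof.
move=> /andP[as_ st] stU; rewrite /psi.
have -> : U `&` `]a, t]%classic = (U `&` `]a, s]%classic) `|` `]s, t]%classic.
  apply/seteqP; split=> x /=; rewrite !in_itv/=.
    move=> [Ux /andP[ax xt]]; have [xs|sx] := leP x s; [left|right].
      by rewrite ax.
    by rewrite xt.
  move=> [[Ux /andP[-> xs]]|/andP[sx xt]]; first by rewrite (le_trans xs).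
  rewrite xt (le_lt_trans as_)//; split=> //; apply: stU.
  by rewrite /= in_itv/= sx.
suff -> : (lebesgue_measure (U `&` `]a, s]%classic `|` `]s, t]%classic) =
    lebesgue_measure (U `&` `]a, s]%classic) + (t - s)%:E)%E.
  by rewrite fineD.
rewrite -(measure_itv_oc st); apply: measureU => //.
- exact: measurableI.
apply/seteqP; split=> x //=; rewrite !in_itv/= => -[[_ /andP[_ xs]] /andP[sx _]].
by move: (lt_le_trans sx xs); rewrite ltxx.
Qed.

End Swept.

Lemma derivable_enorm_bound {d} (c : R -> 'rV[R]_d) (t e : R) : 0 < e ->
  derivable c t 1 -> enorm (derive1 c t) = 1 ->
  exists2 h0, 0 < h0 & forall h, 0 < h < h0 -> enorm (c (t + h) - c t) <= (1 + e) * h.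
Proof.
move=> e0 dc c1.
have e1 : 0 < e / d.+1%:R by rewrite divr_gt0.
have h1 : (fun h : R => h^-1 *: ((c \o shift t) (h *: 1) - c t)) @ 0^' --> derive1 c t.
  by rewrite derive1E; exact: dc.
have := @cvgr_dist_le _ _ _ _ _ _ _ h1 _ e1.
move=> hQ.
have {}hQ : \forall h \near (0 : R), h != 0 ->
  `|derive1 c t - h^-1 *: ((c \o shift t) (h *: 1) - c t)| <= e / d.+1%:R by exact: hQ.
have /nbhs_ballP [r /= r0 hr] := hQ; exists r => // h /andP[h0 hr'].
have := hr h; rewrite /ball/= sub0r normrN gtr0_norm// => /(_ hr' (lt0r_neq0 h0)).
rewrite [_ *: 1]mulr1 /= (addrC h) => hh.
have -> : c (t + h) - c t = h *: (h^-1 *: (c (t + h) - c t)).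
  by rewrite scalerA divff ?scale1r// gt_eqF.
rewrite enormZ gtr0_norm// mulrC ler_wpM2r// ?(ltW h0)//.
set v := _ *: _ in hh *.
have -> : v = derive1 c t - (derive1 c t - v) by rewrite subKr.
apply: le_trans (ler_enormB _ _) _; rewrite c1 lerD2l.
apply: le_trans (enorm_le_norm _) _.
apply: (@le_trans _ _ (d.+1%:R * `|derive1 c t - v|)); first by rewrite ler_wpM2r// ler_nat.
by rewrite mulrC -ler_pdivlMr.
Qed.

(* Off an open set U of small measure covering the exceptional null set, c moves
   at speed at most 1 + e; inside U it moves at speed at most M. *)
Lemma ae_unit_speed_lipschitz {d} (c : R -> 'rV[R]_d) (M : R) :
  0 <= M -> (forall s t, enorm (c t - c s) <= M * `|t - s|) ->
  {ae lebesgue_measure, forall t : R, derivable c t 1 /\ enorm (derive1 c t) = 1} ->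
  forall s t, enorm (c t - c s) <= `|t - s|.
Proof.
move=> M0 cM cae.
suff main a b : a <= b -> enorm (c b - c a) <= b - a.
  move=> s t; have [st|/ltW ts] := leP s t.
    by rewrite ger0_norm ?subr_ge0// main.
  by rewrite enorm_distC distrC ger0_norm ?subr_ge0// main.
move=> ab; apply/ler_addgt0Pr => e e0.
(* Chosen so that (1 + e') (b - a) + M e' is at most (b - a) + e. *)
pose e' := e / (b - a + M + 1).
have den : 0 < b - a + M + 1 by lra.
have e'0 : 0 < e' by rewrite divr_gt0.
have [U [oU AU Ue]] := null_cover e'0 cae.
pose psi t : R := fine (lebesgue_measure (U `&` `]a, t]%classic)).
have psi_lt t : psi t < e' by exact: swept_lt.
suff : enorm (c b - c a) <= (1 + e') * (b - a) + M * psi b.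
  move=> /le_trans; apply; have := ler_wpM2l M0 (ltW (psi_lt b)) => h.
  rewrite mulrDl mul1r -addrA lerD2l; apply: (@le_trans _ _ (e' * (b - a + M + 1))).
    by rewrite !mulrDr; lra.
  by rewrite /e' divfK ?gt_eqF.
(* The allowance grows at rate 1 + e' in ordinary time and at the additional rate M during the time
   spent in [U]. *)
pose P t := enorm (c t - c a) <= (1 + e') * (t - a) + M * psi t.
have psi_homo := @swept_homo U oU e' Ue a.
apply: (@real_induction P a b ab).
- by rewrite /P subrr enorm0 subrr mulr0 add0r mulr_ge0// swept_ge0.
- move=> t /andP[at_ tb] Pt.
  suff [h0 h00 hh] : exists2 h0, 0 < h0 & forall h, 0 < h < h0 ->
     enorm (c (t + h) - c t) <= (1 + e') * h + M * (psi (t + h) - psi t).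
    have m0 : 0 < Num.min (h0 / 2) (b - t) by rewrite lt_min subr_gt0 tb andbT divr_gt0.
    exists (Num.min (h0 / 2) (b - t)); set h := Num.min _ _ in m0 *.
    have h1 : h <= h0 / 2 by rewrite ge_min lexx.
    have h2 : h <= b - t by rewrite ge_min lexx orbT.
    split=> //; first by lra.
    rewrite /P; apply: le_trans (ler_enorm_trans (c t) _ _) _.
    have /hh : 0 < h < h0 by rewrite m0; lra.
    by move: Pt; rewrite /P; nra.
  have [Ut|nUt] := pselect (U t).
    have /nbhs_ballP[r /= r0 hr] : nbhs t U by exact: open_nbhs_nbhs.
    exists r => // h /andP[h0 hr'].
    rewrite [psi (t + h)](@sweptD U oU e' Ue a t)//; last first.
    - move=> x /=; rewrite in_itv/= => /andP[tx xh]; apply: hr.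
      by rewrite /ball/= ltr0_norm ?subr_lt0// opprB; lra.
    - by rewrite at_/=; lra.
    rewrite (_ : _ - _ = h); last by rewrite -/(psi t); ring.
    have := cM t (t + h); rewrite (addrC t) addrK gtr0_norm// => h1.
    by apply: (le_trans h1); rewrite lerDr mulr_ge0// ltW//; lra.
  have [dt c1] : derivable c t 1 /\ enorm (derive1 c t) = 1.
    by apply: contrapT => nt; apply: nUt; exact: AU.
  have [h0 h00 hh] := derivable_enorm_bound e'0 dt c1.
  exists h0 => // h hh0; apply: le_trans (hh _ hh0) _; rewrite lerDl mulr_ge0//.
  by rewrite subr_ge0 psi_homo//; case/andP: hh0; lra.
- move=> t /andP[at_ tb] hs; rewrite /P; apply/ler_addgt0Pr => f f0.
  have f1 : 0 < f / (M + 1) by rewrite divr_gt0//; lra.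
  have [s [/andP[as_ st] fs Ps]] := hs _ f1.
  apply: le_trans (ler_enorm_trans (c s) _ _) _; rewrite addrC.
  have h1 : enorm (c t - c s) <= f.
    apply: le_trans (cM _ _) _; rewrite ger0_norm ?subr_ge0//.
    apply: (@le_trans _ _ ((M + 1) * (f / (M + 1)))).
      by apply: ler_pM => //; lra.
    by rewrite mulrC divfK// gt_eqF//; lra.
  apply: lerD => //; apply: le_trans Ps _; apply: lerD.
    by rewrite ler_wpM2l//; lra.
  by rewrite ler_wpM2l// psi_homo.
Qed.

Lemma lipschitz_enorm {d} (c : R -> 'rV[R]_d) : lipschitz c ->
  exists2 M, 0 <= M & forall s t, enorm (c t - c s) <= M * `|t - s|.
Proof.
(* [lipschitz] provides a bound for all constants beyond some [M] of unknown sign; this picks a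
   positive one. *)
move=> [M [_ /(_ (Num.max M 0 + 1))]].
have M0 : 0 <= Num.max M 0 by rewrite le_max lexx orbT.
have M1 : M <= Num.max M 0 by rewrite le_max lexx.
case/(_ _)/wrap; first by lra.
move=> h; exists (d%:R * (Num.max M 0 + 1)).
  by rewrite mulr_ge0//; lra.
move=> s t; apply: le_trans (enorm_le_norm _) _; rewrite -mulrA ler_wpM2l//.
exact: (h (t, s)).
Qed.

Lemma arclength_lipschitz1 {d} (c : R -> 'rV[R]_d) : arclength_curves c ->
  forall s t, enorm (c t - c s) <= `|t - s|.
Proof.
move=> [_ /lipschitz_enorm[M M0 cM] cae].
exact: ae_unit_speed_lipschitz M0 cM cae.
Qed.

End AeLipschitz.

(** * The energy as a double integral *)

Section DoubleIntegral.
Context {R : realType}.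
Local Notation leb := (@lebesgue_measure R).
Local Notation D := (`[0%R, 1%R[%classic : set R).

(** The half-open interval is tiled exactly by the n cells [i/n, (i+1)/n), so lattice sums become
    such integrals. The integral is iterated, as in the energy. *)
Definition dint (F : R -> R -> R) : \bar R :=
  (\int[leb]_(t in D) \int[leb]_(s in D) (F t s)%:E)%E.

(** Just the conditions under which the iterated integral is monotone and additive. Jointly
    measurable functions meet them by Tonelli, step functions by direct computation. *)
Definition dint_fun (F : R -> R -> R) : Prop :=
  [/\ forall t s, 0 <= F t s,
      forall t, D t -> measurable_fun D (fun s => (F t s)%:E) &
      measurable_fun D (fun t => \int[leb]_(s in D) (F t s)%:E)%E].

Let mD : measurable D. Proof. exact: measurable_itv. Qed.

Lemma dint_fun_measurable (F : R -> R -> R) : (forall t s, 0 <= F t s) ->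
  measurable_fun setT (fun z : R * R => F z.1 z.2) -> dint_fun F.
Proof.
move=> F0 mF; split=> //.
  move=> t _; apply: measurable_funTS; apply/measurable_EFinP.
  exact: (measurable_fun_pair2 t mF).
apply: measurable_funTS.
have -> : (fun t => \int[leb]_(s in D) (F t s)%:E)%E =
    fubini_F leb (fun z : R * R => if z.2 \in D then (F z.1 z.2)%:E else 0%E).
  apply/funext => t; rewrite /fubini_F [LHS]integral_mkcond; apply: eq_integral => s _.
  by rewrite patchE.
apply: measurable_fun_fubini_tonelli_F; last first.
  by move=> z; case: ifP => // _; rewrite lee_fin.
apply: measurable_fun_ifT => //; last exact/measurable_EFinP.
apply: (measurable_fun_bool true).
rewrite setTI (_ : _ @^-1` _ = setT `*` D); first exact: measurableX.
by apply/seteqP; split=> x; [move=> /set_mem|move=> [_ Dx]; exact/mem_set].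
Qed.

Lemma dint_le (F G : R -> R -> R) : dint_fun F -> dint_fun G ->
  (forall t s, D t -> D s -> F t s <= G t s) -> (dint F <= dint G)%E.
Proof.
move=> [F0 mF mF'] [G0 mG mG'] FG; apply: ge0_le_integral => //.
  by move=> t _; apply: integral_ge0 => s _; rewrite lee_fin.
move=> t Dt; apply: ge0_le_integral => //.
- by move=> s _; rewrite lee_fin.
- exact: mF.
- exact: mG.
- by move=> s Ds; rewrite lee_fin FG.
Qed.

Lemma dint_ge0 F : dint_fun F -> (0 <= dint F)%E.
Proof.
by move=> [F0 _ _]; apply: integral_ge0 => t _; apply: integral_ge0 => s _; rewrite lee_fin.
Qed.

Lemma dintD (F G : R -> R -> R) : dint_fun F -> dint_fun G ->
  dint_fun (fun t s => F t s + G t s) /\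
  dint (fun t s => F t s + G t s) = (dint F + dint G)%E.
Proof.
move=> [F0 mF mF'] [G0 mG mG'].
have e t : D t -> (\int[leb]_(s in D) (F t s + G t s)%:E =
    \int[leb]_(s in D) (F t s)%:E + \int[leb]_(s in D) (G t s)%:E)%E.
  move=> Dt; rewrite -ge0_integralD//.
  - by move=> s _; rewrite lee_fin.
  - exact: mF.
  - by move=> s _; rewrite lee_fin.
  - exact: mG.
split; last first.
  rewrite /dint -ge0_integralD//.
  - by apply: eq_integral => t /[!inE] Dt; rewrite e.
  - by move=> t _; apply: integral_ge0 => s _; rewrite lee_fin.
  - by move=> t _; apply: integral_ge0 => s _; rewrite lee_fin.
split; first by move=> t s; rewrite addr_ge0.
  by move=> t Dt; apply: (emeasurable_funD (mF t Dt) (mG t Dt)).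
apply: eq_measurable_fun (emeasurable_funD mF' mG').
by move=> t /[!inE] Dt; rewrite e.
Qed.

Lemma dintZ (k : R) F : 0 <= k -> dint_fun F ->
  dint_fun (fun t s => k * F t s) /\ dint (fun t s => k * F t s) = (k%:E * dint F)%E.
Proof.
move=> k0 [F0 mF mF'].
have e t : D t -> (\int[leb]_(s in D) (k * F t s)%:E =
    k%:E * \int[leb]_(s in D) (F t s)%:E)%E.
  move=> Dt; rewrite -ge0_integralZl_EFin//.
  - by move=> s _; rewrite lee_fin.
  - exact: mF.
split; last first.
  rewrite /dint -ge0_integralZl_EFin//.
  - by apply: eq_integral => t /[!inE] Dt; rewrite e.
  - by move=> t _; apply: integral_ge0 => s _; rewrite lee_fin.
split; first by move=> t s; rewrite mulr_ge0.
  move=> t Dt; have := @measurable_funeM _ _ _ D _ k%:E (mF t Dt).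
  exact: eq_measurable_fun.
apply: eq_measurable_fun (measurable_funeM k%:E mF').
by move=> t /[!inE] Dt; rewrite e.
Qed.

Let cellE (n i : nat) : (0 < n)%N ->
  `[0, i.+1%:R / n%:R[%classic = `[0, i%:R / n%:R[%classic `|`
  `[i%:R / n%:R, i.+1%:R / n%:R[%classic :> set R.
Proof.
move=> n0; have n0' : 0 < n%:R :> R by rewrite ltr0n.
apply/seteqP; split=> x /=; rewrite !in_itv/=.
  move=> /andP[x0 xi]; have [xn|nx] := ltP x (i%:R / n%:R); [left|right].
    by rewrite x0.
  by rewrite xi.
move=> [/andP[-> xi]|/andP[ix ->]].
  by rewrite (lt_trans xi)// ltr_pM2r ?invr_gt0// ltr_nat.
by rewrite andbT (le_trans _ ix)// divr_ge0.
Qed.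

Lemma integral_step (n : nat) (F : R -> \bar R) (b : nat -> \bar R) : (0 < n)%N ->
  (forall i, (i < n)%N -> forall t, i%:R / n%:R <= t < i.+1%:R / n%:R -> F t = b i) ->
  (forall i, (0 <= b i)%E) ->
  measurable_fun D F /\
  (\int[leb]_(t in D) F t = \sum_(i < n) b i * (n%:R^-1)%:E)%E.
Proof.
move=> n0 Fb b0; have n0' : 0 < n%:R :> R by rewrite ltr0n.
suff : forall m, (m <= n)%N ->
    measurable_fun (`[0, m%:R / n%:R[%classic : set R) F /\
    (\int[leb]_(t in `[0%R, (m%:R / n%:R)%R[) F t = \sum_(i < m) b i * (n%:R^-1)%:E)%E.
  by move=> /(_ n (leqnn n)); rewrite divff ?gt_eqF.
have F0 m t : (m <= n)%N -> `[0, m%:R / n%:R[%classic t -> (0 <= F t)%E.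
  elim: m => [|m IH] mn.
    by rewrite mul0r/= in_itv/= => /andP[t0 /(le_lt_trans t0)]; rewrite ltxx.
  rewrite cellE// => -[|/= mt]; first by apply: IH; exact: ltnW.
  by rewrite (Fb m).
elim=> [|m IH] mn.
  rewrite mul0r set_itvco0; split; first exact: measurable_fun_set0.
  by rewrite integral_set0 big_ord0.
have [mF iF] := IH (ltnW mn).
have bF t : (t \in `[m%:R / n%:R, m.+1%:R / n%:R[%classic : Prop) -> b m = F t.
  by rewrite inE/= in_itv/= => /(Fb _ mn) ->.
have mF2 : measurable_fun (`[m%:R / n%:R, m.+1%:R / n%:R[%classic : set R) F.
  by apply: (eq_measurable_fun (fun=> b m)) => //; exact: measurable_cst.
have mF3 : measurable_fun (`[0, m.+1%:R / n%:R[%classic : set R) F.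
  by rewrite cellE//; exact/measurable_funU.
split=> //; rewrite cellE// ge0_integral_setU//; last 3 first.
- by rewrite -cellE.
- by move=> t; rewrite -cellE//; apply: F0.
- apply/disj_setPS => x [] /=; rewrite !in_itv/= => /andP[_ h1] /andP[h2 _].
  by move: (lt_le_trans h1 h2); rewrite ltxx.
rewrite iF big_ord_recr/=; congr (_ + _)%E.
transitivity (\int[leb]_(t in `[(m%:R / n%:R)%R, (m.+1%:R / n%:R)%R[) cst (b m) t)%E.
  by apply: eq_integral => t /bF.
rewrite integral_cst//; congr (_ * _)%E.
apply: (etrans (lebesgue_measure_itv `[m%:R / n%:R, m.+1%:R / n%:R[)).
rewrite /= lte_fin ltr_pM2r ?invr_gt0// ltr_nat ltnSn.
by rewrite -EFinB -mulrBl -natr1 addrC addKr mul1r.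
Qed.

Lemma dint_step (n : nat) (F : R -> R -> R) (b : nat -> nat -> R) : (0 < n)%N ->
  (forall i j, (i < n)%N -> (j < n)%N -> forall t s, i%:R / n%:R <= t < i.+1%:R / n%:R ->
     j%:R / n%:R <= s < j.+1%:R / n%:R -> F t s = b i j) ->
  (forall i j, 0 <= b i j) -> (forall t s, 0 <= F t s) ->
  dint_fun F /\ dint F = (\sum_(i < n) \sum_(j < n) b i j / n%:R ^+ 2)%:E.
Proof.
move=> n0 Fb b0 F0; have n0' : 0 < n%:R :> R by rewrite ltr0n.
have inn i t : (i < n)%N -> i%:R / n%:R <= t < i.+1%:R / n%:R ->
   measurable_fun D (fun s => (F t s)%:E) /\
   (\int[leb]_(s in D) (F t s)%:E = \sum_(j < n) (b i j)%:E * (n%:R^-1)%:E)%E.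
  move=> i_n ht; apply: (@integral_step n _ (fun j => (b i j)%:E)) => //.
    by move=> j jn s hs; rewrite (Fb i j).
  by move=> j; rewrite lee_fin.
have [||mI eI] := @integral_step n (fun t => \int[leb]_(s in D) (F t s)%:E)%E
   (fun i => \sum_(j < n) (b i j)%:E * (n%:R^-1)%:E)%E n0.
- by move=> i i_n t ht; have [_ ->] := inn i t i_n ht.
- by move=> i; apply: sume_ge0 => j _; rewrite -EFinM lee_fin mulr_ge0.
split; last first.
  rewrite /dint eI -sumEFin; apply: eq_bigr => i _.
  rewrite -sumEFin ge0_sume_distrl//; last first.
    by move=> j _; rewrite -EFinM lee_fin mulr_ge0.
  apply: eq_bigr => j _; rewrite -!EFinM; congr (_%:E).
  by field; rewrite gt_eqF.
split=> // t; rewrite /= in_itv/= => /andP[t0 t1].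
pose i := Num.truncn (t * n%:R).
have /andP[h1 h2] : i%:R <= t * n%:R < i.+1%:R.
  by rewrite truncn_itv// mulr_ge0.
apply: (inn i t _ _).1; last by rewrite ler_pdivrMr// ltr_pdivlMr// h1.
by rewrite -(ltr_nat R) (le_lt_trans h1)// gtr_pMl.
Qed.

End DoubleIntegral.

Section Density.
Context {R : realType} {d : nat}.
Implicit Types c : R -> 'rV[R]_d.

(* Real-valued, and equal to 0 on the diagonal because 0^-1 = 0. *)
Definition density c (t s : R) : R :=
  (enorm (c t - c s) ^+ 2)^-1 - (circle_dist t s ^+ 2)^-1.

Definition lipschitz1 c := forall s t, enorm (c t - c s) <= `|t - s|.

Lemma lipschitz1_continuous c : lipschitz1 c -> continuous c.
Proof.
move=> cl t; apply/(@cvgrPdist_le _ _ _ _ (nbhs_filter t)) => x x0.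
have := @cvgr_dist_le _ _ _ (nbhs t) (nbhs_filter t) id t (@cvg_id _ (nbhs t)) _ x0.
apply: filterS => s h; apply: le_trans (norm_le_enorm _) _.
exact: le_trans (cl _ _) h.
Qed.

Lemma closed_curve_period c : closed_curve c -> forall t (k : int), c (t + k%:~R) = c t.
Proof.
move=> [_ c1] t k; have nat_period (u : R) (n : nat) : c (u + n%:R) = c u.
  by elim: n => [|n IH]; [rewrite addr0 | rewrite -natr1 addrA c1].
case: k => n; first exact: nat_period.
by rewrite NegzE mulrNz -[LHS](nat_period _ n.+1) subrK.
Qed.

Lemma lipschitz1_circle c : closed_curve c -> lipschitz1 c ->
  forall t s, enorm (c t - c s) <= circle_dist t s.
Proof.
move=> cc cl t s; have [k ->] := circle_dist_lift t s.
by rewrite -(closed_curve_period cc s k).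
Qed.

Lemma embedded_enorm_gt0 c t s : embedded c -> 0 < circle_dist t s ->
  0 < enorm (c t - c s).
Proof.
move=> [cc ci] ts0; rewrite lt0r enorm_ge0 andbT; apply/eqP => /enorm_eq0/eqP.
rewrite subr_eq0 => /eqP/ci [k sk].
by move: ts0; rewrite sk circle_distDr circle_distxx ltxx.
Qed.

Lemma densityC c t s : density c t s = density c s t.
Proof. by rewrite /density enorm_distC circle_distC. Qed.

Lemma density_periodl c : closed_curve c -> forall t s (k : int),
  density c (t + k%:~R) s = density c t s.
Proof. by move=> cc t s k; rewrite /density closed_curve_period// circle_distDl. Qed.

Lemma density_periodr c : closed_curve c -> forall t s (k : int),
  density c t (s + k%:~R) = density c t s.
Proof. by move=> cc t s k; rewrite !(densityC c t) density_periodl. Qed.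

Lemma density_diag c t s : closed_curve c -> circle_dist t s = 0 -> density c t s = 0.
Proof.
move=> cc ts0; have [k tk] := circle_dist_eq0 ts0.
by rewrite /density ts0 tk closed_curve_period// subrr enorm0 !expr0n/= invr0 subrr.
Qed.

Lemma density_ge0 c : embedded c -> lipschitz1 c -> forall t s, 0 <= density c t s.
Proof.
move=> ce cl t s; have [cc _] := ce.
have := circle_dist_ge0 t s; rewrite le_eqVlt => /orP[/eqP/esym|ts0].
  by move=> ts0; rewrite density_diag.
rewrite subr_ge0 lef_pV2 ?posrE ?exprn_gt0 ?embedded_enorm_gt0//.
by rewrite ler_pXn2r ?nnegrE ?enorm_ge0 ?circle_dist_ge0 ?lipschitz1_circle.
Qed.

(** Continuity fails at 0; the real power with exponent -1 is measurable and agrees with the inverse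
    on nonnegative numbers, 0 included. *)
Lemma measurable_inv : measurable_fun setT (fun x : R => (x ^+ 2)^-1).
Proof.
have -> : (fun x : R => (x ^+ 2)^-1) = (fun x => (x ^+ 2) `^ (-1)).
  by apply/funext => x; rewrite powR_inv1// sqr_ge0.
apply: (measurableT_comp (measurable_powR (-1))).
by apply: exprn_measurable.
Qed.

Lemma circle_dist_continuous : continuous (fun x : R => circle_dist x 0).
Proof.
move=> x; apply/cvgrPdist_le => e e0.
near=> y; apply: le_trans (circle_dist_dist _ _ _ _) _.
rewrite subrr normr0 addr0.
by near: y; apply: cvgr_dist_le (@cvg_id _ (nbhs x)) _ e0.
Unshelve. all: by end_near. Qed.

Lemma measurable_circle_dist :
  measurable_fun setT (fun z : R * R => circle_dist z.1 z.2).
Proof.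
rewrite (_ : (fun _ => _) = (fun x => circle_dist x 0) \o (fun z : R * R => z.1 - z.2)).
  apply: measurableT_comp; first exact: (continuous_measurable_fun circle_dist_continuous).
  by apply: measurable_funB; [exact: measurable_fst|exact: measurable_snd].
apply/funext => z /=; rewrite /circle_dist subr0.
by [].
Qed.

Lemma measurable_density c : continuous c ->
  measurable_fun setT (fun z : R * R => density c z.1 z.2).
Proof.
move=> cc; apply: measurable_funB; last first.
  exact: (measurableT_comp measurable_inv measurable_circle_dist).
have -> : (fun z : R * R => (enorm (c z.1 - c z.2) ^+ 2)^-1) =
  (fun x : R => (x ^+ 2)^-1) \o (@Num.sqrt R) \o
    (fun z : R * R => \sum_(i < d) (c z.1 ord0 i - c z.2 ord0 i) ^+ 2).
  apply/funext => z /=; congr ((Num.sqrt _ ^+ 2)^-1).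
  by apply: eq_bigr => i _; rewrite !mxE.
apply: measurableT_comp.
  apply: (measurableT_comp measurable_inv).
  exact: (continuous_measurable_fun (@sqrt_continuous R)).
apply: measurable_sum => i; apply: measurable_funX.
have mi : measurable_fun setT (fun t : R => c t ord0 i).
  apply: continuous_measurable_fun => t.
  apply: (@continuous_comp _ _ _ c (fun v : 'rV[R]_d => v ord0 i)); first exact: cc.
  exact: (@coord_continuous R 1 d ord0 i).
apply: measurable_funB.
  exact: (measurableT_comp mi measurable_fst).
exact: (measurableT_comp mi measurable_snd).
Qed.

Lemma dint_fun_density c : embedded c -> lipschitz1 c -> dint_fun (density c).
Proof.
move=> ce cl; apply: dint_fun_measurable; first exact: density_ge0.
by apply: measurable_density; case: ce => -[].
Qed.

(** The integrands differ only where [circle_dist t s = 0]: there one is +oo - +oo and the other 0.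
    For fixed t this is the countable set t + Z, hence null; the endpoint 1 is null as well. *)
Lemma moebius_energyE c : embedded c -> lipschitz1 c ->
  moebius_energy c = dint (density c).
Proof.
move=> ce cl; have [cc _] := ce.
have [F0 mF mF'] := dint_fun_density ce cl.
have mD : measurable (`[0%R, 1%R]%classic : set R) by exact: measurable_itv.
have mdens t : measurable_fun setT (fun s => (density c t s)%:E).
  apply/measurable_EFinP.
  exact: (measurable_fun_pair2 t (measurable_density cc.1)).
have inner t : (\int[lebesgue_measure]_(s in `[0%R, 1%R])
     (((enorm (c t - c s)) ^+ 2)%:E^-1 - ((circle_dist t s) ^+ 2)%:E^-1) =
   \int[lebesgue_measure]_(s in `[0%R, 1%R[) (density c t s)%:E)%E.
  pose f (s : R) := (((enorm (c t - c s)) ^+ 2)%:E^-1 - ((circle_dist t s) ^+ 2)%:E^-1)%E.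
  rewrite -/f.
  (* Along t + Z the integrand repeats its value at s = t, so measurability follows without
     evaluating that value. *)
  have fE : f = fun s => if circle_dist t s == 0 then f t else (density c t s)%:E.
    apply/funext => s; case: eqP => [ts|/eqP ts].
      have [k tk] := circle_dist_eq0 ts; rewrite /f tk (closed_curve_period cc s).
      by rewrite circle_distDl circle_distDr circle_distDl.
    have ts0 : 0 < circle_dist t s by rewrite lt0r ts circle_dist_ge0.
    rewrite /f !inver !ifF ?EFinB//; apply/negbTE; rewrite sqrf_eq0//.
    by rewrite gt_eqF// embedded_enorm_gt0.
  have mf : measurable_fun setT f.
    rewrite fE; apply: measurable_fun_ifT => //.
    apply: measurable_fun_eqr => //.
    exact: (measurable_fun_pair2 t measurable_circle_dist).
  rewrite -(@integral_itv_bndo_bndc R (BLeft 0) 1 f); last exact: measurable_funTS.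
  apply: ae_eq_integral => //; [exact: measurable_funTS|exact: (measurable_funTS (mdens t))|].
  suff : lebesgue_measure.-negligible
    (~` [set s | `[0, 1[%classic s -> f s = (density c t s)%:E]) by [].
  exists [set s | circle_dist t s = 0]; split.
  - rewrite (_ : [set s | _] = setT `&` (fun s => circle_dist t s) @^-1` [set 0]).
      by apply: (measurable_fun_pair2 t measurable_circle_dist).
    by rewrite setTI.
  - apply: countable_lebesgue_measure0.
    apply: (@sub_countable _ _ _ [set t + k%:~R | k in [set: int]]).
      apply: subset_card_le => s /= /(@eq_trans _ _ _ _ (circle_distC s t)).
      by move=> /circle_dist_eq0[k ->]; exists k.
    apply: sub_countable (card_image_le _ _) _; exact: countableP.
  - move=> s /= ns; apply: contrapT => ts0; apply: ns => _.
    by rewrite fE; case: eqP.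
rewrite /moebius_energy /dint.
under eq_integral do rewrite inner.
by rewrite integral_itv_bndo_bndc.
Qed.

End Density.

(** * Splitting the energy into pairs near and far from the diagonal *)

Section Truncation.
Context {R : realType} {d : nat} (c : R -> 'rV[R]_d).
Hypotheses (ce : embedded c) (cl : lipschitz1 c).

Definition near_density (r t s : R) : R :=
  if circle_dist t s < r then density c t s else 0.
Definition far_density (r t s : R) : R :=
  if circle_dist t s < r then 0 else density c t s.

Let mless (r : R) : measurable_fun setT (fun z : R * R => circle_dist z.1 z.2 < r).
Proof. by apply: measurable_fun_ltr => //; exact: measurable_circle_dist. Qed.

Lemma dint_fun_near_density r : dint_fun (near_density r).
Proof.
apply: dint_fun_measurable.
  by move=> t s; rewrite /near_density; case: ifP => // _; exact: density_ge0.
apply: measurable_fun_ifT => //; apply: measurable_density; by case: ce => -[].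
Qed.

Lemma dint_fun_far_density r : dint_fun (far_density r).
Proof.
apply: dint_fun_measurable.
  by move=> t s; rewrite /far_density; case: ifP => // _; exact: density_ge0.
apply: measurable_fun_ifT => //; apply: measurable_density; by case: ce => -[].
Qed.

Lemma dint_density_split r :
  dint (density c) = (dint (near_density r) + dint (far_density r))%E.
Proof.
have [_ <-] := dintD (dint_fun_near_density r) (dint_fun_far_density r).
congr dint; apply/funext => t; apply/funext => s.
by rewrite /near_density /far_density; case: ifP; rewrite ?addr0 ?add0r.
Qed.

Let far_homo t s : {homo (fun k : nat => (far_density k.+1%:R^-1 t s)%:E) :
  n m / (n <= m)%N >-> (n <= m)%E}.
Proof.
move=> n m nm; rewrite lee_fin /far_density.
case: ifPn => [_|]; first by case: ifP => // _; exact: density_ge0.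
rewrite -leNgt => h; rewrite ifF//; apply/negbTE; rewrite -leNgt.
by apply: le_trans h; rewrite lef_pV2 ?posrE// ler_nat.
Qed.

Let far_lim t s :
  limn (fun k : nat => (far_density k.+1%:R^-1 t s)%:E) = (density c t s)%:E.
Proof.
have := circle_dist_ge0 t s; rewrite le_eqVlt => /orP[/eqP/esym|] ts0.
  rewrite (_ : (fun _ => _) = cst 0%E); last first.
    apply/funext => k; rewrite /far_density density_diag//; last by case: ce.
    by case: ifP.
  by rewrite lim_cst// density_diag//; case: ce.
apply/cvg_lim => //; apply: cvg_near_cst.
exists (Num.truncn (circle_dist t s)^-1) => // k /= hk.
rewrite /far_density ifF//; apply/negbTE; rewrite -leNgt.
rewrite -[leRHS]invrK lef_pV2 ?posrE ?invr_gt0//.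
have i0 : 0 <= (circle_dist t s)^-1 by rewrite invr_ge0 ltW.
have /andP[_ h] := truncn_itv i0.
by rewrite (le_trans (ltW h))// ler_nat.
Qed.

(** The far densities increase to [density] as the cut-off shrinks (on the diagonal both are 0);
    monotone convergence is applied to the inner and then to the outer integral. *)
Lemma dint_far_cvg :
  dint (far_density k.+1%:R^-1) @[k --> \oo] --> dint (density c).
Proof.
have inner t : `[0, 1[%classic t ->
    limn (fun k => \int[lebesgue_measure]_(s in `[0%R, 1%R[) (far_density k.+1%:R^-1 t s)%:E)%E
    = (\int[lebesgue_measure]_(s in `[0%R, 1%R[) (density c t s)%:E)%E.
  move=> Dt; apply/cvg_lim => //.
  under [X in _ --> X]eq_integral do rewrite -far_lim.
  apply: cvg_monotone_convergence => //.
  - move=> k; have [_ + _] := dint_fun_far_density k.+1%:R^-1; exact.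
  - by move=> k s _; have [+ _ _] := dint_fun_far_density k.+1%:R^-1; rewrite lee_fin; apply.
rewrite [X in _ --> X](_ : _ = (\int[lebesgue_measure]_(t in `[0%R, 1%R[)
    limn (fun k => \int[lebesgue_measure]_(s in `[0%R, 1%R[)
       (far_density k.+1%:R^-1 t s)%:E))%E); last first.
  by apply: eq_integral => t; rewrite inE => Dt; rewrite inner.
apply: cvg_monotone_convergence => //.
- by move=> k; have [_ _ ] := dint_fun_far_density k.+1%:R^-1.
- move=> k t _; apply: integral_ge0 => s _.
  by have [+ _ _] := dint_fun_far_density k.+1%:R^-1; rewrite lee_fin; apply.
- move=> t Dt n m nm; apply: ge0_le_integral => //.
  + by move=> s _; have [+ _ _] := dint_fun_far_density n.+1%:R^-1; rewrite lee_fin; apply.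
  + by have [_ + _] := dint_fun_far_density n.+1%:R^-1; apply.
  + by have [_ + _] := dint_fun_far_density m.+1%:R^-1; apply.
  + by move=> s _; exact: far_homo.
Qed.

(** Stated through real numbers below the energy so that infinite energy is covered too, as the
    lower bound for [gamma] demands. *)
Lemma lt_dint_far (A : R) : (A%:E < dint (density c))%E ->
  exists2 r, 0 < r & (A%:E < dint (far_density r))%E.
Proof.
move=> h; have : \forall k \near \oo, (A%:E < dint (far_density k.+1%:R^-1))%E.
  apply: (dint_far_cvg (t := [set x | (A%:E < x)%E])).
  by apply: open_nbhs_nbhs; split=> //; exact: open_ereal_gt_ereal.
by move=> [k _ /(_ k (leqnn k))] hk; exists k.+1%:R^-1.
Qed.

Lemma dint_near_small (e : R) : (dint (density c) < +oo)%E -> 0 < e ->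
  exists2 r, 0 < r & (dint (near_density r) < e%:E)%E.
Proof.
move=> fin e0; have ge0 := dint_ge0 (dint_fun_density ce cl).
have [E0 EE] : exists E0 : R, dint (density c) = E0%:E.
  by exists (fine (dint (density c))); rewrite fineK// ge0_fin_numE.
have [|r r0 hr] := @lt_dint_far (E0 - e); first by rewrite EE lte_fin; lra.
exists r => //; have := dint_density_split r.
rewrite EE; move: hr (dint_ge0 (dint_fun_near_density r)).
case: (dint (far_density r)) => [x| |]//; case: (dint (near_density r)) => [y| |]//.
rewrite !lte_fin => h1 _ -[h2]; lra.
Qed.

End Truncation.

(** * The discrete energy as a lattice sum *)

(** Moving the window of summation by one changes the sum by a telescoping difference h (k + n) - h
    k, which vanishes. *)
Lemma sum_cyclic_shift (V : zmodType) (n : nat) (h : int -> V) (m : int) :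
  (forall k, h (k + n%:Z) = h k) ->
  \sum_(i < n) h (m + i%:Z) = \sum_(i < n) h i%:Z.
Proof.
move=> hn; pose S k := \sum_(i < n) h (k + i%:Z).
have S1 k : S (k + 1) = S k.
  apply/eqP; rewrite -subr_eq0 /S -sumrB.
  have /= := @telescope_sumr V 0 n (fun i => h (k + i%:Z)) (leq0n n).
  rewrite big_mkord hn addr0 subrr => T.
  apply/eqP; rewrite -[RHS]T; apply: eq_bigr => i _; congr (h _ - _); lia.
have S0 : S 0 = \sum_(i < n) h i%:Z by apply: eq_bigr => i _; rewrite add0r.
rewrite -S0 -/(S m); case: m => k.
  by elim: k => // k <-; rewrite -addn1 PoszD S1.
rewrite NegzE; elim: k.+1 => [|j <-]; first by rewrite oppr0.
by rewrite -[LHS]S1; congr S; lia.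
Qed.

Section Discrete.
Context {R : realType} {d : nat}.
Implicit Types c : R -> 'rV[R]_d.

(** The diagonal terms can be kept because [density] vanishes there. *)
Definition lattice_energy (n : nat) (r : R) c : R :=
  \sum_(i < n) \sum_(j < n) density c (r + i%:R / n%:R) (r + j%:R / n%:R) / n%:R ^+ 2.

Lemma equilateral_vertices_gt0 n c a : equilateral_vertices n c a -> (0 < n)%N.
Proof. by case: n => // -[[[_ h] _] _]; move: h; lra. Qed.

(** Circle distance 1/n alone would allow a gap longer than half a turn. It does give that every gap
    is at least 1/n, and n gaps adding up to 1 must then all be equal. *)
Lemma equilateral_verticesE n c a : equilateral_vertices n c a ->
  forall i, (i <= n)%N -> a i = a 0%N + i%:R / n%:R.
Proof.
move=> va; have n0 := equilateral_vertices_gt0 va.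
have [[[ainc an] _] ad] := va.
have step i : (i < n)%N -> a i + n%:R^-1 <= a i.+1.
  move=> i_n; rewrite -lerBrDl -(ad i i_n).
  by apply: le_trans (circle_dist_le _ _) _; rewrite gtr0_norm// subr_gt0 ainc.
have low i : (i <= n)%N -> a 0%N + i%:R / n%:R <= a i.
  elim: i => [|i IH] i_n; first by rewrite mul0r addr0.
  apply: le_trans (step _ i_n); apply: le_trans (lerD (IH (ltnW i_n)) (lexx _)).
  by rewrite -addrA lerD2l -natr1 mulrDl mul1r.
have high i : (i <= n)%N -> a (n - i)%N <= a n - i%:R / n%:R.
  elim: i => [|i IH] i_n; first by rewrite mul0r subr0 subn0.
  have := step (n - i.+1)%N; rewrite -subSn// subSS => /(_ (ltac:(lia))) h.
  by have := IH (ltnW i_n); rewrite -natr1 mulrDl mul1r; lra.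
move=> i i_n; apply/le_anti; rewrite low// andbT.
have := high (n - i)%N (leq_subr _ _); rewrite subKn// an natrB// mulrBl divff.
  by move=> h; apply: le_trans h _; lra.
by rewrite pnatr_eq0 -lt0n.
Qed.

(** Reducing the offset modulo 1/n relabels the vertices cyclically. With a small offset each vertex
    is within 1/n of all points of the cell that carries its index. *)
Lemma lattice_energy_shift n (a0 : R) c : closed_curve c -> (0 < n)%N ->
  exists2 r, 0 <= r < n%:R^-1 & lattice_energy n a0 c = lattice_energy n r c.
Proof.
move=> cc n0; have n0' : 0 < n%:R :> R by rewrite ltr0n.
pose m := Num.floor (a0 * n%:R); pose r := a0 - m%:~R / n%:R.
have rn : r * n%:R = a0 * n%:R - m%:~R by rewrite /r mulrBl divfK ?gt_eqF.
exists r.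
  have /andP[h1 h2] := floor_itv (a0 * n%:R).
  rewrite -(pmulr_lge0 _ n0') -[X in _ < X]mul1r ltr_pdivlMr//.
  by rewrite rn subr_ge0 h1/= ltrBlDl; move: h2; rewrite intrD.
have per t u : density c t (r + (u + n%:Z)%:~R / n%:R) = density c t (r + u%:~R / n%:R).
  rewrite intrD mulrDl divff ?gt_eqF// addrA.
  by rewrite (density_periodr cc t _ 1).
pose g (u v : int) := density c (r + u%:~R / n%:R) (r + v%:~R / n%:R) / n%:R ^+ 2.
have sh (i : nat) : a0 + i%:R / n%:R = r + (m + i%:Z)%:~R / n%:R.
  by rewrite /r intrD mulrDl addrA subrK.
rewrite /lattice_energy.
transitivity (\sum_(i < n) \sum_(j < n) g (m + i%:Z) (m + j%:Z)).
  by apply: eq_bigr => i _; apply: eq_bigr => j _; rewrite !sh.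
transitivity (\sum_(i < n) \sum_(j < n) g (m + i%:Z) j%:Z).
  apply: eq_bigr => i _; apply: (sum_cyclic_shift (h := g (m + i%:Z))).
  by move=> k; rewrite /g per.
apply: (sum_cyclic_shift (h := fun k => \sum_(j < n) g k j%:Z)) => k.
by apply: eq_bigr => j _; rewrite /g densityC per// densityC.
Qed.

Lemma discrete_energyE n c : embedded c -> equilateral_vertices n c !=set0 ->
  exists2 r, 0 <= r < n%:R^-1 & discrete_energy n c = (lattice_energy n r c)%:E.
Proof.
move=> ce /getPex; rewrite /discrete_energy; set a := get _ => va.
have [cc _] := ce.
have n0 := equilateral_vertices_gt0 va.
have n0' : 0 < n%:R :> R by rewrite ltr0n.
have aE := equilateral_verticesE va.
have [_ ad] := va.
have [r rn eE] := lattice_energy_shift (a 0%N) cc n0.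
exists r => //; rewrite -eE /lattice_energy -sumEFin; apply: eq_bigr => i _.
rewrite -sumEFin big_mkcond/=; apply: eq_bigr => j _.
rewrite !ad// -!aE ?(ltnW (ltn_ord _))//.
case: ifPn => [ji|]; last first.
  by rewrite negbK => /eqP ->; rewrite density_diag ?circle_distxx ?mul0r.
have ts0 : 0 < circle_dist (a j) (a i).
  (* Coinciding vertices would give j = i + k n with i and j both below n, hence k = 0 and i = j. *)
  rewrite lt0r circle_dist_ge0 andbT; apply/eqP => /circle_dist_eq0[k].
  rewrite (aE j (ltnW (ltn_ord j))) (aE i (ltnW (ltn_ord i))) -addrA => /addrI h.
  have : (j%:Z)%:~R = (i%:Z + k * n%:Z)%:~R :> R.
    rewrite intrD intrM -[LHS](divfK (lt0r_neq0 n0')) [X in X * _]h mulrDl divfK//.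
    by rewrite gt_eqF.
  move=> /intr_inj => jik; move: ji; apply/negP; rewrite negbK; apply/eqP/val_inj => /=.
  have := ltn_ord i; have := ltn_ord j; case: (ltgtP k 0) jik => [k0|k0|->]; last by lia.
    have : k * n%:Z <= - n%:Z by rewrite -[leRHS]mulN1r ler_wpM2r//; lia.
    by lia.
  have : n%:Z <= k * n%:Z by rewrite -[leLHS]mul1r ler_wpM2r.
  by lia.
rewrite !inver !sqrf_eq0 (gt_eqF (embedded_enorm_gt0 ce ts0)) (gt_eqF ts0).
rewrite -EFinB -!EFinM; congr (_%:E).
by rewrite densityC /density -mulrA -invfM -expr2.
Qed.

End Discrete.

(** * Lattice sums as integrals of step functions *)

Section Cells.
Context {R : realType}.

Definition cell (n : nat) (t : R) : nat := Num.truncn (t * n%:R).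

Lemma cellP n t i : (0 < n)%N -> i%:R / n%:R <= t < i.+1%:R / n%:R -> cell n t = i.
Proof.
move=> n0; have n0' : 0 < n%:R :> R by rewrite ltr0n.
by rewrite ler_pdivrMr// ltr_pdivlMr// => h; exact: truncn_def.
Qed.

Lemma cell_itv n t : (0 < n)%N -> 0 <= t ->
  (cell n t)%:R / n%:R <= t < (cell n t).+1%:R / n%:R.
Proof.
move=> n0 t0; have n0' : 0 < n%:R :> R by rewrite ltr0n.
by rewrite ler_pdivrMr// ltr_pdivlMr//; apply: truncn_itv; rewrite mulr_ge0.
Qed.

Lemma cell_dist n (r t : R) : (0 < n)%N -> 0 <= t -> 0 <= r < n%:R^-1 ->
  `|t - (r + (cell n t)%:R / n%:R)| <= n%:R^-1.
Proof.
move=> n0 t0 /andP[r0 rn]; have := cell_itv n0 t0.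
rewrite -natr1 mulrDl mul1r => /andP[h1 h2]; rewrite ler_norml; lra.
Qed.

(** The bridge between discrete and continuous energies: with it each comparison of a lattice sum
    with an integral is a pointwise inequality. *)
Lemma dint_cell n (b : nat -> nat -> R) : (0 < n)%N -> (forall i j, 0 <= b i j) ->
  dint_fun (fun t s => b (cell n t) (cell n s)) /\
  dint (fun t s => b (cell n t) (cell n s)) =
    (\sum_(i < n) \sum_(j < n) b i j / n%:R ^+ 2)%:E.
Proof.
move=> n0 b0; apply: dint_step => // i j i_n j_n t s ti sj.
by rewrite (cellP n0 ti) (cellP n0 sj).
Qed.

Lemma sum_cell_const n (w : R) : (0 < n)%N ->
  \sum_(i < n) \sum_(j < n) w / n%:R ^+ 2 = w.
Proof.
move=> n0; have n0' : 0 < n%:R :> R by rewrite ltr0n.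
by rewrite sumr_const sumr_const card_ord -mulrnA -[LHS]mulr_natr natrM; field; rewrite gt_eqF.
Qed.

Lemma inv_small (e : R) : 0 < e -> exists N : nat, forall n, (N <= n)%N ->
  (0 < n)%N /\ n%:R^-1 <= e.
Proof.
move=> e0; exists (Num.truncn e^-1).+1 => n Nn; have n0 : (0 < n)%N by apply: leq_trans Nn.
split=> //; rewrite -[leRHS]invrK lef_pV2 ?posrE ?invr_gt0 ?ltr0n//.
have i0 : 0 <= e^-1 by rewrite invr_ge0 ltW.
by have /andP[_ /ltW h] := truncn_itv i0; apply: le_trans h _; rewrite ler_nat.
Qed.

Lemma inv_sqr_continuous (m w : R) : 0 < m -> 0 < w -> exists2 h, 0 < h &
  forall x y, m <= x -> `|x - y| <= h -> `|(x ^+ 2)^-1 - (y ^+ 2)^-1| <= w.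
Proof.
(* The first bound keeps y above m / 2; then x^-1 y^-2 + x^-2 y^-1 is at most (4 + 2) / m^3, whence
   the second. *)
move=> m0 w0; pose h := Num.min (m / 2) (w * m ^+ 3 / 6).
have h0 : 0 < h by rewrite lt_min !divr_gt0// mulr_gt0// exprn_gt0.
exists h => // x y mx xy.
have h1 : h <= m / 2 by rewrite ge_min lexx.
have h2 : h <= w * m ^+ 3 / 6 by rewrite ge_min lexx orbT.
have my : m / 2 <= y by move: xy; rewrite ler_norml; lra.
have x0 : 0 < x by lra.
have y0 : 0 < y by lra.
have -> : (x ^+ 2)^-1 - (y ^+ 2)^-1 = (y - x) * (x^-1 * (y^-1) ^+ 2 + (x^-1) ^+ 2 * y^-1).
  by field; rewrite !gt_eqF.
have xm : x^-1 <= m^-1 by rewrite lef_pV2 ?posrE.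
have ym : y^-1 <= 2 * m^-1.
  by rewrite -[2]invrK -invfM lef_pV2 ?posrE// ?mulr_gt0// mulrC.
have x1 : 0 <= x^-1 by rewrite invr_ge0 ltW.
have y1 : 0 <= y^-1 by rewrite invr_ge0 ltW.
have m1 : 0 <= m^-1 by rewrite invr_ge0 ltW.
have A0 : 0 <= x^-1 * (y^-1) ^+ 2 + (x^-1) ^+ 2 * y^-1.
  by rewrite addr_ge0// mulr_ge0// sqr_ge0.
rewrite normrM distrC (ger0_norm A0).
apply: (@le_trans _ _ (h * (m^-1 * (2 * m^-1) ^+ 2 + (m^-1) ^+ 2 * (2 * m^-1)))).
  apply: ler_pM => //.
  by apply: lerD; apply: ler_pM; rewrite ?sqr_ge0// ler_pXn2r// nnegrE// mulr_ge0.
apply: (@le_trans _ _ (w * m ^+ 3 / 6 * (6 * m^-1 ^+ 3))).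
  rewrite (_ : _ + _ = 6 * m^-1 ^+ 3); last by ring.
  by rewrite ler_wpM2r// mulr_ge0// exprn_ge0.
by rewrite le_eqVlt (_ : _ * _ = w) ?eqxx//; field; rewrite gt_eqF.
Qed.

End Cells.

(** * Uniform comparison away from the diagonal *)

Section Compare.
Context {R : realType} {d : nat} (c : R -> 'rV[R]_d).
Hypotheses (ce : embedded c) (cl : lipschitz1 c).

Lemma circle_dist2_continuous : continuous (fun z : R * R => circle_dist z.1 z.2).
Proof.
have -> : (fun z : R * R => circle_dist z.1 z.2) =
    (fun x => circle_dist x 0) \o (fun z : R * R => z.1 - z.2).
  by apply/funext => z /=; rewrite /circle_dist subr0.
move=> z; apply: continuous_comp; last exact: circle_dist_continuous.
by apply: cvgB; [exact: cvg_fst|exact: cvg_snd].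
Qed.

(** The chord length is continuous and positive on the compact set of pairs of [0, 1]^2 at circle
    distance at least [r]; periodicity brings every pair there. *)
Lemma separation (r : R) : 0 < r -> exists2 m, 0 < m &
  forall t s, r <= circle_dist t s -> m <= enorm (c t - c s).
Proof.
move=> r0.
pose A := (`[0%R, 1%R]%classic `*` `[0%R, 1%R]%classic) `&`
  [set z : R * R | r <= circle_dist z.1 z.2].
have red t s : r <= circle_dist t s -> exists t' s', A (t', s') /\ c t' = c t /\ c s' = c s.
  move=> rts; have [cc _] := ce.
  exists (t - (Num.floor t)%:~R), (s - (Num.floor s)%:~R).
  rewrite -!rmorphN/= !(closed_curve_period cc); split=> //.
  rewrite /A /= circle_distDl circle_distDr; split=> //.
  rewrite !in_itv/= !rmorphN/=.
  have /andP[a1 a2] := floor_itv t; have /andP[b1 b2] := floor_itv s.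
  by move: a2 b2; rewrite !intrD; split; lra.
have [[z0 Az0]|A0] := pselect (A !=set0); last first.
  exists 1 => // t s /red[t' [s' [At _]]].
  by exfalso; apply: A0; exists (t', s').
have cA : compact A.
  apply: compact_closedI.
    by apply: compact_setX; exact: segment_compact.
  apply: (closed_comp (f := fun z : R * R => circle_dist z.1 z.2) (D := [set x | r <= x])).
    by move=> z _; exact: circle_dist2_continuous.
  exact: closed_ge.
have A1 : A !=set0 by exists z0.
have [|z /set_mem Az zmin] := @compact_EVT_min _ R (fun z => enorm (c z.1 - c z.2)) A A1 cA.
  apply: continuous_subspaceT => z.
  apply: (@continuous_comp _ _ _ (fun z : R * R => c z.1 - c z.2) enorm); last exact: enorm_continuous.
  have cc : continuous c by case: ce => -[].
  apply: cvgB.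
    by apply: (@continuous_comp _ _ _ fst c); [exact: cvg_fst|exact: cc].
  by apply: (@continuous_comp _ _ _ snd c); [exact: cvg_snd|exact: cc].
exists (enorm (c z.1 - c z.2)).
  by apply: (embedded_enorm_gt0 ce); case: Az => _ /(lt_le_trans r0).
move=> t s /red[t' [s' [At [<- <-]]]].
by apply: (zmin (t', s')); exact: mem_set.
Qed.

(** Points and parameters are perturbed independently, so that P and Q can be values of another
    curve at grid parameters t' and s'. One [h] serves all pairs at distance at least [r] because
    chords there are bounded below. *)
Lemma density_perturb (r w : R) : 0 < r -> 0 < w -> exists2 h, 0 < h &
  forall t s t' s' P Q, r <= circle_dist t s ->
    `|t - t'| <= h -> `|s - s'| <= h -> enorm (c t - P) <= h -> enorm (c s - Q) <= h ->
    `|density c t s - ((enorm (P - Q) ^+ 2)^-1 - (circle_dist t' s' ^+ 2)^-1)| <= w.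
Proof.
move=> r0 w0; have w2 : 0 < w / 2 by rewrite divr_gt0.
have [m m0 hm] := separation r0.
have [h1 h10 H1] := inv_sqr_continuous m0 w2.
have [h2 h20 H2] := inv_sqr_continuous r0 w2.
exists (Num.min (h1 / 2) (h2 / 2)); first by rewrite lt_min !divr_gt0.
set h := Num.min _ _; have hh1 : h <= h1 / 2 by rewrite ge_min lexx.
have hh2 : h <= h2 / 2 by rewrite ge_min lexx orbT.
move=> t s t' s' P Q rts tt' ss' tP sQ.
have := H1 _ (enorm (P - Q)) (hm t s rts) => /(_ _)/wrap[].
  apply: le_trans (ler_dist_enorm _ _) _.
  rewrite (_ : _ - _ - _ = (c t - P) - (c s - Q)); last first.
    by rewrite !opprB addrACA [RHS]addrACA (addrC (- P)) (addrC (-c s)).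
  by apply: le_trans (ler_enormB _ _) _; lra.
move=> k1; have := H2 _ (circle_dist t' s') rts => /(_ _)/wrap[].
  by apply: le_trans (circle_dist_dist _ _ _ _) _; lra.
move: k1; rewrite /density !ler_norml; lra.
Qed.

(** Only far pairs of [c] have to be matched; the other terms of the lattice sum are nonnegative and
    are dropped. *)
Lemma lattice_energy_ge (r w : R) : 0 < r -> 0 < w -> exists2 h, 0 < h &
  exists N : nat, forall n q x, (N <= n)%N -> embedded q -> lipschitz1 q ->
    (forall t, enorm (c t - q t) <= h) -> 0 <= x < n%:R^-1 ->
    (dint (far_density c r) <= (lattice_energy n x q + w)%:E)%E.
Proof.
move=> r0 w0; have [h h0 hH] := density_perturb r0 w0.
have h2 : 0 < h / 2 by rewrite divr_gt0.
have [N HN] := inv_small h2.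
exists (h / 2) => //; exists N => n q x Nn qe ql hq xn.
have [n0 nh] := HN n Nn.
pose b i j := density q (x + i%:R / n%:R) (x + j%:R / n%:R) + w.
have b0 i j : 0 <= b i j by rewrite addr_ge0 ?(ltW w0)// density_ge0.
have [mB EB] := dint_cell n0 b0.
have -> : lattice_energy n x q + w = \sum_(i < n) \sum_(j < n) b i j / n%:R ^+ 2.
  rewrite /lattice_energy -{1}(sum_cell_const w n0) -big_split/=; apply: eq_bigr => i _.
  by rewrite -big_split/=; apply: eq_bigr => j _; rewrite -mulrDl.
rewrite -EB; apply: dint_le => //; first exact: dint_fun_far_density.
move=> t s; rewrite /= !in_itv/= => /andP[t0 t1] /andP[s0 s1].
rewrite /far_density; case: ifPn => [_|]; first exact: b0.
rewrite -leNgt => rts; rewrite /b.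
have ht := cell_dist n0 t0 xn; have hs := cell_dist n0 s0 xn.
set t' := x + _ / _ in ht *; set s' := x + _ / _ in hs *.
have tq (u u' : R) : `|u - u'| <= n%:R^-1 -> enorm (c u - q u') <= h.
  move=> uu'; apply: le_trans (ler_enorm_trans (q u) _ _) _.
  have := hq u; have := ql u' u; lra.
have ht' : `|t - t'| <= h by lra.
have hs' : `|s - s'| <= h by lra.
have := hH t s t' s' (q t') (q s') rts ht' hs' (tq _ _ ht) (tq _ _ hs).
by rewrite -/(density q t' s') ler_norml => /andP[]; lra.
Qed.

Lemma lattice_energy_far_le (r w : R) : 0 < r -> 0 < w -> exists2 h, 0 < h &
  exists N : nat, forall n q x, (N <= n)%N -> embedded q -> lipschitz1 q ->
    (forall t, enorm (c t - q t) <= h) -> 0 <= x < n%:R^-1 ->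
    ((\sum_(i < n) \sum_(j < n) far_density q r (x + i%:R / n%:R) (x + j%:R / n%:R)
        / n%:R ^+ 2)%:E <= dint (density c) + w%:E)%E.
Proof.
(* Here the cut-off [r] applies to the vertices of [q]. Passing from a vertex to a point of its cell
   costs at most r / 4 on each side, so the pairs for [c] are still r / 2 apart. *)
move=> r0 w0; have r2 : 0 < r / 2 by rewrite divr_gt0.
have [h h0 hH] := density_perturb r2 w0.
have h2 : 0 < Num.min (h / 2) (r / 4) by rewrite lt_min !divr_gt0.
have [N HN] := inv_small h2.
exists (h / 2); first by rewrite divr_gt0.
exists N => n q x Nn qe ql hq xn.
have [n0 nh] := HN n Nn.
have nh1 : n%:R^-1 <= h / 2 by apply: le_trans nh _; rewrite ge_min lexx.
have nr : n%:R^-1 <= r / 4 by apply: le_trans nh _; rewrite ge_min lexx orbT.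
pose b i j := far_density q r (x + i%:R / n%:R) (x + j%:R / n%:R).
have b0 i j : 0 <= b i j.
  by rewrite /b /far_density; case: ifP => // _; exact: density_ge0.
have [mB EB] := dint_cell n0 b0.
have [mW EW] := @dint_cell R n (fun _ _ => w) n0 (fun _ _ => ltW w0).
have mc := dint_fun_density ce cl.
have [mS ES] := dintD mc mW.
rewrite -EB -(sum_cell_const w n0) -EW -ES; apply: dint_le => //.
move=> t s; rewrite /= !in_itv/= => /andP[t0 t1] /andP[s0 s1].
rewrite /b /far_density; case: ifPn => [_|].
  by rewrite addr_ge0 ?(ltW w0)// density_ge0.
have ht := cell_dist n0 t0 xn; have hs := cell_dist n0 s0 xn.
set t' := x + _ / _ in ht *; set s' := x + _ / _ in hs *.
rewrite -leNgt => rts.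
have rts' : r / 2 <= circle_dist t s.
  have := circle_dist_dist t' s' t s; rewrite (distrC t') (distrC s') ler_norml; lra.
have tq (u u' : R) : `|u - u'| <= n%:R^-1 -> enorm (c u - q u') <= h.
  move=> uu'; apply: le_trans (ler_enorm_trans (q u) _ _) _.
  have := hq u; have := ql u' u; lra.
have ht' : `|t - t'| <= h by lra.
have hs' : `|s - s'| <= h by lra.
have := hH t s t' s' (q t') (q s') rts' ht' hs' (tq _ _ ht) (tq _ _ hs).
by rewrite -/(density q t' s') ler_norml => /andP[]; lra.
Qed.

End Compare.

(** * Flatness and bi-Lipschitz bounds from finite energy *)

Section Flatness.
Context {R : realType} {d : nat}.
Implicit Types c : R -> 'rV[R]_d.

(** The arc-length excess in squared form: it is the numerator of [density] over a common
    denominator, and sums of edge vectors are computed best in squares. *)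
Definition defect c (t s : R) : R := (s - t) ^+ 2 - enorm (c s - c t) ^+ 2.

(** Let S and C be arc and chord of the smaller arc and D the added length. The larger chord is at
    most C + D, so the defect grows by at least 2 D (S - C), which is nonnegative. *)
Lemma defect_homo c t' t s s' : lipschitz1 c -> t' <= t <= s -> s <= s' ->
  defect c t s <= defect c t' s'.
Proof.
move=> cl /andP[t't ts] ss'; rewrite /defect.
have : enorm (c s' - c t') <= enorm (c s - c t) + (s' - s) + (t - t').
  apply: le_trans (ler_enorm_trans (c s) _ _) _.
  have := cl s s'; rewrite ger0_norm ?subr_ge0// => h1.
  have := ler_enorm_trans (c t) (c s) (c t').
  by have := cl t' t; rewrite ger0_norm ?subr_ge0// => h2 h3; lra.
have := cl t s; rewrite ger0_norm ?subr_ge0//.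
have := enorm_ge0 (c s - c t); have := enorm_ge0 (c s' - c t').
by nra.
Qed.

Lemma densityE c t s : embedded c -> t < s -> s - t <= 2^-1 ->
  density c t s = defect c t s / ((s - t) ^+ 2 * enorm (c s - c t) ^+ 2).
Proof.
move=> ce ts st; have ts' : `|t - s| = s - t by rewrite ltr0_norm ?subr_lt0// opprB.
have cd : circle_dist t s = s - t by rewrite circle_distE ts'.
have e0 : 0 < enorm (c t - c s) by apply: embedded_enorm_gt0 => //; rewrite cd subr_gt0.
rewrite /density /defect cd (enorm_distC (c s)); field.
by rewrite gt_eqF//= gt_eqF// subr_gt0.
Qed.

Lemma density_ge_defect c t s : embedded c -> lipschitz1 c -> t < s -> s - t <= 2^-1 ->
  defect c t s / (s - t) ^+ 4 <= density c t s.
Proof.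
move=> ce cl ts st; rewrite densityE//.
have st0 : 0 < s - t by rewrite subr_gt0.
have cd : circle_dist s t = s - t by rewrite circle_distE gtr0_norm.
have e0 : 0 < enorm (c s - c t) by apply: embedded_enorm_gt0 => //; rewrite cd.
have el : enorm (c s - c t) <= s - t by have := cl t s; rewrite gtr0_norm.
rewrite ler_wpM2l//.
  by rewrite /defect subr_ge0 ler_pXn2r ?nnegrE ?(ltW st0) ?(ltW e0)//.
rewrite lef_pV2 ?posrE ?mulr_gt0 ?exprn_gt0// (_ : 4%N = (2 + 2)%N)// exprD.
by rewrite ler_wpM2l ?sqr_ge0// ler_pXn2r ?nnegrE ?(ltW st0) ?(ltW e0)//.
Qed.

Lemma density_le_defect c t s (l : R) : embedded c -> lipschitz1 c -> 0 < l ->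
  t < s -> s - t <= 2^-1 -> l * (s - t) <= enorm (c s - c t) ->
  density c t s <= defect c t s / (l ^+ 2 * (s - t) ^+ 4).
Proof.
move=> ce cl l0 ts st hl; rewrite densityE//.
have st0 : 0 < s - t by rewrite subr_gt0.
have e0 : 0 < enorm (c s - c t) by apply: lt_le_trans hl; rewrite mulr_gt0.
have el : enorm (c s - c t) <= s - t by have := cl t s; rewrite gtr0_norm.
rewrite ler_wpM2l//.
  by rewrite /defect subr_ge0 ler_pXn2r ?nnegrE ?(ltW st0) ?(ltW e0)//.
rewrite lef_pV2 ?posrE ?mulr_gt0 ?exprn_gt0// (_ : 4%N = (2 + 2)%N)// exprD.
rewrite mulrCA ler_wpM2l ?sqr_ge0// -exprMn.
by rewrite ler_pXn2r ?nnegrE ?(ltW e0)// mulr_ge0 ?(ltW st0) ?(ltW l0).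
Qed.

Lemma near_density_periodl c r t s (k : int) : closed_curve c ->
  near_density c r (t + k%:~R) s = near_density c r t s.
Proof. by move=> cc; rewrite /near_density density_periodl// circle_distDl. Qed.

Lemma near_density_periodr c r t s (k : int) : closed_curve c ->
  near_density c r t (s + k%:~R) = near_density c r t s.
Proof. by move=> cc; rewrite /near_density density_periodr// circle_distDr. Qed.

Lemma near_density_ge0 c r t s : embedded c -> lipschitz1 c -> 0 <= near_density c r t s.
Proof. by move=> ce cl; rewrite /near_density; case: ifP => // _; exact: density_ge0. Qed.

Lemma cell_lift (n : nat) (i : int) (t : R) : (0 < n)%N ->
  `|(i %% n)%Z|%:R / n%:R <= t < `|(i %% n)%Z|.+1%:R / n%:R ->
  i%:~R / n%:R <= t + ((i %/ n)%Z)%:~R < (i + 1)%:~R / n%:R.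
Proof.
move=> n0 /andP[h1 h2].
have n0' : 0 < n%:R :> R by rewrite ltr0n.
have e : i%:~R = (`|(i %% n)%Z|%N)%:R + n%:R * ((i %/ n)%Z)%:~R :> R.
  rewrite {1}(divz_eq i n) intrD intrM addrC mulrC; congr (_ + _).
  by rewrite -[in LHS](gez0_abs (modz_ge0 i _))//; lia.
rewrite intrD e !mulrDl mulrAC divff ?gt_eqF// mul1r.
by move: h2; rewrite -natr1 mulrDl; lra.
Qed.

(** A bound on a single lattice square already bounds the energy below. The square may lie anywhere
    in the plane: periodicity moves it to the one with indices reduced modulo n. *)
Lemma dint_near_rect c r n (i j : int) (a : R) : embedded c -> lipschitz1 c ->
  (0 < n)%N -> 0 <= a ->
  (forall t s, i%:~R / n%:R <= t < (i + 1)%:~R / n%:R ->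
     j%:~R / n%:R <= s < (j + 1)%:~R / n%:R -> a <= near_density c r t s) ->
  ((a / n%:R ^+ 2)%:E <= dint (near_density c r))%E.
Proof.
move=> ce cl n0 a0 h; have [cc _] := ce.
have n0' : 0 < n%:R :> R by rewrite ltr0n.
pose i' := `|(i %% n)%Z|%N; pose j' := `|(j %% n)%Z|%N.
have i'n : (i' < n)%N by rewrite /i'; have := @ltz_pmod i n; have := modz_ge0 i (d := n); lia.
have j'n : (j' < n)%N by rewrite /j'; have := @ltz_pmod j n; have := modz_ge0 j (d := n); lia.
pose b k l := if (k == i') && (l == j') then a else 0.
have b0 k l : 0 <= b k l by rewrite /b; case: ifP.
have [mB EB] := dint_cell n0 b0.
have <- : \sum_(k < n) \sum_(l < n) b k l / n%:R ^+ 2 = a / n%:R ^+ 2.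
  rewrite (bigD1 (Ordinal i'n))//= (bigD1 (Ordinal j'n))//= big1 ?addr0; last first.
    by move=> l; rewrite -val_eqE/= => /negbTE lj; rewrite /b lj andbF mul0r.
  rewrite big1 ?addr0 => [|k]; first by rewrite /b !eqxx.
  rewrite -val_eqE/= => /negbTE ki; rewrite big1// => l _; by rewrite /b ki mul0r.
rewrite -EB; apply: dint_le => //; first exact: dint_fun_near_density.
move=> t s; rewrite /= !in_itv/= => /andP[t0 t1] /andP[s0 s1]; rewrite /b.
case: ifPn => [/andP[/eqP ti /eqP sj]|_]; last exact: near_density_ge0.
rewrite -(near_density_periodl r t s (i %/ n)%Z cc).
rewrite -(near_density_periodr r _ s (j %/ n)%Z cc).
apply: h; apply: cell_lift => //; [rewrite -/i' -ti|rewrite -/j' -sj]; exact: cell_itv.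
Qed.

(** An arc of length w that is too bent has defect at least e w^2, and so do all arcs obtained by
    extending it by at most w at each end. Their densities are at least e w^2 / (3 w)^4 on a lattice
    square of side at least w / 3, which costs the scale-invariant energy e / 3^6, more than the
    near part has. *)
Lemma flatness c : embedded c -> lipschitz1 c -> (dint (density c) < +oo)%E ->
  forall e, 0 < e <= 1 -> exists2 r, 0 < r &
    forall t s, `|s - t| <= r -> (1 - e) * `|s - t| <= enorm (c s - c t).
Proof.
move=> ce cl fin e /andP[e0 e1].
have e6 : 0 < e * 3^-1 ^+ 6 by rewrite mulr_gt0// exprn_gt0// invr_gt0.
have [r0 r00 hr0] := dint_near_small ce cl fin e6.
(* The extended arcs have length at most 3 w: this must be below [r0], and at most 1/2, where circle
   distance is distance on the line. *)
pose r := Num.min (r0 / 4) (1 / 6).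
have rr0 : r <= r0 / 4 by rewrite ge_min lexx.
have r6 : r <= 1 / 6 by rewrite ge_min lexx orbT.
exists r; first by rewrite lt_min !divr_gt0.
move=> t s; wlog : t s / t < s.
  move=> H; have [ts|st|->] := ltgtP t s; first exact: H.
    by rewrite distrC enorm_distC; exact: H.
  by rewrite !subrr normr0 mulr0 enorm_ge0.
move=> ts; rewrite gtr0_norm ?subr_gt0// => wr.
rewrite leNgt; apply/negP => hlt.
set w := s - t in wr hlt; have w0 : 0 < w by rewrite subr_gt0.
(* Then 1/n lies between w / 3 and w / 2, so every interval of length w contains a whole cell, and
   cells are not much smaller than w. *)
pose n := (Num.truncn (2 / w)).+1.
have /andP[n1 n2] : (n.-1)%:R <= 2 / w < n%:R.
  by rewrite /n; apply: truncn_itv; rewrite divr_ge0 ?ltW.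
have n0 : (0 < n)%N by [].
have n0' : 0 < n%:R :> R by rewrite ltr0n.
have nw : n%:R^-1 <= w / 2.
  rewrite -[leRHS]invrK lef_pV2 ?posrE ?invr_gt0 ?divr_gt0// invf_div; exact: ltW.
have nw' : w / 3 <= n%:R^-1.
  rewrite -[leLHS]invrK lef_pV2 ?posrE ?invr_gt0 ?divr_gt0// invf_div.
  apply: (@le_trans _ _ (2 / w + 1)); first by rewrite -(prednK n0) -natr1 lerD2r.
  rewrite -[X in _ + X](divff (lt0r_neq0 w0)) -mulrDl ler_wpM2r ?invr_ge0 ?ltW//; lra.
have itv_of (x : R) : exists k : int,
    x <= k%:~R / n%:R /\ (k + 1)%:~R / n%:R <= x + w.
  have /andP[f1 f2] := floor_itv (x * n%:R).
  exists (Num.floor (x * n%:R) + 1); split; first by rewrite ler_pdivlMr// ltW.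
  rewrite intrD mulrDl intrD mulrDl mul1r.
  have : (Num.floor (x * n%:R))%:~R / n%:R <= x by rewrite ler_pdivrMr.
  by move: nw; lra.
have [i [i1 i2]] := itv_of (t - w); have [j [j1 j2]] := itv_of s.
pose a := e / (3 ^+ 4 * w ^+ 2).
have a0 : 0 <= a by rewrite divr_ge0 ?mulr_ge0 ?sqr_ge0 ?exprn_ge0// ltW.
have : ((a / n%:R ^+ 2)%:E <= dint (near_density c r0))%E.
  apply: (dint_near_rect (i := i) (j := j)) => // t' s' /andP[it ti] /andP[js sj].
  have tt' : t - w <= t' <= t by apply/andP; split; lra.
  have ss' : s <= s' <= s + w by apply/andP; split; lra.
  move: tt' ss' => /andP[tt1 tt2] /andP[ss1 ss2].
  have ts' : t' < s' by lra.
  have sw : s' - t' <= 3 * w by rewrite /w; move: tt1 ss2; rewrite /w; lra.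
  have half : s' - t' <= 2^-1 by lra.
  have cd : circle_dist t' s' = s' - t'.
    have nst : `|s' - t'| = s' - t' by rewrite gtr0_norm ?subr_gt0.
    by rewrite circle_distC circle_distE nst.
  rewrite /near_density ifT; last by rewrite cd; lra.
  apply: le_trans (density_ge_defect ce cl ts' half).
  have D : e * w ^+ 2 <= defect c t' s'.
    apply: (@le_trans _ _ (defect c t s)); last first.
      by apply: defect_homo => //; rewrite tt2 ltW.
    rewrite /defect -/w; have := enorm_ge0 (c s - c t); move: hlt w0 e0 e1.
    set x := enorm _ => x1 w0 e0 e1 x0.
    have : x ^+ 2 <= ((1 - e) * w) ^+ 2 by nra.
    by nra.
  have a' : a = (e * w ^+ 2) / (3 * w) ^+ 4 by rewrite /a; field; rewrite gt_eqF.
  have st0 : 0 < s' - t' by rewrite subr_gt0.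
  rewrite a'; apply: ler_pM => //.
  - by rewrite mulr_ge0 ?sqr_ge0// ltW.
  - by rewrite invr_ge0 exprn_ge0// mulr_ge0// ltW.
  - rewrite lef_pV2 ?posrE ?exprn_gt0 ?mulr_gt0// ler_pXn2r ?nnegrE ?(ltW st0)//.
    by rewrite mulr_ge0// ltW.
apply/negP; rewrite -ltNge; apply: lt_le_trans hr0 _; rewrite lee_fin.
have -> : e * 3^-1 ^+ 6 = a * (w / 3) ^+ 2 by rewrite /a; field; rewrite gt_eqF.
by rewrite ler_wpM2l// -exprVn ler_pXn2r ?nnegrE ?invr_ge0 ?divr_ge0// ltW.
Qed.

Lemma bilipschitz c : embedded c -> lipschitz1 c -> (dint (density c) < +oo)%E ->
  exists2 l, 0 < l <= 1 & forall t s, l * circle_dist t s <= enorm (c t - c s).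
Proof.
move=> ce cl fin; have [cc _] := ce.
have [|r r0 hr] := @flatness c ce cl fin 2^-1; first by apply/andP; split; lra.
have [m m0 hm] := separation ce r0.
exists (Num.min 2^-1 m).
  by rewrite lt_min m0 invr_gt0 ltr0n/= ge_min; apply/orP; left; lra.
move=> t s; have cd0 := circle_dist_ge0 t s.
have l1 : Num.min 2^-1 m <= 2^-1 by rewrite ge_min lexx.
have l2 : Num.min 2^-1 m <= m by rewrite ge_min lexx orbT.
have [h|h] := leP r (circle_dist t s).
  apply: le_trans (hm _ _ h); have := circle_dist_le_half t s.
  by nra.
have [k e] := circle_dist_lift t s.
rewrite -(closed_curve_period cc s k); apply: (@le_trans _ _ (2^-1 * `|t - (s + k%:~R)|)).
  by rewrite -e ler_wpM2r.
by apply: le_trans (hr _ _ _); [rewrite ler_wpM2r//; lra|rewrite -e ltW].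
Qed.

End Flatness.

(** * Inscribed polygons *)

Section Interpolation.
Context {R : realType} {d : nat}.
Implicit Types (z w : int -> 'rV[R]_d).

Definition interp (n : nat) z (t : R) : 'rV[R]_d :=
  let i := Num.floor (t * n%:R) in z i + (t * n%:R - i%:~R) *: (z (i + 1) - z i).

Lemma interp_on n z (i : int) t : i%:~R <= t * n%:R <= (i + 1)%:~R ->
  interp n z t = z i + (t * n%:R - i%:~R) *: (z (i + 1) - z i).
Proof.
move=> /andP[h1]; rewrite le_eqVlt => /orP[/eqP h2|h2].
  rewrite /interp h2 intrKfloor subrr scale0r addr0 intrD.
  by rewrite (addrC i%:~R) addrK scale1r [RHS]addrC subrK.
by rewrite /interp (@floor_def _ _ i) ?h1.
Qed.

Lemma interp_node n z (i : int) : (0 < n)%N -> interp n z (i%:~R / n%:R) = z i.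
Proof.
move=> n0; have n0' : n%:R != 0 :> R by rewrite pnatr_eq0 -lt0n.
by rewrite (@interp_on _ _ i) divfK// ?subrr ?scale0r ?addr0// lexx ler_int lerDl.
Qed.

Lemma interpB n z w t : interp n z t - interp n w t = interp n (fun i => z i - w i) t.
Proof.
rewrite /interp; set i := Num.floor _; set a := _ - i%:~R.
by rewrite !scalerBr; apply/rowP => j; rewrite !mxE; ring.
Qed.

Lemma interp_linear n (v : 'rV[R]_d) t : (0 < n)%N ->
  interp n (fun i => (i%:~R / n%:R) *: v) t = t *: v.
Proof.
move=> n0; have n0' : n%:R != 0 :> R by rewrite pnatr_eq0 -lt0n.
rewrite /interp; set i := Num.floor _.
by apply/rowP => j; rewrite !mxE intrD; field.
Qed.

(** Induction on the number of cells between [t] and [s]. Only edges met on the way are constrained,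
    since in [inscribed_bilipschitz] the slopes are controlled on short stretches only. *)
Lemma interp_lipschitz_local n z (a t s : R) : (0 < n)%N -> t <= s ->
  (forall i, Num.floor (t * n%:R) <= i <= Num.floor (s * n%:R) ->
     enorm (z (i + 1) - z i) <= a / n%:R) ->
  enorm (interp n z s - interp n z t) <= a * (s - t).
Proof.
move=> n0; have n0' : 0 < n%:R :> R by rewrite ltr0n.
rewrite le_eqVlt => /orP[/eqP -> _|ts]; first by rewrite !subrr enorm0 mulr0.
set i := Num.floor (t * _); set j := Num.floor (s * _) => h.
have /andP[i1 i2] := floor_itv (t * n%:R); have /andP[j1 j2] := floor_itv (s * n%:R).
rewrite -/i in i1 i2; rewrite -/j in j1 j2.
have tsn : t * n%:R < s * n%:R by rewrite ltr_pM2r.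
have ij : i <= j by rewrite /j floor_ge_int (le_trans i1)// ltW.
have seg (k : int) u v : i <= k <= j -> k%:~R <= u * n%:R -> u <= v ->
    v * n%:R <= (k + 1)%:~R -> enorm (interp n z v - interp n z u) <= a * (v - u).
  move=> kij ku uv vk; have uvn : u * n%:R <= v * n%:R by rewrite ler_pM2r.
  rewrite !(@interp_on n z k) ?ku ?vk ?(le_trans ku)// ?(le_trans _ vk)//.
  rewrite opprD addrACA subrr add0r -scalerBl enormZ ger0_norm; last by lra.
  apply: le_trans (ler_wpM2l _ (h _ kij)) _; first by lra.
  rewrite (_ : _ * (a / _) = a * (v - u))//; field; exact: lt0r_neq0.
have [m jm] : exists m : nat, j = i + m%:Z.
  by exists `|j - i|%N; rewrite gez0_abs ?subr_ge0// [RHS]addrC subrK.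
suff main : forall k : nat, (k <= m)%N -> forall v, t <= v ->
    (i + k%:Z)%:~R <= v * n%:R <= (i + k%:Z + 1)%:~R ->
    enorm (interp n z v - interp n z t) <= a * (v - t).
  by apply: (main m) => //; rewrite ?(ltW ts)// -jm j1 ltW.
elim=> [|k IH] km v tv /andP[v1 v2].
  by apply: (seg i) => //; rewrite ?lexx//; move: v2; rewrite addr0.
pose u : R := (i + k%:Z + 1)%:~R / n%:R.
have un : u * n%:R = (i + k%:Z + 1)%:~R by rewrite divfK// lt0r_neq0.
have k1 : i + k.+1%:Z = i + k%:Z + 1 by rewrite -addrA -PoszD addn1.
have tu : t <= u.
  by rewrite -(ler_pM2r n0') un ltW// (lt_le_trans i2)// ler_int lerD2r lerDl.
apply: le_trans (ler_enorm_trans (interp n z u) _ _) _.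
have -> : a * (v - t) = a * (v - u) + a * (u - t) by ring.
apply: lerD.
  apply: (seg (i + k.+1%:Z)) => //; first by rewrite lerDl jm lerD2l lez_nat.
    by rewrite un k1.
  by rewrite -(ler_pM2r n0') un -k1.
apply: IH => //; first exact: ltnW.
by rewrite un lexx andbT ler_int lerDl.
Qed.

Lemma interp_lipschitz n z (a : R) : (0 < n)%N ->
  (forall i, enorm (z (i + 1) - z i) <= a / n%:R) ->
  forall s t, enorm (interp n z t - interp n z s) <= a * `|t - s|.
Proof.
move=> n0 h s t; have [st|/ltW ts] := leP s t.
  by rewrite ger0_norm ?subr_ge0//; apply: interp_lipschitz_local.
rewrite enorm_distC distrC ger0_norm ?subr_ge0//.
exact: interp_lipschitz_local.
Qed.

Lemma interp_period n z : (0 < n)%N -> (forall i, z (i + n%:Z) = z i) ->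
  forall t, interp n z (t + 1) = interp n z t.
Proof.
move=> n0 zn t; rewrite /interp mulrDl mul1r.
rewrite (_ : Num.floor (t * n%:R + n%:R) = Num.floor (t * n%:R) + n%:Z); last first.
  by rewrite floorDrz ?(intr_int n)// (intrKfloor n).
rewrite [_ + n%:Z + 1]addrAC !zn; congr (_ + _ *: _); rewrite intrD; ring.
Qed.

(** Refining the lattice does not change a piecewise affine map. So an n-gon and a 2n-gon can be
    subtracted node by node. *)
Lemma interp_double n z t : (0 < n)%N ->
  interp n z t = interp n.*2 (fun k => interp n z (k%:~R / n.*2%:R)) t.
Proof.
move=> n0; have n0' : n%:R != 0 :> R by rewrite pnatr_eq0 -lt0n.
have n2 : n.*2%:R = 2 * n%:R :> R by rewrite -muln2 natrM mulrC.
have n2t : t * n.*2%:R = 2 * (t * n%:R) by rewrite n2; ring.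
set i := Num.floor (t * n%:R).
have /andP[i1 i2] := floor_itv (t * n%:R); rewrite -/i in i1 i2.
set k := Num.floor (t * n.*2%:R).
have /andP[k1 k2] := floor_itv (t * n.*2%:R); rewrite -/k in k1 k2.
have ik : 2 * i <= k.
  rewrite /k floor_ge_int intrM n2; move: i1; lra.
have ki : k + 1 <= 2 * (i + 1).
  rewrite lezD1 -(ltr_int R) intrM; apply: (@le_lt_trans _ _ (2 * (t * n%:R))).
    by rewrite -n2t.
  by rewrite ltr_pM2l.
have kn (m : int) : 2 * i <= m <= 2 * (i + 1) ->
    i%:~R <= (m%:~R / n.*2%:R * n%:R : R) <= (i + 1)%:~R.
  move=> /andP[]; rewrite -!(ler_int R) !intrM n2.
  have -> : m%:~R / (2 * n%:R) * n%:R = m%:~R / 2 :> R by field.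
  by move=> m1 m2; apply/andP; split; lra.
rewrite [RHS]/interp -/k (@interp_on n z i t) ?i1 ?(ltW i2)//.
rewrite (@interp_on n z i (k%:~R / _)); last by apply: kn; lia.
rewrite (@interp_on n z i ((k + 1)%:~R / _)); last by apply: kn; lia.
by apply/rowP => j; rewrite !mxE n2 intrD; field.
Qed.

End Interpolation.

Section Inscribed.
Context {R : realType} {d : nat} (c : R -> 'rV[R]_d).

Definition inscribed (n : nat) : R -> 'rV[R]_d := interp n (fun i => c (i%:~R / n%:R)).

Hypotheses (cc : closed_curve c) (cl : lipschitz1 c).

Let step n (i : int) : (0 < n)%N ->
  enorm (c ((i + 1)%:~R / n%:R) - c (i%:~R / n%:R)) <= n%:R^-1.
Proof.
move=> n0; apply: le_trans (cl _ _) _; rewrite -mulrBl intrD (addrC i%:~R) addrK mul1r.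
by rewrite ger0_norm.
Qed.

Lemma inscribed_lipschitz n : (0 < n)%N -> lipschitz1 (inscribed n).
Proof.
move=> n0 s t; rewrite -[leRHS]mul1r; apply: interp_lipschitz => // i.
by rewrite mul1r step.
Qed.

Lemma inscribed_period n t : (0 < n)%N -> inscribed n (t + 1) = inscribed n t.
Proof.
move=> n0; apply: interp_period => // i; rewrite intrD mulrDl divff ?cc.2//.
by rewrite pnatr_eq0 -lt0n.
Qed.

Lemma inscribed_closed n : (0 < n)%N -> closed_curve (inscribed n).
Proof.
move=> n0; split; first exact: (lipschitz1_continuous (inscribed_lipschitz n0)).
by move=> s; exact: inscribed_period.
Qed.

Lemma inscribed_close n t : (0 < n)%N -> enorm (inscribed n t - c t) <= 2 / n%:R.
Proof.
move=> n0; have n0' : 0 < n%:R :> R by rewrite ltr0n.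
pose i := Num.floor (t * n%:R); pose x : R := i%:~R / n%:R.
have /andP[i1 i2] := floor_itv (t * n%:R); rewrite -/i in i1 i2.
have tx : `|t - x| <= n%:R^-1.
  have x1 : x <= t by rewrite ler_pdivrMr.
  rewrite ger0_norm ?subr_ge0// -(ler_pM2r n0') mulVf ?lt0r_neq0// mulrBl divfK ?lt0r_neq0//.
  by move: i2; rewrite intrD; lra.
have h1 := inscribed_lipschitz n0 x t.
have h2 := cl x t.
have e : inscribed n x = c x by rewrite /inscribed interp_node.
apply: le_trans (ler_enorm_trans (c x) _ _) _.
rewrite -{1}e (enorm_distC (c x)); lra.
Qed.

(** Parallelogram identity for the two half chords: their lengths are at most h and their sum has
    length at least 2 (1 - e) h, which leaves at most 4 h^2 - 4 (1 - e)^2 h^2 for the difference. *)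
Lemma midpoint_defect (x y h e : R) : 0 <= e <= 1 -> 0 <= h -> y = x + h + h ->
  (1 - e) * `|y - x| <= enorm (c y - c x) ->
  enorm (c (x + h) - c x - (c y - c (x + h))) ^+ 2 <= 8 * e * h ^+ 2.
Proof.
move=> /andP[e0 e1] h0 yE; rewrite yE.
rewrite (_ : x + h + h - x = 2 * h); last by ring.
rewrite ger0_norm ?mulr_ge0// => fl.
have := parallelogram (c (x + h) - c x) (c (x + h + h) - c (x + h)).
rewrite [_ - _ + (_ - _)]addrC addrA subrK => pa.
have := cl x (x + h); have := cl (x + h) (x + h + h).
rewrite !(addrC _ h) !addrK !(addrC h) !ger0_norm// => a1 a2.
have b1 := enorm_ge0 (c (x + h) - c x).
have b2 := enorm_ge0 (c (x + h + h) - c (x + h)).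
have b3 : ((1 - e) * (2 * h)) ^+ 2 <= enorm (c (x + h + h) - c x) ^+ 2.
  by rewrite ler_pXn2r ?nnegrE ?enorm_ge0// !mulr_ge0// subr_ge0.
have b4 : enorm (c (x + h) - c x) ^+ 2 <= h ^+ 2 by rewrite ler_pXn2r ?nnegrE.
have b5 : enorm (c (x + h + h) - c (x + h)) ^+ 2 <= h ^+ 2 by rewrite ler_pXn2r ?nnegrE.
set X := enorm (_ - _ - _) ^+ 2 in pa *.
have -> : X = 2 * (enorm (c (x + h) - c x) ^+ 2 + enorm (c (x + h + h) - c (x + h)) ^+ 2)
   - enorm (c (x + h + h) - c x) ^+ 2 by rewrite -pa addrAC subrr add0r.
have : 0 <= e ^+ 2 * h ^+ 2 by rewrite mulr_ge0 ?sqr_ge0.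
by move: b3 b4 b5; rewrite !expr2; nra.
Qed.

Lemma slope_diff n (e a : R) (i : int) : (0 < n)%N -> 0 <= e <= 1 -> 0 <= a ->
  8 * e <= a ^+ 2 ->
  (forall t s, `|s - t| <= 2 / n%:R -> (1 - e) * `|s - t| <= enorm (c s - c t)) ->
  enorm ((c ((i + 2)%:~R / n%:R) - c ((i + 1)%:~R / n%:R)) -
    (c ((i + 1)%:~R / n%:R) - c (i%:~R / n%:R))) <= a / n%:R.
Proof.
move=> n0 e01 a0 ea fl; have n0' : 0 < n%:R :> R by rewrite ltr0n.
pose x : R := i%:~R / n%:R; pose h : R := n%:R^-1.
have e1 : (i + 1)%:~R / n%:R = x + h by rewrite intrD mulrDl mul1r.
have e2 : (i + 2)%:~R / n%:R = x + h + h by rewrite /x /h intrD; field; exact: lt0r_neq0.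
rewrite e1 e2 -/x enorm_distC.
have h0 : 0 <= h by rewrite invr_ge0.
rewrite -(@ler_pXn2r _ 2) ?nnegrE ?enorm_ge0 ?divr_ge0//.
apply: le_trans (midpoint_defect e01 h0 erefl _) _.
  apply: fl; rewrite (_ : _ - x = 2 * h); last by ring.
  by rewrite ger0_norm// mulr_ge0.
by rewrite exprMn ler_wpM2r// sqr_ge0.
Qed.

(** The difference is affine between nodes of the finer lattice and is 0 at even nodes. At an odd
    node it is half the difference of two consecutive chords, which [midpoint_defect] bounds. *)
Lemma inscribed_double n (e a : R) : (0 < n)%N -> 0 <= e <= 1 -> 0 <= a ->
  2 * e <= a ^+ 2 ->
  (forall t s, `|s - t| <= n%:R^-1 -> (1 - e) * `|s - t| <= enorm (c s - c t)) ->
  forall s t, enorm ((inscribed n.*2 t - inscribed n t) - (inscribed n.*2 s - inscribed n s))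
    <= a * `|t - s|.
Proof.
move=> n0 e01 a0 ea fl s t; have n0' : 0 < n%:R :> R by rewrite ltr0n.
have n2 : n.*2%:R = 2 * n%:R :> R by rewrite -muln2 natrM mulrC.
have n20 : (0 < n.*2)%N by rewrite double_gt0.
rewrite /inscribed !(@interp_double _ _ n) // !interpB.
apply: interp_lipschitz => // k.
pose g (k : int) : 'rV[R]_d := c (k%:~R / n.*2%:R) - inscribed n (k%:~R / n.*2%:R).
rewrite -/(inscribed n) -/(g (k + 1)) -/(g k).
have even (i : int) : g (2 * i) = 0.
  have ei : (2 * i)%:~R / n.*2%:R = i%:~R / n%:R :> R.
    by rewrite n2 intrM; field; exact: lt0r_neq0.
  by rewrite /g ei /inscribed interp_node// subrr.
have odd (i : int) : enorm (g (2 * i + 1)) <= a / n.*2%:R.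
  pose x : R := i%:~R / n%:R; pose h : R := n.*2%:R^-1.
  have ei : (2 * i + 1)%:~R / n.*2%:R = x + h.
    by rewrite /x /h n2 intrD intrM; field; exact: lt0r_neq0.
  have e1 : (i + 1)%:~R / n%:R = x + h + h.
    by rewrite /x /h n2 intrD; field; exact: lt0r_neq0.
  have xh : (x + h) * n%:R = i%:~R + 2^-1 :> R.
    by rewrite /x /h n2; field; exact: lt0r_neq0.
  rewrite /g ei /inscribed (@interp_on _ _ n _ i); last first.
    by rewrite xh intrD; apply/andP; split; lra.
  rewrite xh (addrC i%:~R) addrK e1 -/x.
  have -> : c (x + h) - (c x + 2^-1 *: (c (x + h + h) - c x)) =
     2^-1 *: (c (x + h) - c x - (c (x + h + h) - c (x + h))).
    by apply/rowP => j; rewrite !mxE; field.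
  rewrite enormZ ger0_norm ?invr_ge0//.
  have h0 : 0 <= h by rewrite invr_ge0.
  have := midpoint_defect (x := x) e01 h0 erefl => /(_ _)/wrap[].
    apply: fl; rewrite (_ : _ - x = 2 * h); last by ring.
    by rewrite ger0_norm ?mulr_ge0// /h n2 invfM mulrA divff// mul1r.
  set X := enorm _ => hX; have X0 : 0 <= X by exact: enorm_ge0.
  have aX : X <= 2 * a * h.
    rewrite -(@ler_pXn2r _ 2) ?nnegrE ?mulr_ge0//; apply: le_trans hX _.
    by rewrite !exprMn ler_wpM2r ?sqr_ge0//; lra.
  by rewrite -/h; lra.
have [m [->|->]] : exists m : int, k = 2 * m \/ k = 2 * m + 1.
  by exists (k %/ 2)%Z; have := divz_eq k 2; have := @ltz_pmod k 2; have := @modz_ge0 k 2; lia.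
  by rewrite even subr0.
by rewrite (_ : _ + 1 + 1 = 2 * (m + 1)) ?even ?sub0r ?enormN//; lia.
Qed.

End Inscribed.

(** * Bi-Lipschitz bounds for inscribed polygons, uniform in the number of edges *)

Section InscribedBilipschitz.
Context {R : realType} {d : nat} (c : R -> 'rV[R]_d).
Hypotheses (ce : embedded c) (cl : lipschitz1 c).
Hypothesis fin : (dint (density c) < +oo)%E.

Let cc : closed_curve c := ce.1.

Lemma slope_drift n (a : R) (i : int) (m : nat) : (0 < n)%N -> 0 <= a ->
  (forall i : int, enorm ((c ((i + 2)%:~R / n%:R) - c ((i + 1)%:~R / n%:R)) -
    (c ((i + 1)%:~R / n%:R) - c (i%:~R / n%:R))) <= a / n%:R) ->
  enorm ((c ((i + m%:Z + 1)%:~R / n%:R) - c ((i + m%:Z)%:~R / n%:R)) -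
    (c ((i + 1)%:~R / n%:R) - c (i%:~R / n%:R))) <= m%:R * (a / n%:R).
Proof.
move=> n0 a0 h; elim: m => [|m IH]; first by rewrite addr0 subrr enorm0 mul0r.
apply: le_trans (ler_enorm_trans
  (c ((i + m%:Z + 1)%:~R / n%:R) - c ((i + m%:Z)%:~R / n%:R)) _ _) _.
rewrite -natr1 mulrDl mul1r addrC; apply: lerD => //.
have -> : i + m.+1%:Z + 1 = i + m%:Z + 2 by rewrite -addn1 PoszD; ring.
have -> : i + m.+1%:Z = i + m%:Z + 1 by rewrite -addn1 PoszD; ring.
exact: h.
Qed.

(** Two regimes. If l w > 8 / n, the error 2 / n at each end takes away at most half of the chord of
    [c]. Otherwise few edges are involved, their slopes differ by at most 1/4 from a vector of
    length at least 3/4, and the chord is at least w / 2. *)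
Lemma inscribed_bilipschitz (l : R) : 0 < l <= 1 ->
  (forall t s, l * circle_dist t s <= enorm (c t - c s)) ->
  exists N : nat, forall n, (N <= n)%N -> (0 < n)%N /\
    forall t s, l / 2 * circle_dist t s <= enorm (inscribed c n t - inscribed c n s).
Proof.
move=> /andP[l0 l1] hl.
(* At most [K] vertices are passed between parameters with l w <= 8 / n, so a change of slope by at
   most [a] at each of them adds up to at most 1/4. The value of [e] is what [slope_diff] requires
   for this [a]. *)
pose K := (Num.truncn (8 / l)).+2.
have K1 : 8 / l + 1 <= K%:R.
  have /andP[_ h] : (Num.truncn (8 / l))%:R <= 8 / l < (Num.truncn (8 / l)).+1%:R.
    by apply: truncn_itv; rewrite divr_ge0 ?ltW.
  by rewrite /K -[leRHS]natr1 lerD2r ltW.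
have K0 : 1 <= K%:R :> R by rewrite ler1n.
pose a : R := (4 * K%:R)^-1.
have a0 : 0 < a by rewrite invr_gt0; lra.
have a4 : a <= 4^-1 by rewrite lef_pV2 ?posrE; lra.
pose e := a ^+ 2 / 8.
have e0 : 0 < e by rewrite divr_gt0// exprn_gt0.
have e4 : e <= 4^-1 by rewrite /e; nra.
have [|r r0 fl] := flatness ce cl fin (e := e); first by rewrite e0; lra.
have r2 : 0 < r / 2 by rewrite divr_gt0.
have [N HN] := inv_small r2; exists N => n /HN[n0 nr]; split=> //.
have n0' : 0 < n%:R :> R by rewrite ltr0n.
have Pc : closed_curve (inscribed c n) by exact: inscribed_closed.
suff main t s : t < s -> s - t <= 2^-1 ->
    l / 2 * (s - t) <= enorm (inscribed c n s - inscribed c n t).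
  move=> t s; have [k e1] := circle_dist_lift t s.
  rewrite -(closed_curve_period Pc s k) e1; set s' := s + _ in e1 *.
  have h : `|t - s'| <= 2^-1 by rewrite -e1 circle_dist_le_half.
  have [ts|st|->] := ltgtP t s'.
  - by rewrite enorm_distC ltr0_norm ?subr_lt0// opprB main//; move: h; rewrite distrC gtr0_norm ?subr_gt0.
  - by rewrite gtr0_norm ?subr_gt0// main//; move: h; rewrite gtr0_norm ?subr_gt0.
  - by rewrite !subrr normr0 mulr0 enorm_ge0.
move=> ts half; set w := s - t in half *; have w0 : 0 < w by rewrite subr_gt0.
have cd : circle_dist s t = w by rewrite circle_distE gtr0_norm.
have [far|near] := leP (8 / n%:R) (l * w).
  have h1 := hl s t; rewrite cd in h1.
  have h2 := inscribed_close cl t n0; have h3 := inscribed_close cl s n0.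
  have h4 := ler_enorm_trans (inscribed c n s) (c s) (c t).
  have h5 := ler_enorm_trans (inscribed c n t) (inscribed c n s) (c t).
  rewrite (enorm_distC (c s) (inscribed _ _ _)) in h4; lra.
pose i := Num.floor (t * n%:R).
pose D (k : int) : 'rV[R]_d := c ((k + 1)%:~R / n%:R) - c (k%:~R / n%:R).
pose U := n%:R *: D i.
have U34 : 3 / 4 <= enorm U.
  have q : `|(i + 1)%:~R / n%:R - i%:~R / n%:R| = n%:R^-1 :> R.
    by rewrite -mulrBl intrD (addrC i%:~R) addrK mul1r ger0_norm ?invr_ge0.
  have := fl (i%:~R / n%:R) ((i + 1)%:~R / n%:R); rewrite q => /(_ _)/wrap[]; first by lra.
  move=> h; have {h} := ler_wpM2l (ltW n0') h.
  rewrite -/(D i) (_ : n%:R * ((1 - e) / n%:R) = 1 - e); last by field; exact: lt0r_neq0.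
  move=> h.
  by rewrite /U enormZ ger0_norm//; lra.
pose z (k : int) := c (k%:~R / n%:R) - (k%:~R / n%:R) *: U.
have zE u : interp n z u = inscribed c n u - u *: U.
  by rewrite /inscribed -(interp_linear U u n0) interpB.
have dr : enorm (interp n z s - interp n z t) <= 4^-1 * (s - t).
  apply: interp_lipschitz_local => //; first exact: ltW.
  move=> k /andP[ik kj].
  have -> : z (k + 1) - z k = D k - D i.
    have -> : z (k + 1) - z k = D k - ((k + 1)%:~R / n%:R - k%:~R / n%:R) *: U.
      by rewrite /z /D; apply/rowP => q; rewrite !mxE; ring.
    rewrite -mulrBl intrD (addrC k%:~R) addrK mul1r /U scalerA mulVf ?scale1r//.
    exact: lt0r_neq0.
  have [m km] : exists m : nat, k = i + m%:Z.
    by exists `|k - i|%N; rewrite gez0_abs ?subr_ge0// [RHS]addrC subrK.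
  have mK : m%:R <= K%:R :> R.
    have s1 : k%:~R <= s * n%:R :> R by apply: le_trans (floor_le _); rewrite ler_int.
    have /andP[_ t1] := floor_itv (t * n%:R); rewrite -/i in t1.
    have wn : w * n%:R <= 8 / l.
      rewrite ler_pdivlMr// mulrC mulrA -ler_pdivlMr//; exact: ltW.
    move: s1 t1; rewrite km !intrD /= => s1 t1.
    have sE : s = t + w by rewrite /w addrC subrK.
    rewrite sE mulrDl in s1; move: s1 t1 wn K1; rewrite -[(m%:Z)%:~R]/(m%:R); lra.
  rewrite km; apply: le_trans (slope_drift (a := a) i m n0 (ltW a0) _) _.
    move=> k'; apply: (slope_diff cl (e := e)) => //.
    - by rewrite ltW//=; lra.
    - exact: ltW.
    - by rewrite /e; lra.
    - by move=> t' s' h; apply: fl; apply: le_trans h _; lra.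
  rewrite mulrA ler_wpM2r ?invr_ge0//.
  have -> : 4^-1 = K%:R * a by rewrite /a; field; rewrite lt0r_neq0//; lra.
  by rewrite ler_wpM2r// ltW.
move: dr; rewrite !zE -/w => dr.
have := lerB_enorm (w *: U) (- (inscribed c n s - s *: U - (inscribed c n t - t *: U))).
rewrite opprK enormN enormZ (gtr0_norm w0).
have -> : w *: U + (inscribed c n s - s *: U - (inscribed c n t - t *: U)) =
   inscribed c n s - inscribed c n t.
  by rewrite /w; apply/rowP => q; rewrite !mxE; ring.
by move: dr U34 w0 l1 l0; nra.
Qed.

End InscribedBilipschitz.

(** * Ambient isotopies from small relative displacements *)

Section McShane.
Context {R : realType} {V : normedModType R} (c : R -> V).

(** The extension is the infimum of g t + a |x - c t| over t. It is at least -M by itself; clipping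
    at M from above changes neither the Lipschitz constant nor the values on the curve. *)
Lemma mcshane_scalar (g : R -> R) (a M : R) : 0 <= a ->
  (forall s t, `|g t - g s| <= a * `|c t - c s|) -> (forall t, `|g t| <= M) ->
  exists G : V -> R, [/\ forall x y, `|G x - G y| <= a * `|x - y|,
    forall x, `|G x| <= M & forall t, G (c t) = g t].
Proof.
move=> a0 gl gM.
pose S x := [set g t + a * `|x - c t| | t in [set: R]].
have S0 x : S x !=set0 by exists (g 0 + a * `|x - c 0|); exists 0.
have lbS x : lbound (S x) (- M).
  move=> _ [t _ <-]; have := gM t; rewrite ler_norml => /andP[h _].
  by apply: le_trans h _; rewrite lerDl mulr_ge0.
have hS x : has_lbound (S x) by exists (- M).
pose h x := inf (S x).
have hle x t : h x <= g t + a * `|x - c t| by apply: ge_inf => //; exists t.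
have hl x y : h x <= h y + a * `|x - y|.
  rewrite -lerBlDr; apply: lb_le_inf => // _ [t _ <-].
  rewrite lerBlDr -addrA -mulrDr; apply: le_trans (hle x t) _.
  by rewrite lerD2l ler_wpM2l// [leRHS]addrC (ler_distD y).
have hM x : - M <= h x by apply: lb_le_inf.
have hc t : h (c t) = g t.
  apply/le_anti; have := hle (c t) t; rewrite subrr normr0 mulr0 addr0 => ->/=.
  apply: lb_le_inf => // _ [s _ <-].
  by have := gl s t; rewrite ler_norml; lra.
exists (fun x => Num.min M (h x)); split.
- move=> x y; have h1 := hl x y; have h2 := hl y x; rewrite (distrC y) in h2.
  have h3 : 0 <= a * `|x - y| by rewrite mulr_ge0.
  by rewrite ler_norml /Num.min; case: ltP => ?; case: ltP => ?; apply/andP; split; lra.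
- move=> x; have := hM x; have := gM 0; rewrite ler_norml => /andP[? ?] ?.
  by rewrite ler_norml /Num.min; case: ltP => ?; apply/andP; split; lra.
- move=> t; rewrite hc; have := gM t; rewrite ler_norml => /andP[_ ?].
  by rewrite min_r.
Qed.

End McShane.

Section Extension.
Context {R : realType} {d : nat}.
Implicit Types (c g : R -> 'rV[R]_d).

(* Coordinatewise, McShane's extension preserves the Lipschitz constant for the sup norm. *)
Lemma mcshane c g (a M : R) : 0 <= a ->
  (forall s t, `|g t - g s| <= a * `|c t - c s|) -> (forall t, `|g t| <= M) ->
  exists G : 'rV[R]_d -> 'rV[R]_d, [/\ forall x y, `|G x - G y| <= a * `|x - y|,
    forall x, `|G x| <= M & forall t, G (c t) = g t].
Proof.
move=> a0 gl gM; have M0 : 0 <= M by apply: le_trans (gM 0).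
have /choice[G hG] : forall i : 'I_d, exists G : 'rV[R]_d -> R,
    [/\ forall x y, `|G x - G y| <= a * `|x - y|,
    forall x, `|G x| <= M & forall t, G (c t) = g t ord0 i].
  move=> i; apply: mcshane_scalar => // [s t|t].
    apply: le_trans (gl s t); apply: le_trans (coord_le_norm _ i).
    by rewrite !mxE.
  exact: le_trans (coord_le_norm _ _) (gM t).
exists (fun x => \row_i G i x); split.
- move=> x y; apply: norm_le_coord => [|i]; first by rewrite mulr_ge0.
  by rewrite !mxE; case: (hG i).
- by move=> x; apply: norm_le_coord => // i; rewrite mxE; case: (hG i).
- by move=> t; apply/rowP => i; rewrite mxE; case: (hG i).
Qed.

End Extension.

Section Perturbation.
Context {R : realType} {V : completeNormedModType R}.

Lemma lipschitz_cont (f : V -> V) (a : R) : (forall x y, `|f x - f y| <= a * `|x - y|) ->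
  continuous f.
Proof.
move=> fl x; apply/cvgrPdist_le => e e0.
have a1 : 0 < `|a| + 1 by apply: ltr_wpDl.
have ea : 0 < e / (`|a| + 1) by rewrite divr_gt0.
have := @cvgr_dist_le _ _ _ (nbhs x) (nbhs_filter x) id x (@cvg_id _ (nbhs x)) _ ea.
apply: filterS => y h; apply: le_trans (fl _ _) _.
apply: (@le_trans _ _ ((`|a| + 1) * `|x - y|)).
  by rewrite ler_wpM2r//; have := ler_norm a; lra.
by rewrite mulrC -ler_pdivlMr.
Qed.

(** A preimage of y is a fixed point of the contraction x -> y - G x. The reverse inequality, that x
    + G x contracts distances by a factor at least 1 - a, gives injectivity and the Lipschitz
    constant of the inverse. *)
Lemma perturbed_identity (G : V -> V) (a M : R) : 0 <= a < 1 ->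
  (forall x y, `|G x - G y| <= a * `|x - y|) -> (forall x, `|G x| <= M) ->
  exists g : V -> V, [/\ cancel (fun x => x + G x) g, cancel g (fun x => x + G x),
    forall x y, `|g x - g y| <= (1 - a)^-1 * `|x - y| & forall x, `|g x - x| <= M].
Proof.
move=> /andP[a0 a1] Gl GM.
have low x y : (1 - a) * `|x - y| <= `|(x + G x) - (y + G y)|.
  have := Gl x y; have := lerB_normD (x - y) (G x - G y).
  rewrite opprD addrACA => h1 h2; lra.
have surj y : exists x, x + G x = y.
  have sub : set_fun setT setT (fun x => y - G x) by [].
  pose f := mkfun_fun sub.
  have fc : is_contraction f.
    exists (NngNum a0); split => //= -[u v] _ /=.
    by rewrite opprB addrC addrA subrK distrC Gl.
  have [|x _ hx] := banach_fixed_point fc (@closedT V); first by exists 0.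
  by exists x; rewrite {1}hx /= subrK.
have /choice[g hg] := surj.
have inj x : g (x + G x) = x.
  apply/eqP; rewrite -subr_eq0 -normr_eq0 eq_le normr_ge0 andbT.
  have := low (g (x + G x)) x; rewrite hg subrr normr0.
  by rewrite pmulr_rle0// subr_gt0.
exists g; split => //.
- move=> x y; rewrite mulrC ler_pdivlMr ?subr_gt0// mulrC.
  by have := low (g x) (g y); rewrite !hg.
- by move=> x; rewrite -{2}(hg x) opprD addrA subrr sub0r normrN.
Qed.

Lemma geometric_cvg (u : nat -> V) (A q : R) : 0 <= q < 1 ->
  (forall k, `|u k.+1 - u k| <= A * q ^+ k) ->
  forall k, `|u k - limn u| <= A / (1 - q) * q ^+ k /\ u @ \oo --> limn u.
Proof.
move=> /andP[q0 q1] hu.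
have A0 : 0 <= A by have := le_trans (normr_ge0 _) (hu 0%N); rewrite expr0 mulr1.
have q1' : 0 < 1 - q by rewrite subr_gt0.
have tail k m : `|u k - u (k + m)%N| <= A / (1 - q) * (q ^+ k - q ^+ (k + m)).
  elim: m => [|m IH]; first by rewrite addn0 !subrr normr0 mulr0.
  rewrite addnS; apply: le_trans (ler_distD (u (k + m)%N) _ _) _.
  have h := hu (k + m)%N; rewrite distrC in h; apply: (le_trans (lerD IH h)).
  rewrite le_eqVlt; apply/orP; left; apply/eqP; rewrite exprS; field.
  exact: lt0r_neq0.
have tail' k m : `|u k - u (k + m)%N| <= A / (1 - q) * q ^+ k.
  apply: le_trans (tail k m) _; rewrite ler_wpM2l ?divr_ge0 ?(ltW q1')//.
  by rewrite gerBl exprn_ge0.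
have cu : cvgn u.
  apply/cauchy_cvgP/cauchy_exP => e e0.
  have := cvg_geometric (A / (1 - q)) (_ : `|q| < 1); rewrite ger0_norm// => /(_ q1).
  move/cvgr0Pnorm_lt => /(_ e e0)[N _ /(_ N (leqnn N)) hN].
  exists (u N); exists N => // k /= Nk; rewrite -ball_normE/=.
  rewrite -(subnKC Nk); apply: le_lt_trans (tail' _ _) _.
  by apply: le_lt_trans hN; rewrite ler_norm.
move=> k; split => //.
have h : (fun m => `|u k - u (k + m)%N|) @ \oo --> `|u k - limn u|.
  apply: cvg_norm; apply: cvgB; first exact: cvg_cst.
  have := cu; rewrite -(cvg_shiftn k) => h; under eq_fun do rewrite addnC; exact: h.
apply: (cvgr_to_le h); near=> m; exact: tail'.
Unshelve. all: by end_near. Qed.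

End Perturbation.

Section LimitHomeomorphism.
Context {R : realType} {V : completeNormedModType R}.

Lemma uniform_limit_cont (T : topologicalType) (f : nat -> T -> V) (F : T -> V) (b : nat -> R) :
  (forall k, continuous (f k)) -> b @ \oo --> 0 ->
  (forall k x, `|f k x - F x| <= b k) -> continuous F.
Proof.
move=> fc b0 fF x; apply/cvgrPdist_le => e e0; have e3 : 0 < e / 3 by rewrite divr_gt0.
have [N _ /(_ N (leqnn N)) hN] : \forall k \near \oo, `|b k| < e / 3.
  by move/cvgr0Pnorm_lt : b0; apply.
have bN : b N <= e / 3 by apply: le_trans (ltW hN); exact: ler_norm.
have := @cvgr_dist_le _ _ _ (nbhs x) (nbhs_filter x) (f N) (f N x) (fc N x) _ e3.
apply: filterS => y h.
rewrite (_ : F x - F y = (F x - f N x) + (f N x - f N y) + (f N y - F y)); last first.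
  by rewrite !addrA !subrK.
apply: le_trans (ler_normD _ _) _; have := fF N y; have := fF N x; rewrite distrC => h1 h2.
have := ler_normD (F x - f N x) (f N x - f N y); lra.
Qed.

Lemma geometric_cvg0 (A q : R) : 0 <= q < 1 -> (fun k => A * q ^+ k) @ \oo --> 0.
Proof. by move=> /andP[q0 q1]; apply: cvg_geometric; rewrite ger0_norm. Qed.

(** G (f_k x) tends to G (F x) by continuity, and to x because it is within b_k of g_k (f_k x) = x:
    uniform convergence is used for one of the two sequences only. *)
Lemma limit_cancel (f g : nat -> V -> V) (F G : V -> V) (b : nat -> R) :
  (forall k, cancel (f k) (g k)) -> continuous G -> b @ \oo --> 0 ->
  (forall k x, `|g k x - G x| <= b k) ->
  (forall x, f ^~ x @ \oo --> F x) -> cancel F G.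
Proof.
move=> fg Gc b0 gG fF x.
have h1 : (fun k => G (f k x)) @ \oo --> G (F x).
  by apply: (cvg_comp (f ^~ x) G); [exact: fF | exact: Gc].
have h2 : (fun k => G (f k x)) @ \oo --> x.
  apply/cvgrPdist_le => e e0; move/cvgr0Pnorm_lt : b0 => /(_ e e0).
  apply: filterS => k hk; rewrite -{1}(fg k x); apply: le_trans (gG _ _) _.
  by apply: le_trans (ltW hk); exact: ler_norm.
exact: (cvg_unique _ h1 h2).
Qed.

Lemma limit_homeomorphism (f g : nat -> V -> V) (A q p : R) :
  0 <= q < 1 -> 0 <= p < 1 ->
  (forall k, continuous (f k)) -> (forall k, continuous (g k)) ->
  (forall k, cancel (f k) (g k)) -> (forall k, cancel (g k) (f k)) ->
  (forall k x, `|f k.+1 x - f k x| <= A * q ^+ k) ->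
  (forall k x, `|g k.+1 x - g k x| <= A * p ^+ k) ->
  homeomorphism (fun x => limn (fun k => f k x)).
Proof.
move=> q01 p01 fc gc fg gf fA gA.
have fl x k := geometric_cvg q01 (fA ^~ x) k.
have gl x k := geometric_cvg p01 (gA ^~ x) k.
have cF : continuous (fun x => limn (fun k => f k x)).
  apply: (uniform_limit_cont (f := f) (b := fun k => A / (1 - q) * q ^+ k)) => //.
    exact: geometric_cvg0.
  by move=> k x; have [] := fl x k.
have cG : continuous (fun x => limn (fun k => g k x)).
  apply: (uniform_limit_cont (f := g) (b := fun k => A / (1 - p) * p ^+ k)) => //.
    exact: geometric_cvg0.
  by move=> k x; have [] := gl x k.
split=> //; exists (fun x => limn (fun k => g k x)); split=> //.
  apply: (limit_cancel (f := f) (g := g) (b := fun k => A / (1 - p) * p ^+ k)) => //.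
  - exact: geometric_cvg0.
  - by move=> k x; have [] := gl x k.
  - by move=> x; have [] := fl x 0%N.
apply: (limit_cancel (f := g) (g := f) (b := fun k => A / (1 - q) * q ^+ k)) => //.
- exact: geometric_cvg0.
- by move=> k x; have [] := fl x k.
- by move=> x; have [] := gl x 0%N.
Qed.

End LimitHomeomorphism.

(** Lets row vectors be used as a [completeNormedModType] in the fixed point and limit lemmas
    above. *)
HB.instance Definition _ (R : realType) (n : nat) := Complete.on 'rV[R]_n.

Section AmbientIsotopy.
Context {R : realType}.
Local Notation V := 'rV[R]_3.

(** Extends the isotopy to all real times, so that joint continuity can be proved on the whole
    product space. *)
Let clamp (t : R) : R := Num.max 0 (Num.min 1 t).

Let clamp01 t : 0 <= clamp t <= 1.
Proof. by rewrite /clamp le_max lexx/= ge_max ler01 ge_min lexx. Qed.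

Let clamp_cont : continuous clamp.
Proof.
move=> t; apply/cvgrPdist_le => e e0.
have := @cvgr_dist_le _ _ _ (nbhs t) (nbhs_filter t) id t (@cvg_id _ (nbhs t)) _ e0.
apply: filterS => s h; apply: le_trans h.
rewrite /clamp /Num.max /Num.min ler_norml.
have := ler_norm (t - s); have := lerNnormlW (lexx `|t - s|).
case: (ltP 1 t) => ?; case: (ltP 1 s) => ?; case: ltP => ?; case: ltP => ? ? ?; apply/andP; split; lra.
Qed.

(** The isotopy at time t is the infinite composition of the maps id + t G_k, where G_k extends
    c_(k+1) - c_k from the curve c_k. The bounds A q^k make the compositions converge uniformly; q <
    1 - a does the same for their inverses. *)
Lemma isotopy_of_small_steps (c : nat -> R -> V) (cinf : R -> V) (a A q : R) :
  0 <= a < 1 -> 0 <= q < 1 - a ->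
  (forall k s t, `|(c k.+1 t - c k t) - (c k.+1 s - c k s)| <= a * `|c k t - c k s|) ->
  (forall k t, `|c k.+1 t - c k t| <= A * q ^+ k) ->
  (forall t, c ^~ t @ \oo --> cinf t) ->
  ambient_isotopic (range (c 0%N)) (range cinf).
Proof.
move=> a01 /andP[q0 qa] cl cA ccvg; have /andP[a0 a1] := a01.
have /choice[G hG] : forall k, exists G : V -> V, [/\ forall x y, `|G x - G y| <= a * `|x - y|,
    forall x, `|G x| <= A * q ^+ k & forall t, G (c k t) = c k.+1 t - c k t].
  by move=> k; apply: mcshane.
(* At time 1 this sends c_0 to c_k pointwise along the parameter, hence in the limit to [cinf]. *)
pose Phi t := fix Phi k x : V := if k is k'.+1 then Phi k' x + clamp t *: G k' (Phi k' x) else x.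
have PhiS t k x : Phi t k.+1 x = Phi t k x + clamp t *: G k (Phi t k x) by [].
have PhiA t k x : `|Phi t k.+1 x - Phi t k x| <= A * q ^+ k.
  rewrite PhiS addrC addKr normrZ; have [_ h _] := hG k.
  have /andP[h0 h1] := clamp01 t; rewrite ger0_norm//.
  by apply: le_trans (h (Phi t k x)); rewrite ler_piMl.
have q01 : 0 <= q < 1 by apply/andP; split => //; lra.
pose H t x := limn (fun k => Phi t k x).
have PhiC k : continuous (fun z : R * V => Phi z.1 k z.2).
  elim: k => [|k IH] z; first exact: cvg_snd.
  apply: cvgD; first exact: IH.
  apply: cvgZ.
    by apply: (@continuous_comp _ _ _ fst clamp); [exact: cvg_fst | exact: clamp_cont].
  apply: (@continuous_comp _ _ _ (fun z : R * V => Phi z.1 k z.2) (G k)); first exact: IH.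
  by have [h _ _] := hG k; exact: (lipschitz_cont h).
have HC : continuous (fun z : R * V => H z.1 z.2).
  apply: (uniform_limit_cont (f := fun k (z : R * V) => Phi z.1 k z.2)
    (b := fun k => A / (1 - q) * q ^+ k)) => //.
    exact: geometric_cvg0.
  by move=> k z; have [] := geometric_cvg q01 (fun k => PhiA z.1 k z.2) k.
exists H; split.
- exact: continuous_subspaceT.
- move=> t _.
  have /choice[g hg] : forall k, exists g : V -> V,
     [/\ cancel (fun x => x + clamp t *: G k x) g, cancel g (fun x => x + clamp t *: G k x),
       forall x y, `|g x - g y| <= (1 - a)^-1 * `|x - y| & forall x, `|g x - x| <= A * q ^+ k].
    move=> k; have [h1 h2 _] := hG k; have /andP[t0 t1] := clamp01 t.
    apply: (perturbed_identity a01) => [x y|x].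
      rewrite -scalerBr normrZ ger0_norm//; apply: le_trans (h1 _ _).
      by rewrite ler_piMl.
    by rewrite normrZ ger0_norm//; apply: le_trans (h2 x); rewrite ler_piMl.
  (* The inverse composes in the opposite order, so its k-th increment is a displacement of size A
     q^k seen through a map of Lipschitz constant (1 - a)^-k. *)
  pose Psi := fix Psi k x : V := if k is k'.+1 then Psi k' (g k' x) else x.
  have PsiL k x y : `|Psi k x - Psi k y| <= (1 - a)^-1 ^+ k * `|x - y|.
    elim: k x y => [|k IH] x y; first by rewrite expr0 mul1r.
    apply: le_trans (IH _ _) _; rewrite exprSr -mulrA ler_wpM2l//; last by case: (hg k).
    by rewrite exprn_ge0// invr_ge0 subr_ge0 ltW.
  have a1' : 0 < 1 - a by rewrite subr_gt0.
  apply: (limit_homeomorphism (f := Phi t) (g := Psi) (A := A) (q := q) (p := (1 - a)^-1 * q)) => //.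
  + by rewrite mulr_ge0 ?invr_ge0 ?(ltW a1')//= mulrC ltr_pdivrMr// mul1r.
  + move=> k x; apply: (@continuous_comp _ _ _ (pair t) (fun z : R * V => Phi z.1 k z.2)).
      have h1 : (fun _ : V => t) @ nbhs x --> nbhs t by exact: cvg_cst.
      exact: (cvg_pair h1 (@cvg_id _ (nbhs x))).
    exact: PhiC.
  + by move=> k; exact: (lipschitz_cont (PsiL k)).
  + move=> k; elim: k => [|k IH] x //=; rewrite (_ : g k _ = Phi t k x) ?IH//.
    by have [h _ _ _] := hg k; exact: h.
  + move=> k; elim: k => [|k IH] x //=; rewrite IH.
    by have [_ h _ _] := hg k; exact: h.
  + move=> k x /=; apply: le_trans (PsiL k _ _) _; rewrite exprMn mulrCA ler_wpM2l//.
      by rewrite exprn_ge0// invr_ge0 ltW.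
    by case: (hg k).
- move=> x; rewrite /H (_ : (fun k => _) = cst x) ?lim_cst//.
  apply/funext; elim=> // k IH; rewrite PhiS IH.
  have -> : clamp 0 = 0 by rewrite /clamp min_r ?ler01// maxxx.
  by rewrite scale0r addr0.
- have c1 : clamp 1 = 1 by rewrite /clamp minxx max_r ?ler01.
  have Hc t : H 1 (c 0%N t) = cinf t.
    rewrite /H (_ : (fun k => _) = c ^~ t); first exact/cvg_lim.
    apply/funext; elim=> // k IH; rewrite PhiS IH c1 scale1r.
    by have [_ _ ->] := hG k; rewrite addrC subrK.
  apply/seteqP; split=> [_ [_ [t _ <-] <-]|_ [t _ <-]].
    by rewrite Hc; exists t.
  by exists (c 0%N t); [exists t | rewrite Hc].
Qed.

(** The isotopy K_(1-t) o K_1^-1 o H_t starts at the identity and carries A to B. Only the inverse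
    at the fixed time 1 enters, so joint continuity of inverses in time is not an issue. *)
Lemma ambient_isotopic_join (A B C : set V) :
  ambient_isotopic A C -> ambient_isotopic B C -> ambient_isotopic A B.
Proof.
move=> [H [Hc Hh H0 HA]] [K [Kc Kh K0 KB]].
have i1 : 0 <= (1 : R) <= 1 by rewrite lexx ler01.
have [_ [g [gc Kg gK]]] := Kh 1 i1.
exists (fun t x => K (1 - t) (g (H t x))); split.
- apply/subspace_continuousP => z Az.
  pose S : set (R * V) := `[0%R, 1%R]%classic `*` setT.
  pose h (z : R * V) := (1 - z.1, g (H z.1 z.2)).
  have hS y : S y -> S (h y).
    by rewrite /S /h /= => -[]; rewrite !in_itv/= => /andP[? ?] _; split=> //; apply/andP; split; lra.
  move/subspace_continuousP : Kc => /(_ (h z) (hS z Az)) Kc.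
  apply: (cvg_comp h (fun z : R * V => K z.1 z.2) _ Kc).
  have hc : h y @[y --> within S (nbhs z)] --> h z.
    have h1 : (1 - y.1) @[y --> within S (nbhs z)] --> nbhs (1 - z.1).
      apply: cvgB; first exact: cvg_cst.
      apply: (cvg_trans _ (@cvg_fst _ _ (nbhs z.1) (nbhs z.2) _)).
      by apply: cvg_app; exact: cvg_within.
    have h2 : g (H y.1 y.2) @[y --> within S (nbhs z)] --> nbhs (g (H z.1 z.2)).
      apply: (cvg_comp (fun z : R * V => H z.1 z.2) g); last exact: gc.
      by move/subspace_continuousP : Hc; apply.
    exact: (cvg_pair h1 h2).
  move=> P /=; rewrite /nbhs/= => hP.
  have := hc _ hP; rewrite /within/= /nbhs/=.
  apply: filterS => y /= hy Sy; apply: hy => //; exact: hS.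
- move=> t /andP[t0 t1]; have [|Hct [h [hc Hth htH]]] := Hh t; first by rewrite t0.
  have [|Kct [k [kc Ktk ktK]]] := Kh (1 - t); first by apply/andP; split; lra.
  have comp (u v : V -> V) : continuous u -> continuous v -> continuous (u \o v).
    by move=> uc vc x; apply: continuous_comp; [exact: vc | exact: uc].
  split; first exact: (comp (K (1 - t)) (g \o H t) Kct (comp _ _ gc Hct)).
  exists (h \o K 1 \o k); split.
  + exact: (comp _ _ (comp h (K 1) hc (Kh 1 i1).1) kc).
  + by move=> x /=; rewrite Ktk gK Hth.
  + by move=> x /=; rewrite htH Kg ktK.
- by move=> x; rewrite subr0 H0 gK.
- rewrite subrr; apply/seteqP; split=> [_ [x Ax <-]|x Bx].
    rewrite K0; have : C (H 1 x) by rewrite -HA; exists x.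
    by rewrite -KB => -[y By <-]; rewrite Kg.
  have : C (K 1 x) by rewrite -KB; exists x.
  by rewrite -HA => -[y Ay e]; exists y => //; rewrite K0 e Kg.
Qed.

End AmbientIsotopy.

(** * Equilateral polygons close to a curve *)

Section FiniteFamilies.
Context {R : realType} {d : nat}.
Local Notation V := 'rV[R]_d.

(** Turns the defect of a sum of unit vectors into pairwise differences, which are insensitive to
    adding a common vector. *)
Lemma sum_sqr_diff m (v : 'I_m -> V) :
  \sum_i \sum_j enorm (v i - v j) ^+ 2 =
  2 * (m%:R * (\sum_i enorm (v i) ^+ 2) - enorm (\sum_i v i) ^+ 2).
Proof.
have -> : enorm (\sum_i v i) ^+ 2 = \sum_i \sum_j inner (v i) (v j).
  rewrite enorm_sqr inner_suml; apply: eq_bigr => i _; exact: inner_sumr.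
have e i : \sum_j enorm (v i - v j) ^+ 2 = m%:R * enorm (v i) ^+ 2 -
    2 * (\sum_j inner (v i) (v j)) + \sum_j enorm (v j) ^+ 2.
  rewrite (eq_bigr (fun j => (enorm (v i) ^+ 2 - 2 * inner (v i) (v j)) + enorm (v j) ^+ 2));
    last by move=> j _; rewrite enorm_sqrB.
  rewrite big_split/= sumrB sumr_const card_ord -mulr_sumr; congr (_ - _ + _).
  by rewrite -[LHS]mulr_natl.
rewrite (eq_bigr _ (fun i _ => e i)) big_split/= sumrB -!mulr_sumr sumr_const card_ord.
by rewrite -[X in _ + X]mulr_natl; ring.
Qed.

Lemma enorm_sum_sqr_le m (v : 'I_m -> V) :
  enorm (\sum_i v i) ^+ 2 <= m%:R * \sum_i enorm (v i) ^+ 2.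
Proof.
have := sum_sqr_diff v; have : 0 <= \sum_i \sum_j enorm (v i - v j) ^+ 2.
  by apply: sumr_ge0 => i _; apply: sumr_ge0 => j _; rewrite sqr_ge0.
by move=> h e; move: h; rewrite e; lra.
Qed.

Definition normalize (x : V) : V := (enorm x)^-1 *: x.

Lemma enorm_normalize x : 0 < enorm x -> enorm (normalize x) = 1.
Proof.
move=> x0; rewrite enormZ ger0_norm ?invr_ge0 ?(ltW x0)// mulVf//; exact: lt0r_neq0.
Qed.

(** With a and b the lengths, the left side equals (|x - y|^2 - (a - b)^2) / (a b), and a b is at
    least 1/4. *)
Lemma normalize_dist (x y : V) : 2^-1 <= enorm x -> 2^-1 <= enorm y ->
  enorm (normalize x - normalize y) ^+ 2 <= 4 * enorm (x - y) ^+ 2.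
Proof.
move=> x2 y2; have x0 : 0 < enorm x by lra. have y0 : 0 < enorm y by lra.
rewrite enorm_sqrB !enorm_normalize// innerZl innerZr enorm_sqrB.
set a := enorm x in x2 x0 *; set b := enorm y in y2 y0 *; set p := inner x y.
have -> : 1 ^+ 2 - 2 * (a^-1 * (b^-1 * p)) + 1 ^+ 2 =
  (a ^+ 2 - 2 * p + b ^+ 2 - (a - b) ^+ 2) / (a * b).
  by field; rewrite !lt0r_neq0.
rewrite ler_pdivrMr ?mulr_gt0//.
have h : 0 <= a ^+ 2 - 2 * p + b ^+ 2 by rewrite /a /b /p -enorm_sqrB sqr_ge0.
have ab : 1 <= 4 * (a * b) by nra.
have := sqr_ge0 (a - b); nra.
Qed.

(** [sum_sqr_diff] on both sides: it is exact for the unit vectors on the left, and on the right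
    lengths at most 1 give the needed inequality. The factor 4 is that of [normalize_dist]. *)
Lemma normalize_defect m (u : 'I_m -> V) (x : V) :
  (forall i, enorm (u i) <= 1) -> (forall i, 2^-1 <= enorm (u i + x)) ->
  m%:R ^+ 2 - enorm (\sum_i normalize (u i + x)) ^+ 2 <=
  4 * (m%:R ^+ 2 - enorm (\sum_i u i) ^+ 2).
Proof.
move=> u1 ux.
have h1 := sum_sqr_diff (fun i => normalize (u i + x)); have h2 := sum_sqr_diff u.
have h3 : \sum_i enorm (normalize (u i + x)) ^+ 2 = m%:R.
  rewrite (eq_bigr (fun=> 1)) ?sumr_const ?card_ord// => i _.
  by rewrite enorm_normalize ?expr1n//; have := ux i; lra.
have h4 : \sum_i enorm (u i) ^+ 2 <= m%:R.
  rewrite -[m in leRHS]card_ord -sumr_const; apply: ler_sum => i _.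
  by rewrite expr_le1// enorm_ge0.
have h5 : \sum_i \sum_j enorm (normalize (u i + x) - normalize (u j + x)) ^+ 2 <=
    4 * \sum_i \sum_j enorm (u i - u j) ^+ 2.
  rewrite mulr_sumr; apply: ler_sum => i _; rewrite mulr_sumr; apply: ler_sum => j _.
  apply: le_trans (normalize_dist (ux i) (ux j)) _.
  by rewrite (_ : u i + x - (u j + x) = u i - u j)// opprD addrACA subrr addr0.
have m0 : 0 <= m%:R :> R by [].
move: h5; rewrite h1 h2 h3 => h5.
have h6 : m%:R * \sum_i enorm (u i) ^+ 2 <= m%:R * m%:R by rewrite ler_wpM2l.
rewrite !expr2; move: h5 h6; rewrite !expr2; lra.
Qed.

(* Scaled by enorm y ^+ 2 to avoid a division. *)
Definition reject (y v : V) : V := enorm y ^+ 2 *: v - inner y v *: y.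

Lemma reject_sqr y v :
  enorm (reject y v) ^+ 2 = enorm y ^+ 2 * (enorm y ^+ 2 * enorm v ^+ 2 - inner y v ^+ 2).
Proof.
rewrite enorm_sqrB !enormZ innerZl innerZr (innerC v y) !exprMn !real_normK ?num_real//.
by rewrite -?exprM; ring.
Qed.

Lemma reject_sum m (y : V) (v : 'I_m -> V) :
  reject y (\sum_i v i) = \sum_i reject y (v i).
Proof. by rewrite /reject inner_sumr scaler_sumr scaler_suml sumrB. Qed.

Lemma rejectD y v w : reject y (v + w) = reject y v + reject y w.
Proof. by rewrite /reject innerDr scalerDr scalerDl opprD addrACA. Qed.

Lemma reject_le y v : enorm (reject y v) <= enorm y ^+ 2 * enorm v.
Proof.
rewrite -(@ler_pXn2r _ 2) ?nnegrE ?enorm_ge0 ?mulr_ge0 ?sqr_ge0 ?enorm_ge0// reject_sqr.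
rewrite exprMn; have := sqr_ge0 (inner y v); have := sqr_ge0 (enorm y); nra.
Qed.

(** Two vectors spanning a parallelogram of definite area cannot both be nearly parallel to [y]. The
    fourth power comes from the scaling in [reject]. *)
Lemma gram_reject (P Q y : V) :
  enorm y ^+ 4 * (enorm P ^+ 2 * enorm Q ^+ 2 - inner P Q ^+ 2) <=
  (enorm (reject y P) ^+ 2 + enorm (reject y Q) ^+ 2) * (enorm P ^+ 2 + enorm Q ^+ 2).
Proof.
have [y0|y0] := eqVneq (enorm y) 0.
  by rewrite y0 expr0n/= mul0r mulr_ge0// addr_ge0// sqr_ge0.
have yp : 0 < enorm y ^+ 2 by rewrite exprn_gt0// lt0r y0 enorm_ge0.
set N := enorm y ^+ 2 in yp.
have cs : inner (reject y P) (reject y Q) ^+ 2 <= enorm (reject y P) ^+ 2 * enorm (reject y Q) ^+ 2.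
  rewrite -exprMn -real_normK ?num_real// ler_pXn2r ?nnegrE ?mulr_ge0 ?enorm_ge0//.
  rewrite ler_norml cauchy_schwarz andbT lerNl -innerNl.
  by apply: le_trans (cauchy_schwarz _ _) _; rewrite enormN.
have ipq : inner (reject y P) (reject y Q) = N * (N * inner P Q - inner y P * inner y Q).
  rewrite /reject -/N !(innerDl, innerDr, innerNl, innerNr, innerZl, innerZr).
  by rewrite (innerC P y) -[inner y y]enorm_sqr -/N; ring.
move: cs; rewrite ipq !reject_sqr -/N.
rewrite (_ : enorm y ^+ 4 = N ^+ 2); last by rewrite /N -exprM.
set a := inner y P; set b := inner y Q; set p := enorm P ^+ 2; set q := enorm Q ^+ 2.
set s := inner P Q => cs.
have qP : 0 <= N * p - a ^+ 2.
  by rewrite -(pmulr_rge0 _ yp) /p /a /N -reject_sqr sqr_ge0.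
have qQ : 0 <= N * q - b ^+ 2.
  by rewrite -(pmulr_rge0 _ yp) /q /b /N -reject_sqr sqr_ge0.
set x := N * p - a ^+ 2 in qP cs *; set z := N * q - b ^+ 2 in qQ cs *.
set w := N * s - a * b in cs.
have cs' : w ^+ 2 <= x * z.
  have N2 : 0 < N ^+ 2 by rewrite exprn_gt0.
  by rewrite -(ler_pM2l N2) -exprMn; apply: le_trans cs _; rewrite le_eqVlt; apply/orP; left; apply/eqP; ring.
have -> : N ^+ 2 * (p * q - s ^+ 2) = (x + a ^+ 2) * (z + b ^+ 2) - (w + a * b) ^+ 2.
  by rewrite /x /z /w; ring.
have -> : (N * x + N * z) * (p + q) = (x + z) * (x + a ^+ 2 + (z + b ^+ 2)).
  by rewrite /x /z; ring.
have key : - (2 * (w * (a * b))) <= x * a ^+ 2 + z * b ^+ 2.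
  have h : (w * (a * b)) ^+ 2 <= (x * a ^+ 2) * (z * b ^+ 2).
    rewrite exprMn (_ : x * a ^+ 2 * (z * b ^+ 2) = x * z * (a * b) ^+ 2); last by ring.
    by rewrite ler_wpM2r// sqr_ge0.
  set X := x * a ^+ 2 in h *; set Z := z * b ^+ 2 in h *; set W := w * (a * b) in h *.
  have X0 : 0 <= X by rewrite mulr_ge0// sqr_ge0.
  have Z0 : 0 <= Z by rewrite mulr_ge0// sqr_ge0.
  rewrite -[leRHS](ger0_norm (addr_ge0 X0 Z0)); apply: le_trans (ler_norm _) _.
  rewrite -(@ler_pXn2r _ 2) ?nnegrE// !real_normK ?num_real//.
  by have := sqr_ge0 (X - Z); nra.
have w2 := sqr_ge0 w.
have xz : 0 <= x * z by rewrite mulr_ge0.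
have := sqr_ge0 x; have := sqr_ge0 z; have : 0 <= x * a ^+ 2 by rewrite mulr_ge0// sqr_ge0.
have : 0 <= z * b ^+ 2 by rewrite mulr_ge0// sqr_ge0.
move=> h1 h2 h3 h4; nra.
Qed.

(** Second-order expansion of the norm. The linear term will cancel in a sum, the transversal
    quadratic term (with 1/4 in place of the Taylor coefficient 1/2) gives strict growth, and 3 e
    absorbs the error in the length of [u]. *)
Lemma enormD_ge (u y : V) (e : R) : 0 <= e <= 8^-1 -> 1 - e <= enorm u <= 1 ->
  enorm y <= 2^-1 ->
  1 - 3 * e + inner u y + (enorm y ^+ 2 * enorm u ^+ 2 - inner y u ^+ 2) / 4 <= enorm (u + y).
Proof.
move=> /andP[e0 e8] /andP[ue u1] y2.
set g := leLHS; have [g0|/ltW g0] := leP g 0; first exact: le_trans (enorm_ge0 _).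
apply: enorm_ge => //; rewrite -enorm_sqr enorm_sqrD.
move: g0; rewrite /g (innerC y u).
have p1 : inner u y <= enorm u * enorm y := cauchy_schwarz u y.
have p2 : - inner u y <= enorm u * enorm y.
  by rewrite -innerNl; apply: le_trans (cauchy_schwarz _ _) _; rewrite enormN.
have y0 := enorm_ge0 y.
set p := inner u y in p1 p2 *; set a := enorm u in ue u1 p1 p2 *; set r := enorm y in y0 y2 p1 p2 *.
move=> _; have a0 : 0 <= a by lra.
have pr : p ^+ 2 <= (a * r) ^+ 2 by nra.
have q0 : 0 <= r ^+ 2 * a ^+ 2 - p ^+ 2 by move: pr; rewrite exprMn mulrC; lra.
have ar : a * r <= r by nra.
have r4 : r ^+ 2 <= 4^-1 by nra.
have a2 : a ^+ 2 <= 1 by nra.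
have q1 : r ^+ 2 * a ^+ 2 - p ^+ 2 <= 4^-1 by have := sqr_ge0 p; have := sqr_ge0 r; nra.
have q2 : r ^+ 2 * a ^+ 2 - p ^+ 2 <= r ^+ 2 - p ^+ 2 by have := sqr_ge0 r; nra.
set q := r ^+ 2 * a ^+ 2 - p ^+ 2 in q0 q1 q2 *.
have A1 : (1 - 3 * e) ^+ 2 + 3 * e <= a ^+ 2 by nra.
have p3 : - 2^-1 <= p by lra.
have p4 : p <= 2^-1 by lra.
have A2 : - (3 * e) <= 2 * p * (3 * e).
  have : 0 <= e * (p + 2^-1) by apply: mulr_ge0; lra.
  lra.
have A3 : q / 4 * (q / 4 + 2 * (1 - 3 * e) + 2 * p) <= q.
  have : 0 <= q * (4 - (q / 4 + 2 * (1 - 3 * e) + 2 * p)) by apply: mulr_ge0; lra.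
  lra.
have -> : (1 - 3 * e + p + q / 4) ^+ 2 = (1 - 3 * e) ^+ 2 + 2 * p + p ^+ 2
  - 2 * p * (3 * e) + q / 4 * (q / 4 + 2 * (1 - 3 * e) + 2 * p) by ring.
lra.
Qed.

(** First-order expansion with gradient [normalize a]; the remainder |z|^2 / (2 |a|) is at most
    |z|^2. *)
Lemma enormD_le (a z : V) : 2^-1 <= enorm a ->
  enorm (a + z) <= enorm a + inner (normalize a) z + enorm z ^+ 2.
Proof.
move=> a2; have a0 : 0 < enorm a by lra.
rewrite innerZl; set p := inner a z; set A := enorm a in a2 a0 *; set r := enorm z.
have p2 : - p <= A * r.
  by rewrite -innerNl; apply: le_trans (cauchy_schwarz _ _) _; rewrite enormN.
have r0 : 0 <= r by exact: enorm_ge0.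
have pA : - r <= A^-1 * p.
  by rewrite mulrC ler_pdivlMr//; lra.
apply: enorm_le; first by nra.
rewrite -enorm_sqr enorm_sqrD -/p -/A -/r.
set P := A^-1 * p in pA *.
have -> : p = A * P by rewrite /P mulrA divff ?mul1r// lt0r_neq0.
have h : 0 <= (A - 2^-1) * r ^+ 2 by rewrite mulr_ge0 ?sqr_ge0// subr_ge0.
have := sqr_ge0 (P + r ^+ 2); lra.
Qed.

End FiniteFamilies.

Lemma continuous_sum {R : realType} (T : topologicalType) (n : nat) (f : 'I_n -> T -> R) :
  (forall i, continuous (f i)) -> continuous (fun x => \sum_i f i x).
Proof. by move=> fc; apply: continuous_big => //; exact: add_continuous. Qed.

(** * Making the edge directions sum to zero *)

Section ClosingUp.
Context {R : realType} {d : nat}.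
Local Notation V := 'rV[R]_d.+1.

Lemma enorm_ball_compact (r : R) : compact [set x : V | enorm x <= r].
Proof.
apply: bounded_closed_compact.
  exists r; split; first exact: num_real.
  by move=> M rM x /= xr; apply: le_trans (norm_le_enorm _) _; apply: le_trans xr (ltW rM).
apply: (closed_comp (f := enorm) (D := [set x | x <= r])); last exact: closed_le.
by move=> x _; exact: enorm_continuous.
Qed.

(* x minimizes the convex function \sum_i |u_i + x|, whose gradient is the sum
   of the normalized vectors; non-collinearity keeps the minimizer close to 0. *)
Lemma closing_up n (u : 'I_n -> V) (e b r : R) : (0 < n)%N -> 0 <= e <= 8^-1 ->
  (forall i, 1 - e <= enorm (u i) <= 1) -> \sum_i u i = 0 -> 0 < r <= 4^-1 ->
  (forall y, n%:R * b * enorm y ^+ 4 <= \sum_i enorm (reject y (u i)) ^+ 2) ->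
  12 * e < b * r ^+ 2 ->
  exists2 x, enorm x <= r & \sum_i normalize (u i + x) = 0.
Proof.
move=> n0 e8 hu su /andP[r0 r4] hb eb; have n0' : 0 < n%:R :> R by rewrite ltr0n.
have /andP[e0 e8'] := e8.
pose f (x : V) := \sum_i enorm (u i + x).
have fc : continuous f.
  apply: continuous_sum => i x.
  apply: (@continuous_comp _ _ _ (fun x => u i + x) enorm); last exact: enorm_continuous.
  exact: (cvgD (cvg_cst (u i)) (@cvg_id _ (nbhs x))).
pose B := [set x : V | enorm x <= r].
have B0 : B !=set0 by exists 0; rewrite /B /= enorm0 ltW.
have [|x /set_mem Bx xmin] := compact_EVT_min B0 (@enorm_ball_compact r) (f := f).
  exact: continuous_subspaceT.
have f0 : f 0 <= n%:R.
  rewrite -[n in leRHS]card_ord -sumr_const; apply: ler_sum => i _.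
  by rewrite addr0; case/andP: (hu i).
(* Summing [enormD_ge] gives at least n (1 - 3 e) + n b r^2 / 4, which exceeds n exactly when 12 e <
   b r^2. As f 0 is at most n, the minimizer is interior. *)
have sphere y : enorm y = r -> n%:R < f y.
  move=> yr; have r2 : 0 < r ^+ 2 by rewrite exprn_gt0.
  have [K KE] : exists K, K = 1 - 3 * e by exists (1 - 3 * e).
  have low : \sum_(i < n) (K + inner (u i) y +
     (enorm y ^+ 2 * enorm (u i) ^+ 2 - inner y (u i) ^+ 2) / 4) <= f y.
    by rewrite KE; apply: ler_sum => i _; apply: enormD_ge => //; rewrite yr; lra.
  apply: lt_le_trans low.
  rewrite !big_split/= -inner_suml su -mulr_suml sumr_const card_ord.
  have -> : inner 0 y = 0 by rewrite -(scale0r 0) innerZl mul0r.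
  have : n%:R * b * r ^+ 2 <= \sum_(i < n) (enorm y ^+ 2 * enorm (u i) ^+ 2 - inner y (u i) ^+ 2).
    rewrite -(ler_pM2l r2) mulr_sumr.
    rewrite (_ : r ^+ 2 * (n%:R * b * r ^+ 2) = n%:R * b * r ^+ 4); last by rewrite (_ : 4%N = (2 + 2)%N)// exprD; ring.
    rewrite -yr; apply: le_trans (hb y) _; apply: ler_sum => i _.
    by rewrite reject_sqr.
  rewrite -[X in _ < X + _ + _]mulr_natl addr0 => h.
  have : 0 < n%:R * (b * r ^+ 2 - 12 * e) by rewrite mulr_gt0// subr_gt0.
  rewrite KE; lra.
have xr : enorm x < r.
  rewrite lt_neqAle Bx andbT; apply/eqP => /sphere; apply/negP; rewrite -leNgt.
  by apply: le_trans f0; apply: xmin; apply: mem_set; rewrite /B/= enorm0 ltW.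
have ux i : 2^-1 <= enorm (u i + x).
  have /andP[h _] := hu i; have := lerB_enorm (u i) (- x).
  by rewrite opprK enormN; lra.
exists x => //; set S := \sum_i _.
apply: enorm_eq0; apply/eqP; rewrite eq_le enorm_ge0 andbT leNgt; apply/negP => S0.
(* Length of a gradient step that stays in the ball and whose quadratic error n t^2 |S|^2 is at most
   half the gain t |S|^2. *)
pose t := Num.min ((2 * n%:R)^-1) ((r - enorm x) / enorm S).
have t0 : 0 < t by rewrite lt_min invr_gt0 mulr_gt0//= divr_gt0// subr_gt0.
have t1 : t <= (2 * n%:R)^-1 by rewrite ge_min lexx.
have t2 : t <= (r - enorm x) / enorm S by rewrite ge_min lexx orbT.
have tS : enorm (- t *: S) = t * enorm S by rewrite enormZ normrN gtr0_norm.
have : f x <= f (x + - t *: S).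
  apply: xmin; apply: mem_set; rewrite /B /=.
  apply: le_trans (ler_enormD _ _) _; rewrite tS.
  by move: t2; rewrite ler_pdivlMr//; lra.
have up : f (x + - t *: S) <= f x - t * enorm S ^+ 2 + n%:R * (t * enorm S) ^+ 2.
  have : f (x + - t *: S) <= \sum_(i < n) (enorm (u i + x) +
      inner (normalize (u i + x)) (- t *: S) + enorm (- t *: S) ^+ 2).
    by apply: ler_sum => i _; rewrite addrA; exact: enormD_le.
  rewrite !big_split/= -inner_suml -/S innerZr -enorm_sqr sumr_const card_ord tS.
  by rewrite -(mulr_natl ((t * enorm S) ^+ 2) n) mulNr.
move=> low; have S2 : 0 < enorm S ^+ 2 by rewrite exprn_gt0.
have nt : n%:R * t <= 2^-1.
  by move: t1; rewrite -(ler_pM2l n0') invfM mulrCA divff ?mulr1// lt0r_neq0.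
have : 0 < t * enorm S ^+ 2 * (1 - n%:R * t) by rewrite !mulr_gt0//; lra.
by rewrite exprMn in up; lra.
Qed.

End ClosingUp.

Section NonCollinear.
Context {R : realType} {d : nat} (c : R -> 'rV[R]_d).
Hypotheses (ce : embedded c) (cl : lipschitz1 c).
Let cc : closed_curve c := ce.1.

Lemma collinear (P Q : 'rV[R]_d) : 0 < enorm P ->
  enorm P ^+ 2 * enorm Q ^+ 2 - inner P Q ^+ 2 <= 0 ->
  Q = (inner P Q / enorm P ^+ 2) *: P.
Proof.
move=> P0 h; have P2 : 0 < enorm P ^+ 2 by rewrite exprn_gt0.
have r0 : enorm (reject P Q) = 0.
  apply/eqP; rewrite -sqrf_eq0 reject_sqr eq_le mulr_ge0_le0 ?(ltW P2)//=.
  by rewrite -reject_sqr sqr_ge0.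
move/enorm_eq0/eqP : r0; rewrite subr_eq0 => /eqP r0.
by rewrite mulrC -scalerA -r0 scalerA mulVf ?scale1r// lt0r_neq0.
Qed.

(** On a line, the coordinate along P would go continuously from 0 to 1 and back to 0, taking the
    value 1/2 once in each half turn, against injectivity. *)
Lemma embedded_noncollinear : exists t : R, [/\ 0 <= t <= 1 &
  0 < enorm (c 2^-1 - c 0) ^+ 2 * enorm (c t - c 0) ^+ 2 - inner (c 2^-1 - c 0) (c t - c 0) ^+ 2].
Proof.
set P := c 2^-1 - c 0.
have P0 : 0 < enorm P.
  have half : `|2^-1 - 0| = 2^-1 :> R by rewrite subr0 ger0_norm.
  by apply: embedded_enorm_gt0 => //; rewrite circle_distE half// invr_gt0.
apply: contrapT => nt.
have col t : 0 <= t <= 1 -> c t - c 0 = (inner P (c t - c 0) / enorm P ^+ 2) *: P.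
  move=> t01; apply: collinear => //; rewrite leNgt; apply/negP => h.
  by apply: nt; exists t.
pose f t := inner P (c t - c 0) / enorm P ^+ 2.
have fc : continuous f.
  have -> : f = fun t => \sum_(i < d) P ord0 i * (c t - c 0) ord0 i / enorm P ^+ 2.
    by apply/funext => t; rewrite /f /inner mulr_suml.
  apply: continuous_sum => i t.
  apply: cvgM; last exact: cvg_cst.
  apply: cvgM; first exact: cvg_cst.
  apply: (@continuous_comp _ _ _ (fun t => c t - c 0) (fun v : 'rV[R]_d => v ord0 i)).
    by apply: cvgB; [exact: cc.1 | exact: cvg_cst].
  exact: coord_continuous.
have P2 : enorm P ^+ 2 != 0 by rewrite lt0r_neq0// exprn_gt0.
have f0 : f 0 = 0 by rewrite /f subrr -(scale0r 0) innerZr !mul0r.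
have f2 : f 2^-1 = 1 by rewrite /f -/P -enorm_sqr divff.
have f1 : f 1 = 0 by rewrite /f -[X in c X]add0r cc.2 -/(f 0).
have h0 : 0 <= 2^-1 :> R by rewrite invr_ge0.
have h1 : 2^-1 <= 1 :> R by lra.
have [||t /[!in_itv]/= /andP[t0 t2] ft] := @IVT R f 0 2^-1 2^-1 h0.
- exact: continuous_subspaceT.
- by rewrite f0 f2 min_l// max_r//; apply/andP; split; lra.
have [||s /[!in_itv]/= /andP[s2 s1] fs] := @IVT R f 2^-1 1 2^-1 h1.
- exact: continuous_subspaceT.
- by rewrite f1 f2 min_r// max_l//; apply/andP; split; lra.
have e : c t = c s.
  have t01 : 0 <= t <= 1 by apply/andP; split; lra.
  have s01 : 0 <= s <= 1 by apply/andP; split; lra.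
  have := col t t01; rewrite -/(f t) ft => ct.
  have := col s s01; rewrite -/(f s) fs -ct => cs.
  by rewrite -(subrK (c 0) (c t)) -cs subrK.
have [_ ci] := ce; have [k sk] := ci s t (esym e).
have tne : t != 2^-1.
  by apply/eqP => te; move: ft; rewrite te f2; lra.
have sne : s != 1 by apply/eqP => se; move: fs; rewrite se f1; lra.
have : t != 0 by apply/eqP => te; move: ft; rewrite te f0; lra.
have tlt : t < 2^-1 by rewrite lt_neqAle tne.
have slt : s < 1 by rewrite lt_neqAle sne.
move=> tne0; have kE : k%:~R = t - s :> R by rewrite sk addrC addKr.
have : (-1)%:~R < k%:~R :> R by rewrite kE; lra.
have : k%:~R < 0%:~R :> R by rewrite kE; lra.
by rewrite !ltr_int; clear -k; lia.
Qed.

(** Up to an error 1/n, both P and Q are 1/n times partial sums of the slopes, so their rejections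
    are controlled by the sum on the right, while [gram_reject] bounds them below independently of
    n. *)
Lemma noncollinear_slopes : exists2 b, 0 < b & exists N : nat, forall n, (N <= n)%N ->
  forall y, n%:R * b * enorm y ^+ 4 <= \sum_(i < n)
    enorm (reject y (n%:R *: (c (i.+1%:R / n%:R) - c (i%:R / n%:R)))) ^+ 2.
Proof.
have [t [t01 gram]] := embedded_noncollinear.
set P := c 2^-1 - c 0 in gram; set Q := c t - c 0 in gram; set del := _ - _ in gram.
(* With S the sum of squared rejections, |y|^4 del <= 8 S / n + 8 |y|^4 / n; once 1/n <= del / 16
   the last term takes half of the left side. *)
exists (del / 16); first by rewrite divr_gt0.
have d2 : 0 < del / 16 by rewrite divr_gt0.
have [N HN] := inv_small d2; exists N => n /HN[n0 nd] y.
have n0' : 0 < n%:R :> R by rewrite ltr0n.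
set S := \sum_(i < n) _.
have n1 : n%:R^-1 <= 1 :> R by rewrite invf_le1 ?ler1n.
have low s : 0 <= s <= 1 -> enorm (c s - c 0) <= 1 /\
    enorm (reject y (c s - c 0)) ^+ 2 <= 2 * (S / n%:R) + 2 * (enorm y ^+ 4 / n%:R).
  move=> /andP[s0 s1]; split.
    by apply: le_trans (cl _ _) _; rewrite subr0 ger0_norm.
  pose j := cell n s; have /andP[j1 j2] := cell_itv n0 s0.
  have jn : (j <= n)%N.
    rewrite -(ler_nat R); move: j1; rewrite ler_pdivrMr// => /le_trans; apply.
    by rewrite ler_piMl.
  pose D := c (j%:R / n%:R) - c 0.
  have sD : \sum_(i < j) n%:R *: (c (i.+1%:R / n%:R) - c (i%:R / n%:R)) = n%:R *: D.
    rewrite -scaler_sumr; congr (_ *: _).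
    have := telescope_sumr (fun i => c (i%:R / n%:R)) (leq0n j).
    by rewrite big_mkord mul0r.
  have rD : enorm (reject y D) ^+ 2 <= S / n%:R.
    rewrite ler_pdivlMr//.
    have rn : reject y (n%:R *: D) = n%:R *: reject y D.
      by rewrite /reject innerZr; apply/rowP => q; rewrite !mxE; ring.
    have := enorm_sum_sqr_le (fun i : 'I_j =>
      reject y (n%:R *: (c (i.+1%:R / n%:R) - c (i%:R / n%:R)))).
    rewrite -reject_sum sD rn enormZ ger0_norm// exprMn.
    set T := \sum_(i < j) _ => hT.
    have TS : T <= S.
      rewrite /T /S (big_ord_widen n (fun i => enorm (reject y (n%:R *: (c (i.+1%:R / n%:R) - c (i%:R / n%:R)))) ^+ 2) jn).
      rewrite [leRHS](bigID (fun i : 'I_n => (i < j)%N))/= lerDl.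
      by apply: sumr_ge0 => i _; rewrite sqr_ge0.
    have T0 : 0 <= T by apply: sumr_ge0 => i _; rewrite sqr_ge0.
    have jT : j%:R * T <= n%:R * S by apply: ler_pM => //; rewrite ler_nat.
    by rewrite -(ler_pM2l n0'); move: hT; rewrite [n%:R ^+ 2]expr2; lra.
  have r2 : enorm (reject y (c s - c (j%:R / n%:R))) ^+ 2 <= enorm y ^+ 4 / n%:R.
    have h1 : enorm (c s - c (j%:R / n%:R)) <= n%:R^-1.
      apply: le_trans (cl _ _) _; rewrite ger0_norm ?subr_ge0//.
      by move: j2; rewrite -natr1 mulrDl mul1r; lra.
    have h2 := reject_le y (c s - c (j%:R / n%:R)).
    have h3 : enorm (reject y (c s - c (j%:R / n%:R))) <= enorm y ^+ 2 * n%:R^-1.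
      by apply: le_trans h2 _; rewrite ler_wpM2l// sqr_ge0.
    apply: (@le_trans _ _ ((enorm y ^+ 2 * n%:R^-1) ^+ 2)).
      by rewrite ler_pXn2r ?nnegrE ?enorm_ge0// mulr_ge0 ?sqr_ge0// invr_ge0.
    rewrite exprMn -exprM ler_wpM2l ?exprn_ge0 ?enorm_ge0// expr2.
    by rewrite ler_piMl// invr_ge0.
  have -> : c s - c 0 = D + (c s - c (j%:R / n%:R)) by rewrite /D [RHS]addrC addrA subrK.
  rewrite rejectD; set X := reject y D in rD *; set Y := reject y _ in r2 *.
  have := parallelogram X Y; have := sqr_ge0 (enorm (X - Y)); lra.
have half01 : 0 <= (2^-1 : R) <= 1 by apply/andP; split; lra.
have [P1 rP] := low _ half01.
have [Q1 rQ] := low t t01.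
have := gram_reject P Q y; rewrite -/del.
have P2 : enorm P ^+ 2 <= 1 by rewrite expr_le1 ?enorm_ge0.
have Q2 : enorm Q ^+ 2 <= 1 by rewrite expr_le1 ?enorm_ge0.
pose X := enorm (reject y P) ^+ 2 + enorm (reject y Q) ^+ 2.
rewrite -/X -/P -/Q => gr.
have y4 : 0 <= enorm y ^+ 4 by rewrite exprn_ge0 ?enorm_ge0.
have XX : X <= 4 * (S / n%:R) + 4 * (enorm y ^+ 4 / n%:R) by move: rP rQ; rewrite -/P -/Q /X; lra.
have X0 : 0 <= X by rewrite addr_ge0 ?sqr_ge0.
have h1 : enorm y ^+ 4 * del <= 2 * X.
  by apply: le_trans gr _; rewrite mulrC ler_wpM2r//; lra.
have h2 : enorm y ^+ 4 / n%:R <= enorm y ^+ 4 * (del / 16) by rewrite ler_wpM2l.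
rewrite -mulrA mulrC -ler_pdivlMr//; lra.
Qed.

End NonCollinear.

(** * Equilateral polygons from periodic node sequences *)

Section EquilateralInterpolation.
Context {R : realType} {d : nat}.
Local Notation V := 'rV[R]_d.

(** Partial sums up to the residue of i modulo n; the vanishing total is used at the wrap from n - 1
    to 0. *)
Lemma periodic_primitive n (v : int -> V) (v0 : V) : (0 < n)%N ->
  (forall i, v (i + n%:Z) = v i) -> \sum_(i < n) v i%:Z = 0 ->
  exists y : int -> V, [/\ forall i, y (i + n%:Z) = y i,
    forall i, y (i + 1) - y i = v i & y 0 = v0].
Proof.
move=> n0 vn sv; have vnk (i k : int) : v (i + k * n%:Z) = v i.
  have nat_per (j : int) (m : nat) : v (j + m%:Z * n%:Z) = v j.
    elim: m j => [|m IH] j; first by rewrite mul0r addr0.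
    by rewrite -[m.+1]addn1 PoszD mulrDl mul1r addrA vn IH.
  case: k => m; first exact: nat_per.
  by rewrite NegzE mulNr -[LHS](nat_per _ m.+1) subrK.
have nz : n%:Z != 0 by rewrite eqz_nat -lt0n.
pose y (i : int) := v0 + \sum_(k < `|(i %% n)%Z|) v k%:Z.
exists y; split.
- by move=> i; rewrite /y modzDr.
- move=> i; set r := `|(i %% n)%Z|%N.
  have rE : (i %% n)%Z = r%:Z by rewrite gez0_abs ?modz_ge0.
  have rn : (r < n)%N by rewrite -ltz_nat -rE ltz_pmod.
  have vi : v i = v r%:Z by rewrite {1}(divz_eq i n) rE addrC vnk.
  rewrite /y -/r -modzDml rE vi opprD addrACA subrr add0r.
  have [rn'|] := ltnP r.+1 n.
    by rewrite -[(r%:Z + 1)%R]/(Posz (r + 1)%N) modz_small ?addn1// big_ord_recr/= addrC addKr.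
  move=> nr; have nE : n = r.+1 by apply/eqP; rewrite eqn_leq nr.
  have -> : ((r%:Z + 1)%R %% n)%Z = 0 by rewrite nE -addn1 PoszD modzz.
  rewrite big_ord0 sub0r; apply/eqP; rewrite eq_sym -subr_eq0 opprK.
  by move: sv; rewrite nE big_ord_recr/= addrC => ->.
- by rewrite /y mod0z big_ord0 addr0.
Qed.

Variables (n : nat) (y : int -> V).
Hypotheses (n0 : (0 < n)%N) (yn : forall i, y (i + n%:Z) = y i).
Hypothesis ye : forall i, enorm (y (i + 1) - y i) = n%:R^-1.

Let n0' : 0 < n%:R :> R. Proof. by rewrite ltr0n. Qed.

Lemma equilateral_lipschitz1 : lipschitz1 (interp n y).
Proof.
by move=> s t; rewrite -[leRHS]mul1r; apply: interp_lipschitz => // i; rewrite ye mul1r.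
Qed.

Lemma lipschitz1_lipschitz (c : R -> V) : lipschitz1 c -> lipschitz c.
Proof.
move=> cl; apply: (@klipschitzW _ _ _ 1); first exact: (@globally_properfilter _ _ (0, 0)).
move=> [s t] _ /=; rewrite mul1r; apply: le_trans (norm_le_enorm _) _.
exact: cl.
Qed.

Lemma equilateral_closed : closed_curve (interp n y).
Proof.
split; first exact: (lipschitz1_continuous equilateral_lipschitz1).
exact: interp_period.
Qed.

Lemma interp_derivable (t : R) (i : int) : i%:~R < t * n%:R < (i + 1)%:~R ->
  is_derive t 1 (interp n y) (n%:R *: (y (i + 1) - y i)).
Proof.
move=> /andP[h1 h2]; set w := y (i + 1) - y i.
have ft : interp n y t = y i + (t * n%:R - i%:~R) *: w by apply: interp_on; rewrite !ltW.
have q : \forall h \near 0^', h^-1 *: ((interp n y \o shift t) (h *: 1) - interp n y t) = n%:R *: w.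
  pose e := Num.min (t - i%:~R / n%:R) ((i + 1)%:~R / n%:R - t).
  have e0 : 0 < e by rewrite lt_min !subr_gt0 ltr_pdivrMr// ltr_pdivlMr// h1.
  have e1 : e <= t - i%:~R / n%:R by rewrite ge_min lexx.
  have e2 : e <= (i + 1)%:~R / n%:R - t by rewrite ge_min lexx orbT.
  clearbody e; near=> h.
  have hne : h != 0 by near: h; exact: nbhs_dnbhs_neq.
  have he : `|h| < e by near: h; exact: dnbhs0_lt.
  rewrite /= [_ *: 1]mulr1 ft (@interp_on _ _ _ _ i); last first.
    move: he; rewrite ltr_norml => /andP[he1 he2].
    have hb1 : i%:~R / n%:R <= h + t by lra.
    have hb2 : h + t <= (i + 1)%:~R / n%:R by lra.
    by rewrite ler_pdivrMr// in hb1; rewrite ler_pdivlMr// in hb2; rewrite hb1.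
  rewrite -/w opprD addrACA subrr add0r -scalerBl scalerA; congr (_ *: _).
  by field.
have qc : (fun h : R => h^-1 *: ((interp n y \o shift t) (h *: 1) - interp n y t)) @ 0^'
    --> n%:R *: w by exact: cvg_near_cst q.
apply: DeriveDef; first exact: (cvgP _ qc).
exact: (cvg_lim _ qc).
Unshelve. all: by end_near. Qed.

Lemma equilateral_arclength : arclength_curves (interp n y).
Proof.
split; first exact: equilateral_closed.
  exact: (lipschitz1_lipschitz equilateral_lipschitz1).
suff : lebesgue_measure.-negligible (~` [set t : R | derivable (interp n y) t 1 /\
    enorm (derive1 (interp n y) t) = 1]) by [].
have cnt : countable [set (i%:~R / n%:R : R) | i in [set: int]].
  by apply: sub_countable (card_image_le _ _) _; exact: countableP.
exists [set (i%:~R / n%:R : R) | i in [set: int]]; split.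
- exact: countable_measurable.
- exact: countable_lebesgue_measure0.
- move=> t /= nt; apply: contrapT => ti; apply: nt.
  have /andP[i1 i2] := floor_itv (t * n%:R).
  have lt1 : (Num.floor (t * n%:R))%:~R < t * n%:R.
    rewrite lt_neqAle i1 andbT; apply/eqP => e; apply: ti.
    by exists (Num.floor (t * n%:R)) => //; rewrite e mulfK// lt0r_neq0.
  have dt := interp_derivable (introT andP (conj lt1 i2)).
  split; first exact: ex_derive.
  rewrite derive1E derive_val enormZ ye ger0_norm// divff//; exact: lt0r_neq0.
Qed.

Lemma equilateral_polygonsP : (1 < n)%N -> equilateral_polygons n (interp n y).
Proof.
move=> n1; split; first exact: equilateral_arclength.
exists (fun i => i%:R / n%:R); split.
  split.
    split; last by rewrite mul0r add0r divff// lt0r_neq0.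
    by move=> i _; rewrite ltr_pM2r ?invr_gt0// ltr_nat.
  move=> i _; exists (y i - i%:R *: (y (i%:Z + 1) - y i)), (n%:R *: (y (i%:Z + 1) - y i)).
  move=> r /andP[r1 r2]; rewrite (@interp_on _ _ _ _ i%:Z); last first.
    rewrite ler_pdivrMr// in r1; rewrite ler_pdivlMr// in r2; rewrite r1/=.
    by rewrite -[(i%:Z + 1)%R]/(Posz (i + 1)%N) addn1.
  rewrite scalerBl scalerA addrA addrAC.
  by rewrite -[(i%:Z)%:~R]/(i%:R : R).
(* Needs n >= 2: a single gap of length 1 would have circle distance 0. *)
move=> i _; have n2 : n%:R^-1 <= 2^-1 :> R by rewrite lef_pV2 ?posrE// ler_nat.
have e : `|i.+1%:R / n%:R - i%:R / n%:R| = n%:R^-1 :> R.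
  by rewrite -mulrBl -natr1 addrC addKr mul1r ger0_norm.
by rewrite circle_distE e.
Qed.

End EquilateralInterpolation.

Section EquilateralApproximation.
Context {R : realType} {d : nat}.
Local Notation V := 'rV[R]_d.+1.

(** The slope and distance bounds serve the knot class and the far energy, the defect bound the near
    energy. The latter compares [q] with [c] itself, on arcs between nodes, where [c] and its
    inscribed polygon agree. *)
Record equilateral_approx (c : R -> V) (n : nat) (h : R) (q : R -> V) : Prop :=
  EquilateralApprox {
    approx_closed : closed_curve q;
    approx_lipschitz : lipschitz1 q;
    approx_equilateral : equilateral_polygons n q;
    approx_slope : forall s t,
      enorm ((inscribed c n t - q t) - (inscribed c n s - q s)) <= h * `|t - s|;
    approx_dist : forall t, enorm (inscribed c n t - q t) <= h;
    approx_defect : forall (i : int) (m : nat),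
      defect q (i%:~R / n%:R) ((i + m%:Z)%:~R / n%:R) <=
      4 * defect c (i%:~R / n%:R) ((i + m%:Z)%:~R / n%:R) }.

Lemma sum_increments (z : int -> V) (i : int) (m : nat) :
  \sum_(k < m) (z (i + k%:Z + 1) - z (i + k%:Z)) = z (i + m%:Z) - z i.
Proof.
have := telescope_sumr (fun k : nat => z (i + k%:Z)) (leq0n m).
rewrite big_mkord addr0 => <-; apply: eq_bigr => k _.
by rewrite -addrA -PoszD addn1.
Qed.

Lemma normalize_close (u x : V) (e r : R) : 1 - e <= enorm u <= 1 ->
  enorm x <= r -> 0 < enorm (u + x) ->
  enorm (u - normalize (u + x)) <= e + 2 * r.
Proof.
move=> /andP[u0 u1] xr ux.
set a := u + x in ux *.
have aE : enorm (a - normalize a) = `|enorm a - 1|.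
  rewrite (_ : a - normalize a = (1 - (enorm a)^-1) *: a); last first.
    by rewrite /normalize scalerBl scale1r.
  rewrite enormZ -{2}(ger0_norm (enorm_ge0 a)) -normrM mulrBl mul1r mulVf//.
  exact: lt0r_neq0.
have -> : u - normalize a = (a - normalize a) - x.
  by set w := normalize a; apply/rowP => i; rewrite !mxE; ring.
apply: le_trans (ler_enormB _ _) _; rewrite aE.
have a1 : enorm a <= enorm u + enorm x := ler_enormD _ _.
have a2 : enorm u - enorm x <= enorm a by rewrite -(enormN x) -[a]/(u + x) -{2}(opprK x) lerB_enorm.
have : `|enorm a - 1| <= e + r by rewrite ler_norml; apply/andP; split; lra.
lra.
Qed.

Lemma exists_equilateral_approx (c : R -> V) : embedded c -> lipschitz1 c ->
  (dint (density c) < +oo)%E -> forall h, 0 < h -> exists N : nat, forall n, (N <= n)%N ->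
  (1 < n)%N /\ exists q, equilateral_approx c n h q.
Proof.
move=> ce cl fin h h0; have [cc _] := ce.
have [b b0 [N1 HN1]] := noncollinear_slopes ce cl.
(* With [e] and [r] at most h / 4, the error e + 2 r of [normalize_close] is below [h]; e <= b r^2 /
   24 is the strict smallness required by [closing_up]. *)
pose r := Num.min 4^-1 (h / 4).
have r0 : 0 < r by rewrite lt_min; apply/andP; split; lra.
have r4 : r <= 4^-1 by rewrite ge_min lexx.
have rh : r <= h / 4 by rewrite ge_min lexx orbT.
pose e := Num.min 8^-1 (Num.min (h / 4) (b * r ^+ 2 / 24)).
have br : 0 < b * r ^+ 2 by rewrite mulr_gt0// exprn_gt0.
have e0 : 0 < e by rewrite !lt_min; apply/and3P; split; lra.
have e8 : e <= 8^-1 by rewrite ge_min lexx.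
have eh : e <= h / 4 by rewrite /e !ge_min lexx orbT.
have eb : e <= b * r ^+ 2 / 24 by rewrite /e !ge_min lexx !orbT.
have [|dl dl0 fl] := flatness ce cl fin (e := e); first by rewrite e0; lra.
have [N2 HN2] := inv_small dl0.
exists (maxn 2 (maxn N1 N2)) => n; rewrite !geq_max => /and3P[n1 nN1 nN2].
have n0 : (0 < n)%N by exact: ltnW.
have n0' : 0 < n%:R :> R by rewrite ltr0n.
have nn0 : n%:R != 0 :> R by rewrite lt0r_neq0.
have [_ nd] := HN2 n nN2.
split=> //; clearbody r e.
pose u (i : int) : V := n%:R *: (c ((i + 1)%:~R / n%:R) - c (i%:~R / n%:R)).
have un i : u (i + n%:Z) = u i.
  have per (j : int) : c ((j + n%:Z)%:~R / n%:R) = c (j%:~R / n%:R).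
    by rewrite intrD mulrDl divff// cc.2.
  by rewrite /u addrAC !per.
have step (i : int) : (i + 1)%:~R / n%:R - i%:~R / n%:R = n%:R^-1 :> R.
  by rewrite -mulrBl intrD (addrC i%:~R) addrK mul1r.
have u1 i : 1 - e <= enorm (u i) <= 1.
  have /ger0_norm ni : 0 <= n%:R^-1 :> R by rewrite invr_ge0.
  rewrite enormZ ger0_norm//; apply/andP; split.
    have := fl (i%:~R / n%:R) ((i + 1)%:~R / n%:R); rewrite step ni => /(_ nd) h1.
    by have := ler_wpM2l (ltW n0') h1; rewrite mulrCA divff// mulr1.
  have := cl (i%:~R / n%:R) ((i + 1)%:~R / n%:R); rewrite step ni => h1.
  by have := ler_wpM2l (ltW n0') h1; rewrite divff.
have sumu (i : int) (m : nat) : \sum_(k < m) u (i + k%:Z) =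
    n%:R *: (c ((i + m%:Z)%:~R / n%:R) - c (i%:~R / n%:R)).
  by rewrite -(sum_increments (fun i => c (i%:~R / n%:R))) scaler_sumr.
have su : \sum_(k < n) u k%:Z = 0.
  rewrite (eq_bigr (fun k : 'I_n => u (0 + k%:Z))); last by move=> k _; rewrite add0r.
  rewrite sumu add0r mul0r divff// -[X in c X - _]add0r cc.2 subrr scaler0 //.
have [x xr sx] : exists2 x, enorm x <= r & \sum_(i < n) normalize (u i%:Z + x) = 0.
  apply: (closing_up (e := e) (b := b)) => //.
  - by rewrite e8 ltW.
  - by rewrite r0.
  - move=> y; apply: le_trans (HN1 n nN1 y) _; apply: ler_sum => i _.
    by rewrite /u -[(i%:Z + 1)%R]/(Posz (i + 1)%N) addn1.
  - lra.
have ux i : 2^-1 <= enorm (u i + x).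
  have /andP[h1 _] := u1 i; have := lerB_enorm (u i) (- x).
  by rewrite opprK enormN; lra.
have ux0 i : 0 < enorm (u i + x) by have := ux i; lra.
pose v i : V := n%:R^-1 *: normalize (u i + x).
(* Starting at c 0 makes both polygons agree at parameter 0, so the slope bound over one period also
   bounds their distance by [h]. *)
have [||y [yn yv y0]] := @periodic_primitive R d.+1 n v (c 0) n0.
- by move=> i; rewrite /v un.
- by rewrite -scaler_sumr sx scaler0.
have ye i : enorm (y (i + 1) - y i) = n%:R^-1.
  by rewrite yv enormZ ger0_norm ?invr_ge0// enorm_normalize// mulr1.
have slope s t : enorm ((inscribed c n t - interp n y t) - (inscribed c n s - interp n y s))
    <= h * `|t - s|.
  rewrite /inscribed !interpB; apply: interp_lipschitz => // i.
  rewrite (_ : _ - y (i + 1) - _ = (c ((i + 1)%:~R / n%:R) - c (i%:~R / n%:R)) -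
      (y (i + 1) - y i)); last by apply/rowP => j; rewrite !mxE; ring.
  rewrite yv.
  have -> : c ((i + 1)%:~R / n%:R) - c (i%:~R / n%:R) = n%:R^-1 *: u i.
    by rewrite /u scalerA mulVf// scale1r.
  rewrite /v -scalerBr enormZ ger0_norm ?invr_ge0// mulrC ler_wpM2r ?invr_ge0//.
  by apply: le_trans (normalize_close (u1 i) xr (ux0 i)) _; lra.
have qc := equilateral_closed n0 yn ye.
have d0 : inscribed c n 0 - interp n y 0 = 0.
  by rewrite -(mul0r n%:R^-1) /inscribed !(interp_node _ 0)// y0 mul0r subrr.
exists (interp n y); split=> //.
- exact: equilateral_lipschitz1.
- exact: equilateral_polygonsP.
- move=> t; pose k := Num.floor t.
  have /andP[k1 k2] := floor_itv t; rewrite -/k in k1 k2.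
  have pc : closed_curve (inscribed c n) by exact: inscribed_closed.
  have tE : t = (t - k%:~R) + k%:~R by rewrite subrK.
  rewrite tE !closed_curve_period//; have := slope 0 (t - k%:~R).
  rewrite d0 !subr0 => /le_trans; apply; rewrite ger0_norm ?subr_ge0//.
  by rewrite ler_piMr ?(ltW h0)//; move: k2; rewrite intrD; lra.
- move=> i m; rewrite /defect !interp_node//.
  have ni2 : 0 <= n%:R^-1 ^+ 2 :> R by rewrite sqr_ge0.
  have yE : y (i + m%:Z) - y i = n%:R^-1 *: \sum_(k < m) normalize (u (i + k%:Z) + x).
    rewrite -sum_increments scaler_sumr; apply: eq_bigr => k _; exact: yv.
  have cE : c ((i + m%:Z)%:~R / n%:R) - c (i%:~R / n%:R) = n%:R^-1 *: \sum_(k < m) u (i + k%:Z).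
    by rewrite sumu scalerA mulVf// scale1r.
  rewrite yE cE !enormZ !(ger0_norm (_ : 0 <= n%:R^-1)) ?invr_ge0// !exprMn.
  have -> : ((i + m%:Z)%:~R / n%:R - i%:~R / n%:R) ^+ 2 = n%:R^-1 ^+ 2 * m%:R ^+ 2 :> R.
    by rewrite -mulrBl intrD (addrC i%:~R) addrK mulrC exprMn.
  rewrite -!mulrBr mulrCA ler_wpM2l//; apply: normalize_defect => // k.
  by case/andP: (u1 (i + k%:Z)).
Qed.

End EquilateralApproximation.

(** * The knot class of the approximating polygons *)

Section KnotType.
Context {R : realType}.
Local Notation V := 'rV[R]_3.
Implicit Types c q f g : R -> V.

Lemma periodic_lipschitz_circle f g (a : R) : closed_curve f -> closed_curve g ->
  (forall s t, enorm ((f t - g t) - (f s - g s)) <= a * `|t - s|) ->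
  forall s t, enorm ((f t - g t) - (f s - g s)) <= a * circle_dist t s.
Proof.
move=> fc gc h s t; have [k ->] := circle_dist_lift t s.
by have := h (s + k%:~R) t; rewrite !closed_curve_period.
Qed.

Lemma bilipschitz_perturb f g (l a : R) : closed_curve f -> closed_curve g ->
  (forall s t, enorm ((f t - g t) - (f s - g s)) <= a * `|t - s|) ->
  (forall t s, l * circle_dist t s <= enorm (f t - f s)) ->
  forall t s, (l - a) * circle_dist t s <= enorm (g t - g s).
Proof.
move=> fc gc h fl t s; have := periodic_lipschitz_circle fc gc h s t.
have := fl t s; have := lerB_enorm (f t - f s) (g t - g s).
by rewrite (_ : f t - f s - (g t - g s) = f t - g t - (f s - g s)); [lra | rewrite !opprB addrACA [RHS]addrACA (addrC (- f s))].
Qed.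

Lemma bilipschitz_embedded q (l : R) : closed_curve q -> 0 < l ->
  (forall t s, l * circle_dist t s <= enorm (q t - q s)) -> embedded q.
Proof.
move=> qc l0 ql; split=> // s t st; apply: circle_dist_eq0.
have := ql t s; rewrite st subrr enorm0 pmulr_rle0// => h.
by apply/le_anti; rewrite h circle_dist_ge0.
Qed.

(** The isotopy lemma is stated in the sup norm, which loses a factor 3 against the Euclidean one in
    dimension 3; 12 is this 3 times the 4 of the target constant 1/4. *)
Lemma relative_displacement f g (l a : R) : closed_curve f -> closed_curve g -> 0 < l ->
  0 <= a -> 12 * a <= l ->
  (forall s t, enorm ((f t - g t) - (f s - g s)) <= a * `|t - s|) ->
  (forall t s, l * circle_dist t s <= enorm (g t - g s)) ->
  forall s t, `|(f t - g t) - (f s - g s)| <= 4^-1 * `|g t - g s|.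
Proof.
move=> fc gc l0 a0 al h gl s t; apply: le_trans (norm_le_enorm _) _.
have h1 := periodic_lipschitz_circle fc gc h s t.
have h2 := gl t s; have h3 := enorm_le_norm (g t - g s).
have d0 := circle_dist_ge0 t s; apply: (le_trans h1).
have : 12 * a * circle_dist t s <= l * circle_dist t s by rewrite ler_wpM2r.
lra.
Qed.

(** The chain of curves is q, P_n, P_2n, P_4n, ..., where P_m is the inscribed m-gon. It converges
    to [c], and all its members share a bi-Lipschitz bound. *)
Lemma equilateral_approx_isotopic c : embedded c -> lipschitz1 c ->
  (dint (density c) < +oo)%E -> exists2 l, 0 < l & exists2 h0, 0 < h0 &
  exists N : nat, forall n h q, (N <= n)%N -> 0 <= h <= h0 -> equilateral_approx c n h q ->
  (forall t s, l * circle_dist t s <= enorm (q t - q s)) /\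
  ambient_isotopic (range q) (range c).
Proof.
move=> ce cl fin; have [cc _] := ce.
have [l l01 hl] := bilipschitz ce cl fin; have /andP[l0 l1] := l01.
have [N1 HN1] := inscribed_bilipschitz ce cl fin l01 hl.
(* The weakest bi-Lipschitz constant in the chain is l / 4, that of [q], and 48 = 4 * 12 suits
   [relative_displacement]; [e] suits [inscribed_double]. *)
pose a := l / 48; pose e := a ^+ 2 / 2.
have a0 : 0 < a by rewrite divr_gt0.
have a1 : a <= 1 by rewrite /a; lra.
have e0 : 0 < e by rewrite divr_gt0// exprn_gt0.
have e1 : e <= 1 by rewrite /e; nra.
have [|dl dl0 fl] := flatness ce cl fin (e := e); first by rewrite e0.
have [N2 HN2] := inv_small dl0.
exists (l / 4); first by rewrite divr_gt0.
exists a => //; exists (maxn N1 N2) => n h q; rewrite geq_max => /andP[nN1 nN2] /andP[h0 ha] qa.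
have [qc ql _ qs qd _] := qa.
have [n0 Pl] := HN1 n nN1.
have n0' : 0 < n%:R :> R by rewrite ltr0n.
have pc m : (0 < m)%N -> closed_curve (inscribed c m) by exact: inscribed_closed.
have qbl t s : l / 4 * circle_dist t s <= enorm (q t - q s).
  apply: le_trans (bilipschitz_perturb (pc n n0) qc qs Pl t s).
  by rewrite ler_wpM2r ?circle_dist_ge0//; move: ha; rewrite /a; lra.
split=> //.
pose m k := (n * 2 ^ k)%N.
have m0 k : (0 < m k)%N by rewrite muln_gt0 n0 expn_gt0.
have mS k : m k.+1 = (m k).*2 by rewrite /m expnS mulnCA mul2n.
have nm k : (n <= m k)%N by rewrite leq_pmulr// expn_gt0.
have mk k : (m k)%:R^-1 <= 2^-1 ^+ k :> R.
  rewrite /m natrM natrX invfM exprVn ler_piMl ?invr_ge0 ?exprn_ge0//.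
  by rewrite invf_le1 ?ler1n.
have halfk k : 0 <= 2^-1 ^+ k :> R by rewrite exprn_ge0// invr_ge0.
pose f k := if k is k'.+1 then inscribed c (m k') else q.
(* The polygons at k + 1 and k + 2 differ by at most 2 * 2^-(k+1) + 2 * 2^-k, which is 6 * 2^-(k+1);
   the ratio 1/2 is below 1 - 1/4. *)
apply: (@isotopy_of_small_steps R f c 4^-1 6 2^-1).
- by apply/andP; split; lra.
- by apply/andP; split; lra.
- case=> [|k] s t.
    have -> : f 1%N = inscribed c n by rewrite /f /m expn0 muln1.
    apply: (relative_displacement (l := l / 4) (a := h)) => //.
    + exact: pc.
    + by rewrite divr_gt0.
    + by move: ha; rewrite /a; lra.
  rewrite /f mS; apply: (relative_displacement (l := l / 2) (a := a)) => //.
  + by apply: pc; rewrite double_gt0.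
  + exact: pc.
  + by rewrite divr_gt0.
  + exact: ltW.
  + by rewrite /a; lra.
  + apply: (inscribed_double cl (e := e)) => //.
    * by rewrite e1 ltW.
    * exact: ltW.
    * by rewrite /e; lra.
    * move=> t' s' ts; apply: fl; apply: le_trans ts _.
      by have [|_] := HN2 (m k); first exact: leq_trans (nm k).
  + by have [|_ h'] := HN1 (m k); first exact: leq_trans (nm k).
- case=> [|k] t; apply: le_trans (norm_le_enorm _) _.
    have -> : f 1%N = inscribed c n by rewrite /f /m expn0 muln1.
    by apply: le_trans (qd t) _; rewrite expr0 mulr1; lra.
  rewrite /f exprS; apply: le_trans (ler_enorm_trans (c t) _ _) _.
  have i1 := inscribed_close cl t (m0 k.+1); have i2 := inscribed_close cl t (m0 k).
  rewrite enorm_distC in i2; have := mk k; have := mk k.+1; rewrite exprS.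
  by move: (halfk k); lra.
- move=> t; apply/cvgrPdist_le => x x0.
  have := @cvg_geometric R 2 2^-1; rewrite ger0_norm ?invr_ge0// => /(_ _)/wrap[]; first by lra.
  move/cvgr0Pnorm_lt => /(_ x x0)[K _ hK].
  exists K.+1 => //; case=> // k /= Kk; apply: le_trans (norm_le_enorm _) _.
  rewrite enorm_distC; apply: le_trans (inscribed_close cl t (m0 k)) _.
  have := hK k Kk; rewrite /= ger0_norm ?mulr_ge0// => /ltW; apply: le_trans.
  by rewrite ler_wpM2l.
Qed.

End KnotType.

(** * Recovery sequences and the lower bound *)

Section NearSum.
Context {R : realType} {d : nat}.
Implicit Types c q : R -> 'rV[R]_d.

(** The arc between the two vertices lies in the arc from node i to node i + m + 1, where the defect
    of [q] is at most 4 times that of [c], and this arc lies in [t, s]. Since m >= 1, s - t <= (m +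
    3) / n <= 4 m / n, so the fourth powers cost 4^4, and l^2 comes from the chord of [q]. *)
Lemma near_density_compare c q n (l r x : R) (i : int) (m : nat) t s :
  embedded c -> lipschitz1 c -> embedded q -> lipschitz1 q -> 0 < l ->
  (forall t s, l * circle_dist t s <= enorm (q t - q s)) ->
  (forall (i : int) (m : nat), defect q (i%:~R / n%:R) ((i + m%:Z)%:~R / n%:R) <=
      4 * defect c (i%:~R / n%:R) ((i + m%:Z)%:~R / n%:R)) ->
  (0 < n)%N -> (0 < m)%N -> r <= 8^-1 -> m%:R / n%:R < r -> 0 <= x < n%:R^-1 ->
  (i - 1)%:~R / n%:R <= t <= i%:~R / n%:R ->
  (i + m%:Z + 1)%:~R / n%:R <= s <= (i + m%:Z + 2)%:~R / n%:R ->
  near_density q r (x + i%:~R / n%:R) (x + (i + m%:Z)%:~R / n%:R) <=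
  4 ^+ 5 / l ^+ 2 * near_density c (4 * r) t s.
Proof.
move=> ce cl qe ql l0 qbl qdef n0 m0 r8 mr /andP[x0 xn] /andP[t1 t2] /andP[s1 s2].
have n0' : 0 < n%:R :> R by rewrite ltr0n.
set xi := x + i%:~R / n%:R; set xj := x + _ / n%:R.
have [w wE] : exists w : R, w = m%:R / n%:R by exists (m%:R / n%:R).
rewrite -wE in mr.
have w0 : 0 < w by rewrite wE divr_gt0// ltr0n.
have nw : n%:R^-1 <= w by rewrite wE ler_peMl ?invr_ge0// ler1n.
have ijw : xj = xi + w by rewrite /xi /xj wE intrD mulrDl addrA.
have e1 : (i + m%:Z + 1)%:~R / n%:R = i%:~R / n%:R + w + n%:R^-1 :> R.
  by rewrite wE intrD mulrDl mul1r intrD mulrDl.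
have e2 : (i + m%:Z + 2)%:~R / n%:R = i%:~R / n%:R + w + 2 * n%:R^-1 :> R.
  by rewrite wE intrD mulrDl intrD mulrDl.
have e3 : (i - 1)%:~R / n%:R = i%:~R / n%:R - n%:R^-1 :> R.
  by rewrite intrD mulrDl mulN1r.
rewrite e1 e2 in s1 s2; rewrite e3 in t1.
set X : R := i%:~R / n%:R in t1 t2 s1 s2 xi ijw e1 *.
have ts : t < s by lra.
have st4 : s - t <= 4 * w by lra.
have half : s - t <= 2^-1 by lra.
have cdst : circle_dist t s = s - t.
  have a : `|s - t| = s - t by rewrite gtr0_norm ?subr_gt0.
  by rewrite circle_distC circle_distE a.
have cdx : circle_dist xi xj = w.
  have a : `|xj - xi| = w by rewrite ijw addrC addKr gtr0_norm.
  by rewrite circle_distC circle_distE a//; lra.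
have str : s - t < 4 * r by lra.
rewrite /near_density cdst cdx mr str.
have ijlt : xi < xj by rewrite ijw ltrDl.
have ijE : xj - xi = w by rewrite ijw addrC addKr.
have u1 : density q xi xj <= defect q xi xj / (l ^+ 2 * (xj - xi) ^+ 4).
  apply: density_le_defect => //; first by rewrite ijE; lra.
  by rewrite enorm_distC ijE -cdx; exact: qbl.
have u2 : defect q xi xj <= defect q X (X + w + n%:R^-1).
  by apply: defect_homo => //; rewrite ?ijw /xi; [apply/andP; split | ]; lra.
have u3 : defect q X (X + w + n%:R^-1) <= 4 * defect c X (X + w + n%:R^-1).
  have := qdef i m.+1.
  by rewrite (_ : i + m.+1%:Z = i + m%:Z + 1) ?e1// -addrA -PoszD addn1.
have u4 : defect c X (X + w + n%:R^-1) <= defect c t s.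
  by apply: defect_homo => //; apply/andP; split; lra.
have u5 := density_ge_defect ce cl ts half.
have d0 : 0 <= defect c t s.
  rewrite /defect subr_ge0 ler_pXn2r ?nnegrE ?enorm_ge0 ?subr_ge0 ?(ltW ts)//.
  by have := cl t s; rewrite gtr0_norm ?subr_gt0.
have st0 : 0 < s - t by rewrite subr_gt0.
have w4 : 0 < w ^+ 4 by rewrite exprn_gt0.
have l2 : 0 < l ^+ 2 by rewrite exprn_gt0.
have u6 : defect c t s / (4 * w) ^+ 4 <= density c t s.
  have w4' : 0 < 4 * w by rewrite mulr_gt0.
  apply: le_trans u5; rewrite ler_wpM2l// lef_pV2 ?posrE ?(exprn_gt0 _ st0) ?(exprn_gt0 _ w4')//.
  by rewrite ler_pXn2r ?nnegrE ?(ltW st0) ?(ltW w4').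
apply: (le_trans u1); rewrite ijE ler_pdivrMr ?mulr_gt0//.
have -> : 4 ^+ 5 / l ^+ 2 * density c t s * (l ^+ 2 * w ^+ 4) =
    4 * ((4 * w) ^+ 4 * density c t s).
  by rewrite exprMn; field; exact: lt0r_neq0.
have : defect c t s <= (4 * w) ^+ 4 * density c t s.
  by rewrite mulrC -ler_pdivrMr// exprn_gt0// (mulr_gt0 _ w0).
lra.
Qed.

(** Each near pair of distinct vertices is assigned to an order in which the second lies less than
    [r] ahead of the first; the two orders give the factor 2. Each ordered pair is charged to one
    lattice square for [c]. *)
Lemma near_sum c q n (l r x : R) :
  embedded c -> lipschitz1 c -> embedded q -> lipschitz1 q -> 0 < l ->
  (forall t s, l * circle_dist t s <= enorm (q t - q s)) ->
  (forall (i : int) (m : nat), defect q (i%:~R / n%:R) ((i + m%:Z)%:~R / n%:R) <=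
      4 * defect c (i%:~R / n%:R) ((i + m%:Z)%:~R / n%:R)) ->
  (0 < n)%N -> r <= 8^-1 -> 0 <= x < n%:R^-1 ->
  ((\sum_(i < n) \sum_(j < n) near_density q r (x + i%:R / n%:R) (x + j%:R / n%:R)
     / n%:R ^+ 2)%:E <= (2 * (4 ^+ 5 / l ^+ 2))%:E * dint (near_density c (4 * r)))%E.
Proof.
move=> ce cl qe ql l0 qbl qdef n0 r8 xn; have [cc _] := ce; have [qc _] := qe.
have n0' : 0 < n%:R :> R by rewrite ltr0n.
have nn0 : n%:R != 0 :> R by rewrite lt0r_neq0.
have nz : n%:Z != 0 by rewrite eqz_nat -lt0n.
pose g (i j : int) := near_density q r (x + i%:~R / n%:R) (x + j%:~R / n%:R).
have g0 i j : 0 <= g i j by exact: near_density_ge0.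
have gC i j : g i j = g j i by rewrite /g /near_density circle_distC densityC.
have gnr i j (k : int) : g i (j + k * n%:Z) = g i j.
  rewrite /g intrD intrM mulrDl mulfK// addrA; exact: near_density_periodr.
have gnl i j (k : int) : g (i + k * n%:Z) j = g i j by rewrite gC gnr gC.
(* Going forward from i, the index j is reached after m steps, not 0, over a length below [r]. *)
pose fwd (i j : int) := let m := `|((j - i) %% n)%Z|%N in (0 < m)%N && (m%:R / n%:R < r).
pose gf i j := if fwd i j then g i j else 0.
have gf0 i j : 0 <= gf i j by rewrite /gf; case: ifP.
have fwdnr i j : fwd i (j + n%:Z) = fwd i j by rewrite /fwd addrAC modzDr.
have fwdnl i j : fwd (i + n%:Z) j = fwd i j.
  by rewrite -fwdnr /fwd opprD addrACA subrr addr0.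
have gfnr i j : gf i (j + n%:Z) = gf i j.
  by rewrite /gf fwdnr; case: ifP => // _; rewrite -(gnr i j 1) mul1r.
have gfnl i j : gf (i + n%:Z) j = gf i j.
  by rewrite /gf fwdnl; case: ifP => // _; rewrite -(gnl i j 1) mul1r.
have split_g i j : g i j <= gf i j + gf j i.
  suff [h|[h|h]] : fwd i j \/ fwd j i \/ g i j = 0.
  - by rewrite {1}/gf h lerDl.
  - by rewrite {2}/gf h -(gC i) lerDr.
  - by rewrite h addr_ge0.
  rewrite /g /near_density; case: ifPn => [near|_]; last by right; right.
  have [k kE] := circle_distP (x + i%:~R / n%:R) (x + j%:~R / n%:R).
  have dE : x + i%:~R / n%:R - (x + j%:~R / n%:R) - k%:~R = (i - j - k * n%:Z)%:~R / n%:R :> R.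
    rewrite !(intrB, intrM) !mulrBl mulfK//; ring.
  rewrite dE normrM (ger0_norm (_ : 0 <= n%:R^-1)) ?invr_ge0// in kE.
  have n1 : n%:R^-1 <= 1 :> R by rewrite invf_le1 ?ler1n.
  have small (p : int) (m : nat) : p = m%:Z -> m%:R / n%:R < r -> `|(p %% n)%Z|%N = m.
    move=> -> mr; rewrite modz_small//; apply/andP; split=> //.
    rewrite ltz_nat -(ltr_nat R); move: mr; rewrite ltr_pdivrMr//; move: r8 => r8 h.
    by apply: lt_le_trans h _; rewrite ger_pMl//; lra.
  case: (i - j - k * n%:Z =P 0) => [z0|/eqP zn0].
    right; right; apply: density_diag => //; rewrite kE z0 mulr0z normr0 mul0r //.
  set z := i - j - k * n%:Z in kE zn0 dE.
  have zabs : `|z%:~R| = `|z|%N%:R :> R by rewrite -intr_norm -abszE.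
  rewrite zabs in kE.
  rewrite kE in near.
  have absz0 : (0 < `|z|)%N by rewrite absz_gt0.
  have [zp|zp] := leP 0 z.
    right; left; rewrite /fwd.
    have -> : ((i - j) %% n = z %% n)%Z.
      by rewrite (_ : z = - k * n%:Z + (i - j)) ?modzMDl// /z; ring.
    by rewrite (small z `|z|%N) ?gez0_abs// absz0.
  left; rewrite /fwd.
  have -> : ((j - i) %% n = (- z) %% n)%Z.
    by rewrite (_ : - z = k * n%:Z + (j - i)) ?modzMDl// /z; ring.
  by rewrite (small (- z) `|z|%N) ?ltz0_abs// absz0.
(* The shift charges the pair (i, j) to t in cell i - 1 and s in cell j + 1, so that [t, s] encloses
   the arc between the vertices as [near_density_compare] demands. *)
pose B (i' j' : nat) := gf (1 + i'%:Z) (-1 + j'%:Z).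
have B0 i' j' : 0 <= B i' j' by exact: gf0.
have [mB EB] := dint_cell n0 B0.
have shift : \sum_(i < n) \sum_(j < n) B i j / n%:R ^+ 2 =
    \sum_(i < n) \sum_(j < n) gf i%:Z j%:Z / n%:R ^+ 2.
  rewrite -(sum_cyclic_shift (n := n) (h := fun i => \sum_(j < n) gf i j%:Z / n%:R ^+ 2) 1); last first.
    by move=> k; apply: eq_bigr => j _; rewrite gfnl.
  apply: eq_bigr => i _.
  by rewrite -(sum_cyclic_shift (n := n) (h := fun j => gf (1 + i%:Z) j / n%:R ^+ 2) (-1))// => k; rewrite gfnr.
have C0 : 0 <= 4 ^+ 5 / l ^+ 2 by rewrite divr_ge0 ?sqr_ge0// exprn_ge0.
have mN := dint_fun_near_density ce cl (4 * r).
have [mC EC] := dintZ C0 mN.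
have main : (dint (fun t s => B (cell n t) (cell n s)) <=
    (4 ^+ 5 / l ^+ 2)%:E * dint (near_density c (4 * r)))%E.
  rewrite -EC; apply: dint_le => // t s; rewrite /= !in_itv/= => /andP[t0 t1] /andP[s0 s1].
  set i' := cell n t; set j' := cell n s.
  have nd0 := near_density_ge0 (4 * r) t s ce cl.
  rewrite /B /gf; case: ifPn => [|_]; last by rewrite mulr_ge0.
  set i : int := 1 + i'%:Z; set j : int := -1 + j'%:Z; rewrite /fwd.
  set m := `|((j - i) %% n)%Z|%N => /andP[m0 mr].
  pose k := ((j - i) %/ n)%Z.
  have jE : j = i + m%:Z + k * n%:Z.
    have mE : m%:Z = ((j - i) %% n)%Z by rewrite gez0_abs ?modz_ge0.
    have h : j - i = k * n%:Z + m%:Z by rewrite mE -divz_eq.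
    by rewrite -[LHS](subrK i j) h; ring.
  rewrite jE gnr -(near_density_periodr (4 * r) t s (- k) cc).
  apply: near_density_compare => //.
    have /andP[h1 h2] := cell_itv n0 t0.
    have ei1 : i - 1 = i'%:Z by rewrite /i; ring.
    have ei2 : i = i'.+1%:Z by rewrite /i -PoszD.
    by rewrite ei1 h1 ei2 ltW.
  have /andP[h1 h2] := cell_itv n0 s0; rewrite -/j' in h1 h2.
  have e1 : i + m%:Z + 1 = j'%:Z - k * n%:Z by rewrite -(addrK (k * n%:Z) (i + m%:Z)) -jE /j; ring.
  have e2 : i + m%:Z + 2 = j'%:Z + 1 - k * n%:Z by rewrite -(addrK (k * n%:Z) (i + m%:Z)) -jE /j; ring.
  rewrite e1 e2 !(intrB, intrM, intrD) !mulrBl mulfK// mulrNz.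
  by rewrite !lerD2r h1 -intrD -[(j'%:Z + 1)%R]/(Posz (j' + 1)%N) addn1 ltW.
rewrite EB shift in main.
have tot : \sum_(i < n) \sum_(j < n) near_density q r (x + i%:R / n%:R) (x + j%:R / n%:R) / n%:R ^+ 2
    <= 2 * \sum_(i < n) \sum_(j < n) gf i%:Z j%:Z / n%:R ^+ 2.
  rewrite mulr_natl mulr2n [X in _ <= _ + X]exchange_big/= -big_split/=; apply: ler_sum => i _.
  rewrite -big_split/=; apply: ler_sum => j _.
  rewrite -mulrDl ler_wpM2r ?invr_ge0 ?sqr_ge0//; exact: (split_g i%:Z j%:Z).
apply: (@le_trans _ _ (2 * \sum_(i < n) \sum_(j < n) gf i%:Z j%:Z / n%:R ^+ 2)%:E).
  by rewrite lee_fin.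
by rewrite !EFinM -muleA lee_pmul2l.
Qed.

End NearSum.

(** * The two inequalities of Gamma-convergence *)

Section GammaConvergence.
Context {R : realType}.
Local Notation V := 'rV[R]_3.

Lemma lattice_energy_split n (x r : R) (q : R -> V) : lattice_energy n x q =
  \sum_(i < n) \sum_(j < n) near_density q r (x + i%:R / n%:R) (x + j%:R / n%:R) / n%:R ^+ 2 +
  \sum_(i < n) \sum_(j < n) far_density q r (x + i%:R / n%:R) (x + j%:R / n%:R) / n%:R ^+ 2.
Proof.
rewrite -big_split/=; apply: eq_bigr => i _; rewrite -big_split/=; apply: eq_bigr => j _.
by rewrite -mulrDl /near_density /far_density; case: ifP; rewrite ?addr0 ?add0r.
Qed.

(** The constant of [near_sum] depends on [c] only, through the bi-Lipschitz bound of its polygons.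
    So the cut-off can be chosen first to make the near part at most w / 2, and then [h] and n to
    keep the excess of the far part below w / 2. *)
Lemma recovery (c : R -> V) : embedded c -> lipschitz1 c ->
  (dint (density c) < +oo)%E -> forall w, 0 < w -> exists N : nat, forall n, (N <= n)%N ->
  exists q, [/\ equilateral_polygons n q, embedded q, ambient_isotopic (range q) (range c) &
    (discrete_energy n q <= dint (density c) + w%:E)%E].
Proof.
move=> ce cl fin w w0.
have [l l0 [h0 h00 [N0 HN0]]] := equilateral_approx_isotopic ce cl fin.
pose C : R := 2 * (4 ^+ 5 / l ^+ 2).
have C0 : 0 < C by rewrite mulr_gt0// divr_gt0// exprn_gt0.
have wC : 0 < w / 2 / C by rewrite !divr_gt0.
have [r0 r00 near0] := dint_near_small ce cl fin wC.
(* [near_sum] enlarges the cut-off by the factor 4, so 4 r must be at most [r0]. *)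
pose r := Num.min 8^-1 (r0 / 4).
have r8 : r <= 8^-1 by rewrite ge_min lexx.
have rr0 : 4 * r <= r0.
  have : r <= r0 / 4 by rewrite ge_min lexx orbT.
  by lra.
have r_gt0 : 0 < r by rewrite lt_min; apply/andP; split; lra.
have w2 : 0 < w / 2 by rewrite divr_gt0.
have [h1 h10 [N1 HN1]] := lattice_energy_far_le ce cl r_gt0 w2.
pose h := Num.min h0 (h1 / 2).
have hh0 : h <= h0 by rewrite ge_min lexx.
have hh1 : h <= h1 / 2 by rewrite ge_min lexx orbT.
have h_gt0 : 0 < h by rewrite lt_min; apply/andP; split; lra.
have [N2 HN2] := exists_equilateral_approx ce cl fin h_gt0.
have h14 : 0 < h1 / 4 by rewrite divr_gt0.
have [N3 HN3] := inv_small h14.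
exists (maxn (maxn N0 N1) (maxn N2 N3)) => n; rewrite !geq_max => /andP[/andP[n0 n1] /andP[n2 n3]].
have [n_gt1 [q qa]] := HN2 n n2.
have [n_gt0 nh] := HN3 n n3.
have [qbl iso] := HN0 n h q n0 (introT andP (conj (ltW h_gt0) hh0)) qa.
have [qc ql qp _ qd qdef] := qa.
have qe := bilipschitz_embedded qc l0 qbl.
exists q; split=> //.
have [x xn ->] := discrete_energyE qe qp.2.
have cq t : enorm (c t - q t) <= h1.
  apply: le_trans (ler_enorm_trans (inscribed c n t) _ _) _.
  by have := inscribed_close cl t n_gt0; rewrite enorm_distC; have := qd t; lra.
have far := HN1 n q x n1 qe ql cq xn.
have near := near_sum ce cl qe ql l0 qbl qdef n_gt0 r8 xn.
rewrite (lattice_energy_split n x r q) EFinD.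
set S1 := \sum_(i < n) _ in near *; set S2 := \sum_(i < n) _ in far *.
have near_mono : (dint (near_density c (4 * r)) <= (w / 2 / C)%:E)%E.
  apply: le_trans (ltW near0); apply: dint_le; try exact: dint_fun_near_density.
  move=> t s _ _; rewrite /near_density; case: ifPn => [lt4|_].
    by rewrite ifT// (lt_le_trans lt4).
  by case: ifP => // _; exact: density_ge0.
have near' : (S1%:E <= (w / 2)%:E)%E.
  apply: le_trans near _; rewrite -/C.
  have C0e : (0 <= C%:E)%E by rewrite lee_fin ltW.
  apply: le_trans (lee_wpmul2l C0e near_mono) _.
  by rewrite -EFinM mulrC divfK// lt0r_neq0.
have -> : w = w / 2 + w / 2 by lra.
by rewrite EFinD addeA [leRHS]addeC; apply: leeD.
Qed.

Lemma liminf_bound (g : R -> V) (p : nat -> R -> V) : embedded g -> lipschitz1 g ->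
  (\forall n \near \oo, [/\ embedded (p n), lipschitz1 (p n) & equilateral_polygons n (p n)]) ->
  (forall h, 0 < h -> \forall n \near \oo, forall t, enorm (g t - p n t) <= h) ->
  forall A : R, (A%:E < dint (density g))%E ->
  \forall n \near \oo, (A%:E <= discrete_energy n (p n))%E.
Proof.
move=> ge gl hp hu A hA.
(* The margin A2 - A is spent on the discretization error. *)
have [A2 AA2 hA2] : exists2 A2 : R, A < A2 & (A2%:E < dint (density g))%E.
  move: hA; case: (dint (density g)) => [x| |] //.
    rewrite lte_fin => Ax; exists ((A + x) / 2); rewrite ?lte_fin; lra.
  by move=> _; exists (A + 1); rewrite ?ltry//; lra.
have [r r0 hr] := lt_dint_far ge gl hA2.
have w0 : 0 < A2 - A by rewrite subr_gt0.
have [h h0 [N HN]] := lattice_energy_ge ge gl r0 w0.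
have hN : \forall n \near \oo, (N <= n)%N by exists N.
near=> n.
have [pe pl pp] : [/\ embedded (p n), lipschitz1 (p n) & equilateral_polygons n (p n)] by near: n.
have [x xn ->] := discrete_energyE pe pp.2.
have nN : (N <= n)%N by near: n.
have pu : forall t, enorm (g t - p n t) <= h by near: n; exact: hu.
have := le_trans (ltW hr) (HN n (p n) x nN pe pl pu xn).
by rewrite !lee_fin; lra.
Unshelve. all: by end_near. Qed.

(** The distance of the two curves is 2-Lipschitz in the parameter: if it exceeds [h] somewhere, it
    is at least h / 2 on an interval of length L <= h / 4. As L <= 1/2, such an interval fits into
    [0, 1] on one side of the point. *)
Lemma L1_cvg_uniform (g : R -> V) (p : nat -> R -> V) : closed_curve g -> lipschitz1 g ->
  (\forall n \near \oo, closed_curve (p n) /\ lipschitz1 (p n)) ->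
  (fun n => \int[lebesgue_measure]_(t in `[0%R, 1%R]) (enorm (p n t - g t))%:E)%E @ \oo --> 0%E ->
  forall h, 0 < h -> \forall n \near \oo, forall t, enorm (g t - p n t) <= h.
Proof.
move=> gc gl hp hL h h0.
pose L := Num.min (h / 4) 2^-1.
have L0 : 0 < L by rewrite lt_min; apply/andP; split; lra.
have L4 : L <= h / 4 by rewrite ge_min lexx.
have L2 : L <= 2^-1 by rewrite ge_min lexx orbT.
have hL0 : 0 < h / 2 * L by rewrite mulr_gt0// divr_gt0.
have small : \forall n \near \oo,
    (\int[lebesgue_measure]_(t in `[0%R, 1%R]) (enorm (p n t - g t))%:E < (h / 2 * L)%:E)%E.
  apply: (hL [set x | (x < (h / 2 * L)%:E)%E]).
  by apply: open_nbhs_nbhs; split; [exact: open_ereal_lt_ereal | rewrite /= lte_fin].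
near=> n.
have [pc pl] : closed_curve (p n) /\ lipschitz1 (p n) by near: n.
have sn : (\int[lebesgue_measure]_(t in `[0%R, 1%R]) (enorm (p n t - g t))%:E < (h / 2 * L)%:E)%E.
  by near: n.
pose f t := enorm (p n t - g t).
have fl s t : `|f s - f t| <= 2 * `|s - t|.
  apply: le_trans (ler_dist_enorm _ _) _.
  rewrite (_ : p n s - g s - (p n t - g t) = (p n s - p n t) - (g s - g t)); last first.
    by rewrite !opprB addrACA [RHS]addrACA (addrC (- g s)).
  apply: le_trans (ler_enormB _ _) _; have := pl t s; have := gl t s; lra.
suff main t : 0 <= t <= 1 -> f t <= h.
  move=> t; have /andP[t1 t2] := floor_itv t; move: t2; rewrite intrD => t2.
  rewrite enorm_distC -[t](subrK (Num.floor t)%:~R) !closed_curve_period//.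
  by apply: main; apply/andP; split; lra.
move=> /andP[t0 t1]; rewrite leNgt; apply/negP => ft.
have [a [a0 a1 at_]] : exists a : R, [/\ 0 <= a, a + L <= 1 & forall s, a <= s <= a + L -> `|t - s| <= L].
  have [th|th] := leP t 2^-1.
    by exists t; split => //; [lra | move=> s /andP[s1 s2]; rewrite ler_norml; apply/andP; split; lra].
  by exists (t - L); split; [lra | lra | move=> s /andP[s1 s2]; rewrite ler_norml; apply/andP; split; lra].
have fc : continuous f.
  have -> : f = fun t => enorm (p n t - g t) by [].
  move=> s; apply: (@continuous_comp _ _ _ (fun t => p n t - g t) enorm); last exact: enorm_continuous.
  by apply: cvgB; [exact: pc.1 | exact: gc.1].
have mf : measurable_fun setT (fun t => (f t)%:E).
  by apply/measurable_EFinP; exact: continuous_measurable_fun.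
have sub : `[a, a + L]%classic `<=` (`[0, 1]%classic : set R).
  by move=> s /=; rewrite !in_itv/= => /andP[s1 s2]; apply/andP; split; lra.
suff : ((h / 2 * L)%:E <= \int[lebesgue_measure]_(t in `[0%R, 1%R]) (f t)%:E)%E.
  by apply/negP; rewrite -ltNge.
apply: (@le_trans _ _ (\int[lebesgue_measure]_(s in `[a, (a + L)%R]) (f s)%:E)%E); last first.
  apply: ge0_subset_integral => //; first exact: measurable_funTS.
  by move=> s _; rewrite lee_fin enorm_ge0.
apply: (@le_trans _ _ (\int[lebesgue_measure]_(s in `[a, (a + L)%R]) (h / 2)%:E)%E).
  have mu : lebesgue_measure (`[a, a + L]%classic : set R) = L%:E.
    by rewrite lebesgue_measure_itv/= lte_fin ltrDl L0 -EFinB addrC addKr.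
  by rewrite integral_cst// EFinM -mu.
apply: ge0_le_integral => //.
- by move=> s _; rewrite lee_fin divr_ge0// ltW.
- exact: measurable_funTS.
- move=> s /=; rewrite in_itv/= => /at_ ts; rewrite lee_fin.
  by have := fl t s; rewrite ler_norml; lra.
Unshelve. all: by end_near. Qed.

End GammaConvergence.

(** * Convergence of almost minimizers *)

Unset Implicit Arguments.
Set Strict Implicit.

Theorem corollary2 (R : realType) (K : set (R -> 'rV[R]_3))
    (p : nat -> R -> 'rV[R]_3) (gamma : R -> 'rV[R]_3)
    (K_class : knot_class K) (K_tame : tame K) (K_prime : prime_knot K)
    (p_in : \forall n \near \oo, (equilateral_polygons n `&` K) (p n))
    (p_almost_min :
      (fun n => `| ereal_inf [set discrete_energy n q | q in equilateral_polygons n `&` K]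
                   - discrete_energy n (p n) |)%E @ \oo --> 0%E)
    (gamma_in : (arclength_curves `&` K) gamma)
    (p_cvg_L1 :
      (fun n => \int[lebesgue_measure]_(t in `[0%R, 1%R])
                  (enorm (p n t - gamma t))%:E)%E @ \oo --> 0%E) :
  is_minimizer (arclength_curves `&` K) moebius_energy gamma /\
  (fun n => discrete_energy n (p n)) @ \oo --> moebius_energy gamma.
Proof.
have [c0 [c0e KE]] := K_class.
have Kemb c : K c -> embedded c by rewrite KE => -[].
have [gamma_arc gammaK] := gamma_in.
have ge := Kemb _ gammaK; have gl : lipschitz1 gamma := arclength_lipschitz1 gamma_arc.
have [gc _] := ge.
have p_reg : \forall n \near \oo,
    [/\ embedded (p n), lipschitz1 (p n) & equilateral_polygons n (p n)].
  apply: filterS p_in => n [pp pK]; split=> //; first exact: Kemb.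
  by case: pp => /arclength_lipschitz1.
have unif := L1_cvg_uniform gc gl _ p_cvg_L1.
have lower : forall A : R, (A%:E < moebius_energy gamma)%E ->
    \forall n \near \oo, (A%:E <= discrete_energy n (p n))%E.
  rewrite (moebius_energyE ge gl); apply: liminf_bound => //; apply: unif.
  by apply: filterS p_reg => n [[]].
(* Allows [p_almost_min] and the final limit to be read as statements about real numbers. *)
have fin_p : \forall n \near \oo, discrete_energy n (p n) \is a fin_num.
  by apply: filterS p_reg => n [pe _ pp]; have [x _ ->] := discrete_energyE pe pp.2.
have upper c : (arclength_curves `&` K) c -> forall (x w : R), moebius_energy c = x%:E ->
    0 < w -> \forall n \near \oo, (discrete_energy n (p n) <= (x + w)%:E)%E.
  move=> [c_arc cK] x w cx w0.
  have ce := Kemb _ cK; have cl : lipschitz1 c := arclength_lipschitz1 c_arc.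
  rewrite (moebius_energyE ce cl) in cx.
  have w2 : 0 < w / 2 by rewrite divr_gt0.
  have [|N HN] := recovery ce cl _ w2; first by rewrite cx ltry.
  have gap : \forall n \near \oo,
      (`|ereal_inf [set discrete_energy n q | q in equilateral_polygons n `&` K]
         - discrete_energy n (p n)| < (w / 2)%:E)%E.
    apply: (p_almost_min [set y | (y < (w / 2)%:E)%E]).
    by apply: open_nbhs_nbhs; split; [exact: open_ereal_lt_ereal | rewrite /= lte_fin].
  have hN : \forall n \near \oo, (N <= n)%N by exists N.
  near=> n.
  have nN : (N <= n)%N by near: n.
  have gapn : (`|ereal_inf [set discrete_energy n q | q in equilateral_polygons n `&` K]
         - discrete_energy n (p n)| < (w / 2)%:E)%E by near: n.
  have finn : discrete_energy n (p n) \is a fin_num by near: n.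
  have [q [qp qe qc qE]] := HN n nN.
  have qK : K q.
    (* The reference knot of the class and the polygon [q] are both isotopic to [c]. *)
    rewrite KE; split=> //; apply: ambient_isotopic_join qc.
    by move: cK; rewrite KE => -[].
  have : (ereal_inf [set discrete_energy n q | q in equilateral_polygons n `&` K]
      <= (x + w / 2)%:E)%E.
    apply: le_trans (_ : discrete_energy n q <= _)%E; last by rewrite EFinD -cx.
    by apply: ereal_inf_lbound; exists q.
  move: gapn finn; case: (ereal_inf _) => [m| |]; case: (discrete_energy n (p n)) => [y| |] //.
  by rewrite -EFinB abse_EFin !lte_fin !lee_fin ltr_norml; lra.
have ge0 : (0 <= moebius_energy gamma)%E.
  by rewrite (moebius_energyE ge gl); exact/dint_ge0/dint_fun_density.
split.
  split; first exact: gamma_in.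
  move=> c cAK; rewrite leNgt; apply/negP => cg.
  have c0' : (0 <= moebius_energy c)%E.
    have [c_arc cK] := cAK; have ce := Kemb _ cK.
    have cl : lipschitz1 c := arclength_lipschitz1 c_arc.
    by rewrite (moebius_energyE ce cl); exact/dint_ge0/dint_fun_density.
  have [x cx] : exists x : R, moebius_energy c = x%:E.
    exists (fine (moebius_energy c)); rewrite fineK// ge0_fin_numE//.
    exact: lt_le_trans cg (leey _).
  have [A xA Ag] : exists2 A : R, x < A & (A%:E < moebius_energy gamma)%E.
    move: cg; rewrite cx; case: (moebius_energy gamma) => [y| |] //.
      by rewrite lte_fin => xy; exists ((x + y) / 2); rewrite ?lte_fin; lra.
    by move=> _; exists (x + 1); rewrite ?ltry//; lra.
  (* The discrete energies would eventually be at least A by the lower bound for [gamma], and at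
     most (x + A) / 2 < A by the upper bound for [c]. *)
  have w0 : 0 < (A - x) / 2 by lra.
  have [N _ hN] : \forall n \near \oo, (A%:E <= discrete_energy n (p n))%E /\
      (discrete_energy n (p n) <= (x + (A - x) / 2)%:E)%E.
    by apply: filterI; [exact: lower | exact: upper cx w0].
  have [h1 h2] := hN N (leqnn N).
  by have := le_trans h1 h2; rewrite lee_fin; lra.
(* If the energy of [gamma] is infinite, the lower bound for all real A is itself the convergence to
   +oo. *)
move: ge0 lower; case E : (moebius_energy gamma) => [x| |] // _ lower; last first.
  apply/cvgeyPge => A; apply: lower; exact: ltry.
apply/fine_cvgP; split=> //; apply/cvgrPdist_le => w w0.
have low : ((x - w)%:E < x%:E)%E by rewrite lte_fin; lra.
near=> n.
have h1 : ((x - w)%:E <= discrete_energy n (p n))%E by near: n; exact: lower.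
have h2 : (discrete_energy n (p n) <= (x + w)%:E)%E by near: n; exact: upper E w0.
move: h1 h2 => /=; case: (discrete_energy n (p n)) => [y| |] //=.
by rewrite !lee_fin ler_norml; lra.
Unshelve. all: by end_near. Qed.
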